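(* Let $\alpha,\beta$ be compositions and $m$ a positive integer. Then: (1) (Right Pieri rule) $\mathsf{RS}_\alpha E_m=\sum_{\alpha\subset^{sh}_m\delta}\mathsf{RS}_\delta$, summed over compositions $\delta$. (2) (Right ribbon multiplication) $\mathsf{RS}_\alpha R_\beta=\sum_{\gamma}\sum_U\mathsf{RS}_\gamma$, where the outer sum is over compositions $\gamma$ of $|\alpha|+|\beta|$ and the inner sum is over all standard skew row-strict shin-tableaux $U$ of shape $\gamma/\alpha$ with $co_{RS}(U)=\beta$. (3) $E_\beta=\sum_\alpha\mathcal{K}_{\alpha,\beta}\mathsf{RS}_\alpha$ and $R_\beta=\sum_\alpha\mathcal{L}_{\alpha,\beta^c}\mathsf{RS}_\alpha$. (4) $\chi(\mathsf{RS}_\lambda)=s_{\lambda'}$ for every partition $\lambda$, and $\chi(\mathsf{RS}_\alpha)=0$ when $\alpha$ is not a partition. (5) If $\gamma$ is a composition with $\gamma_i<\gamma_{i+1}$ for all $1\le i<\ell(\gamma)$, then $\mathsf{RS}_\gamma=\sum_\sigma(-1)^\sigma E_{\gamma_{\sigma(1)}}E_{\gamma_{\sigma(2)}}\cdots E_{\gamma_{\sigma(\ell(\gamma))}}$, where the sum runs over $\sigma\in S_{\ell(\gamma)}$ such that $\sigma(i)\ge i-1$ for all $i\in\{1,\ldots,\ell(\gamma)\}$. (6) $E_\beta=\sum_\alpha\mathcal{K}^{RS}_{\alpha,\beta}\mathsf{Sh}_\alpha$ and $R_\beta=\sum_\alpha\mathcal{L}^{RS}_{\alpha,\beta^c}\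mathsf{Sh}_\alpha$.
   Context: Compositions: finite (possibly empty) sequences $\alpha=(\alpha_1,\ldots,\alpha_k)$ of positive integers, $|\alpha|=\sum\alpha_i$, $\ell(\alpha)=k$, $\alpha_i=0$ for $i>k$. The diagram of $\alpha$ is left-justified with $\alpha_i$ boxes in the $i$th row from the top. $\beta\subseteq\alpha$ means $\ell(\beta)\le\ell(\alpha)$ and $\beta_i\le\alpha_i$ for all $i$; $\alpha/\beta$ is the diagram of $\alpha$ with the first $\beta_i$ boxes of each row $i$ removed. For $\alpha$ of size $n$, $set(\alpha)=\{\alpha_1,\alpha_1+\alpha_2,\ldots,\alpha_1+\cdots+\alpha_{k-1}\}\subseteq[n-1]$; the inverse bijection is $comp$; $\alpha^c=comp([n-1]\setminus set(\alpha))$. $\lambda'$ is the conjugate of a partition $\lambda$. $NSym=\mathbb{Q}\langle H_1,H_2,\ldots\rangle$ (free associative algebra), $H_\alpha=H_{\alpha_1}\cdots H_{\alpha_k}$. Ribbon basis: $R_\alpha=\sum_{\beta}(-1)^{\ell(\alpha)-\ell(\beta)}H_\beta$ over all coarsenings $\beta$ of $\alpha$ (i.e. $set(\beta)\subseteq set(\alpha)$). Elementary basis: $E_n=\sum_{\beta\models n}(-1)^{n-\ell(\beta)}H_\beta$, $E_\alpha=E_{\alpha_1}\cdots E_{\alpha_k}$. $QSym$ (quasisymmetric functions over $\mathbb{Q}$) has monomial basis $M_\alpha=\sum_{i_1<\cdots<i_k}x_{i_1}^{\alpha_1}\cdots x_{i_k}^{\alpha_k}$, and the pairing is $\langle H_\alpha,M_\beta\rangle=\delta_{\alpha,\beta}$.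 The forgetful map $\chi:NSym\to Sym$ is the algebra map with $\chi(H_n)=h_n$; $s_\lambda$ is the Schur function. Write $\alpha\subset^{sh}_r\beta$ if $\beta_i\ge\alpha_i$ for all $i$, $|\beta|=|\alpha|+r$, and whenever $\beta_i>\alpha_i$ one has $\beta_j\le\alpha_i$ for all $j>i$. The shin basis $\{\mathsf{Sh}_\alpha\}$ of $NSym$ is the unique family with $\mathsf{Sh}_\emptyset=1$ and $\mathsf{Sh}_\alpha H_r=\sum_{\alpha\subset^{sh}_r\beta}\mathsf{Sh}_\beta$ for all $\alpha$, $r\ge1$. A shin-tableau of shape $\alpha$ is a filling of the diagram of $\alpha$ by positive integers with rows weakly increasing (left to right) and columns strictly increasing (top to bottom). A row-strict shin-tableau of shape $\alpha$ is a filling with rows strictly increasing and columns weakly increasing. The type of a tableau $T$ is $(t_1,t_2,\ldots)$ with $t_p$ the number of entries equal to $p$, and $x^T=\prod x_p^{t_p}$. A tableau with $n$ boxes is standard if it contains each of $1,\ldots,n$ exactly once. A skew row-strict shin-tableau of shape $\alpha/\beta$ ($\beta\subseteq\alpha$) is a filling of $\alpha/\beta$ with positive integers such that each row is strictly increasing left to right, each column is weakly increasing top to bottom, and, if $\alpha_i>\beta_i$, then $\beta_j\le\beta_i$ for all $j>i$. For a standard tableau $U$ with $n$ boxes (skew or not): $Des_{sh}(U)=\{i\in[n-1]:i+1\text{ is in a strictly lower row than }i\}$, $Des_{RS}(U)=\{i\in[n-1]:i+1\text{ is in the same row as or a higher row than }i\}$, $co_{sh}(U)=comp(Des_{sh}(U))$,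 $co_{RS}(U)=comp(Des_{RS}(U))$. $\mathcal{K}_{\alpha,\beta}$ (resp. $\mathcal{K}^{RS}_{\alpha,\beta}$) is the number of shin-tableaux (resp. row-strict shin-tableaux) of shape $\alpha$ and type $\beta$; $\mathcal{L}_{\alpha,\beta}$ (resp. $\mathcal{L}^{RS}_{\alpha,\beta}$) is the number of standard shin-tableaux $U$ of shape $\alpha$ with $co_{sh}(U)=\beta$ (resp. standard row-strict shin-tableaux with $co_{RS}(U)=\beta$). The row-strict extended Schur function is $\mathsf{RS}^*_\alpha=\sum_Tx^T$ over row-strict shin-tableaux $T$ of shape $\alpha$; these form a basis of $QSym$, and the row-strict shin basis $\{\mathsf{RS}_\alpha\}$ of $NSym$ is its dual basis. *)

(* Defs.v *)
From HB Require Import structures.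
From mathcomp Require Import all_boot all_fingroup all_algebra finmap.
From mathcomp.multinomials Require Import monalg mpoly.

Set Implicit Arguments.
Unset Strict Implicit.
Unset Printing Implicit Defensive.

Import GRing.Theory.
Local Open Scope ring_scope.

(** * Compositions *)

Record composition :=
  Composition { parts :> seq nat; parts_pos : 0%N \notin parts }.

HB.instance Definition _ := [isSub for parts].
HB.instance Definition _ := [Choice of composition by <:].

Lemma mkcomp_subproof (s : seq nat) : 0%N \notin [seq x <- s | (0 < x)%N].
Proof. by rewrite mem_filter. Qed.

(* Zero entries are dropped; lists of positive integers are unchanged. *)
Definition mkcomp (s : seq nat) : composition :=
  Composition (mkcomp_subproof s).

Lemma parts_inj : injective parts.
Proof. exact: val_inj. Qed.

Lemma mkcompK (a : composition) : mkcomp a = a.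
Proof.
apply: val_inj => /=; apply/all_filterP/allP => x xa; rewrite lt0n.
by apply: contraNneq (parts_pos a) => <-.
Qed.

Lemma mkcomp_id (s : seq nat) : 0%N \notin s -> mkcomp s = s :> seq nat.
Proof. by move=> s0; rewrite -[s]/(parts (Composition s0)) mkcompK. Qed.

(* 0-based indexing: [part a i] is the part numbered i + 1, and it is 0 beyond
   the length. *)
Definition part (a : seq nat) (i : nat) : nat := nth 0%N a i.

(* Compositions of m + 1: either the first part is 1, or it is obtained by
   incrementing the first part of a composition of m. *)
Fixpoint comps_seq (n : nat) : seq (seq nat) :=
  if n is m.+1 then
    [seq 1%N :: s | s <- comps_seq m] ++
    [seq (head 0%N s).+1 :: behead s | s <- comps_seq m & s != [::]]
  else [:: [::]].

Definition comps (n : nat) : seq composition := map mkcomp (comps_seq n).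

Lemma mem_comps_seq n s :
  (s \in comps_seq n) = (0%N \notin s) && (sumn s == n).
Proof.
elim: n s => [|n IHn] s /=.
  by case: s => [|[|x] s]; rewrite ?inE //= ?in_cons //= andbF.
rewrite mem_cat; apply/idP/idP.
  case/orP=> /mapP[t].
    by rewrite IHn => /andP[t0 /eqP<-] -> /=; rewrite in_cons t0 eqxx.
  rewrite mem_filter IHn => /and3P[tn t0 /eqP<-] ->.
  case: t tn t0 => [//|x t] _ /=; rewrite !in_cons !negb_or => /andP[_ ->] /=.
  by rewrite addSn eqxx.
case: s => [|[|[|x]] s] //=.
  rewrite in_cons /= => /andP[s0]; rewrite eqSS => sn.
  by apply/orP; left; apply: map_f; rewrite IHn s0.
rewrite in_cons /= => /andP[s0]; rewrite addSn eqSS => sn.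
apply/orP; right; apply/mapP; exists (x.+1 :: s) => //.
by rewrite mem_filter /= IHn in_cons /= s0.
Qed.

Lemma mem_comps n (a : composition) : (a \in comps n) = (sumn a == n).
Proof.
apply/mapP/idP => [[s] | /eqP an].
  rewrite mem_comps_seq => /andP[s0 sn] ->.
  by rewrite mkcomp_id.
by exists (parts a); rewrite ?mkcompK // mem_comps_seq parts_pos an eqxx.
Qed.

Lemma uniq_comps n : uniq (comps n).
Proof.
rewrite map_inj_in_uniq; last first.
  move=> s t; rewrite !mem_comps_seq => /andP[s0 _] /andP[t0 _].
  by move/(congr1 parts); rewrite !mkcomp_id.
elim: n => [//|n IHn] /=; rewrite cat_uniq map_inj_uniq ?IHn /=; last first.
  by move=> s t [].
apply/andP; split.
  apply/hasPn => s /mapP[t]; rewrite mem_filter mem_comps_seq => /and3P[].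
  case: t => [//|x t] _; rewrite in_cons negb_or => /andP[x0 _] _ -> /=.
  by apply/mapP => -[u _ [/eqP]]; rewrite eq_sym (negPf x0).
rewrite map_inj_in_uniq ?filter_uniq //.
move=> s t; rewrite !mem_filter => /andP[s0 _] /andP[t0 _].
by case: s s0 => [//|x s] _; case: t t0 => [//|y t] _ /= [-> ->].
Qed.

(* set(a) = {a_1, a_1 + a_2, ..., a_1 + ... + a_{k-1}} *)
Definition psums (a : seq nat) : seq nat :=
  [seq sumn (take i a) | i <- iota 1 (size a).-1].

(* comp(S) for a subset S of {1, ..., n-1}: the successive differences of the
   list 0, elements of S in increasing order, n; for n = 0 this yields the
   empty composition. *)
Definition comp_of (n : nat) (S : pred nat) : composition :=
  mkcomp (pairmap (fun x y => (y - x)%N) 0%N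
            (rcons [seq i <- iota 1 n.-1 | S i] n)).

Definition comp_compl (a : composition) : composition :=
  comp_of (sumn a) (fun i => i \notin psums a).

(* [coarsens b a], for |a| = |b|, says that b is a coarsening of a. *)
Definition coarsens (b a : seq nat) : bool :=
  all (fun i => i \in psums a) (psums b).

Definition is_partition (a : seq nat) : bool := sorted geq a.

Definition conj_part (l : seq nat) : seq nat :=
  [seq count (fun x => j < x)%N l | j <- iota 0 (head 0%N l)].

Definition contained (b a : seq nat) : bool :=
  (size b <= size a)%N && [forall i : 'I_(size b), (part b i <= part a i)%N].

(* The relation written alpha \subset^{sh}_r beta. *)
Definition shin_sub (r : nat) (a b : seq nat) : bool :=
  [&& [forall i : 'I_(size a), (part a i <= part b i)%N],
      sumn b == (sumn a + r)%N
    & [forall i : 'I_(size b), (part a i < part b i)%N ==>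
        [forall j : 'I_(size b), (i < j)%N ==> (part b j <= part a i)%N]]].

(** * Tableaux *)

(* Boxes of g / a, given by their row and column. *)
Definition box (g a : seq nat) : Type :=
  {b : 'I_(size g) * 'I_(sumn g) | (part a b.1 <= b.2 < part g b.1)%N}.

HB.instance Definition _ g a := Finite.on (box g a).

Definition box_row {g a} (b : box g a) : nat := (val b).1.
Definition box_col {g a} (b : box g a) : nat := (val b).2.

(* Fillings of g / a with entries in {1, ..., N}; the element p of 'I_N stands
   for the entry p + 1. *)
Definition filling (g a : seq nat) (N : nat) : Type := {ffun box g a -> 'I_N}.

HB.instance Definition _ g a N := Finite.on (filling g a N).

Definition full_filling (g a : seq nat) : Type := filling g a #|{: box g a}|.

HB.instance Definition _ g a := Finite.on (full_filling g a).

Section Fillings.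
Variables (g a : seq nat) (N : nat).
Implicit Type T : {ffun box g a -> 'I_N}.

Definition rows_weak T := [forall b, forall c,
  (box_row b == box_row c) && (box_col b < box_col c)%N ==> (T b <= T c)%N].
Definition rows_strict T := [forall b, forall c,
  (box_row b == box_row c) && (box_col b < box_col c)%N ==> (T b < T c)%N].
Definition cols_weak T := [forall b, forall c,
  (box_col b == box_col c) && (box_row b < box_row c)%N ==> (T b <= T c)%N].
Definition cols_strict T := [forall b, forall c,
  (box_col b == box_col c) && (box_row b < box_row c)%N ==> (T b < T c)%N].

Definition shin_tab T := rows_weak T && cols_strict T.
Definition rs_tab T := rows_strict T && cols_weak T.

(* g / a admits skew row-strict shin-tableaux only if this holds. *)
Definition skew_shape :=
  contained a g &&
  [forall i : 'I_(size g), (part a i < part g i)%N ==>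
     [forall j : 'I_(size a), (i < j)%N ==> (part a j <= part a i)%N]].

Definition skew_rs_tab T := skew_shape && rs_tab T.

Definition tab_type T : 'X_{1..N} := [multinom #|[set b | T b == p]| | p < N].

Definition standard T := [forall p, #|[set b | T b == p]| == 1%N].

Definition Des_sh T : pred nat := fun i =>
  [exists b, exists c,
    [&& (T b).+1 == i, (T c).+1 == i.+1 & (box_row b < box_row c)%N]].
Definition Des_RS T : pred nat := fun i =>
  [exists b, exists c,
    [&& (T b).+1 == i, (T c).+1 == i.+1 & (box_row c <= box_row b)%N]].

Definition co_sh T : composition := comp_of N (Des_sh T).
Definition co_RS T : composition := comp_of N (Des_RS T).

End Fillings.

Definition comp_mnm (b : seq nat) : 'X_{1..size b} :=
  [multinom part b i | i < size b].

(* A tableau of type b has all its entries in {1, ..., size b}. *)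
Definition K_sh (a b : composition) : nat :=
  #|[set T : filling a [::] (size b) |
      shin_tab T && (tab_type T == comp_mnm b)]|.
Definition K_RS (a b : composition) : nat :=
  #|[set T : filling a [::] (size b) |
      rs_tab T && (tab_type T == comp_mnm b)]|.

Definition L_sh (a b : composition) : nat :=
  #|[set U : full_filling a [::] |
      [&& standard U, shin_tab U & co_sh U == b]]|.
Definition L_RS (a b : composition) : nat :=
  #|[set U : full_filling a [::] |
      [&& standard U, rs_tab U & co_RS U == b]]|.

(** * Noncommutative symmetric functions *)

Definition cat_comp (a b : composition) : composition := mkcomp (a ++ b).

Lemma cat_compE (a b : composition) : cat_comp a b = a ++ b :> seq nat.
Proof. by rewrite mkcomp_id // mem_cat negb_or !parts_pos. Qed.

Lemma cat_compA : associative cat_comp.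
Proof. by move=> a b c; apply: parts_inj; rewrite !cat_compE catA. Qed.

Lemma cat_comp0l : left_id (mkcomp [::]) cat_comp.
Proof. by move=> a; apply: parts_inj; rewrite cat_compE. Qed.

Lemma cat_comp0r : right_id (mkcomp [::]) cat_comp.
Proof. by move=> a; apply: parts_inj; rewrite cat_compE cats0. Qed.

Lemma cat_comp_unit (a b : composition) :
  cat_comp a b = mkcomp [::] -> a = mkcomp [::] /\ b = mkcomp [::].
Proof.
move/(congr1 parts); rewrite cat_compE /= => /eqP.
by rewrite -size_eq0 size_cat addn_eq0 !size_eq0 => /andP[/eqP ha /eqP hb];
  split; apply: val_inj.
Qed.

HB.instance Definition _ := Choice_isMonomialDef.Build composition
  cat_compA cat_comp0l cat_comp0r cat_comp_unit.

(* The compositions under concatenation are the free monoid on the positive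
   integers, so their monoid algebra is the free algebra Q<H_1, H_2, ...>. *)
Definition NSym : Type := {malg rat[composition]}.

HB.instance Definition _ := GRing.Lalgebra.on NSym.

(* H_n for n >= 1; nsH 0 = 1. *)
Definition nsH (n : nat) : NSym := << mkcomp [:: n] >>.
Definition nsHc (a : composition) : NSym := \prod_(i <- a) nsH i.

Lemma nsHcE (a : composition) : nsHc a = << a >>.
Proof.
rewrite /nsHc -{2}[a]mkcompK; elim: (parts a) => [|x s IHs].
  by rewrite big_nil.
rewrite big_cons IHs /nsH malgM_def fgmulUU mulr1.
congr << _ >>; apply: parts_inj; rewrite cat_compE /=.
by case: ifP.
Qed.

Definition nsR (a : composition) : NSym :=
  \sum_(b <- comps (sumn a) | coarsens b a) (-1) ^+ (size a - size b) *: nsHc b.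

Definition nsE (n : nat) : NSym :=
  \sum_(b <- comps n) (-1) ^+ (n - size b) *: nsHc b.
Definition nsEc (a : composition) : NSym := \prod_(i <- a) nsE i.

Definition shin_basis (Sh : composition -> NSym) : Prop :=
  Sh (mkcomp [::]) = 1 /\
  forall (a : composition) (r : nat), (0 < r)%N ->
    Sh a * nsH r = \sum_(b <- comps (sumn a + r) | shin_sub r a b) Sh b.

(** * Symmetric and quasisymmetric functions *)

(* [mpoly N rat] is the type of polynomials in N variables (the notation
   {mpoly rat[N]} is also used by monalg for another type).
   A bounded-degree power series f in x_1, x_2, ... is given by the family of
   the polynomials f(x_1, ..., x_N, 0, 0, ...), N >= 0, so that Sym and QSym
   are viewed inside the inverse limit of the polynomial rings. *)
Definition series : Type := forall N : nat, mpoly N rat.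

Definition qsM (a : composition) : series := fun N =>
  \sum_(t : (size a).-tuple 'I_N | sorted ltn (map val t))
    \prod_(k < size a) 'X_(tnth t k) ^+ part a k.

(* The coefficient of M_a in a quasisymmetric function f is the coefficient of
   x_1^{a_1} ... x_k^{a_k} in f. *)
Definition coef_M (f : series) (a : composition) : rat :=
  (f (size a))@_(comp_mnm a).

Definition pairing (F : NSym) (f : series) : rat :=
  \sum_(a <- monalg.msupp F) monalg.mcoeff a F * coef_M f a.

Definition RSstar (a : composition) : series := fun N =>
  \sum_(T : filling a [::] N | rs_tab T) 'X_[tab_type T].

Definition row_strict_shin_basis (RS : composition -> NSym) : Prop :=
  forall a b : composition, pairing (RS a) (RSstar b) = (a == b)%:R.

Definition hsym (n : nat) : series := fun N =>
  \sum_(m : 'X_{1..N < n.+1} | mdeg m == n) 'X_[m].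

(* The tableaux summed over are semistandard when l is a partition. *)
Definition schur (l : seq nat) : series := fun N =>
  \sum_(T : filling l [::] N | shin_tab T) 'X_[tab_type T].

Definition chi (F : NSym) : series := fun N =>
  \sum_(a <- monalg.msupp F) monalg.mcoeff a F *: \prod_(i <- a) hsym i N.

Lemma pairing_nsHc (a : composition) (f : series) :
  pairing (nsHc a) f = coef_M f a.
Proof.
by rewrite /pairing nsHcE monalg.msuppU1 big_seq_fset1 monalg.mcoeffU1 eqxx mul1r.
Qed.

Lemma coef_M_qsM (a b : composition) : coef_M (qsM b) a = (a == b)%:R.
Proof.
rewrite /coef_M /qsM raddf_sum /=.
have E1 (t : (size b).-tuple 'I_(size a)) :
    (\prod_(k < size b) 'X_(tnth t k) ^+ part b k : mpoly (size a) rat) =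
    'X_[(\sum_(k < size b) U_(tnth t k) *+ part b k)%MM].
  rewrite (big_morph _ (@mpolyXD _ rat) (@mpolyX0 _ rat)).
  by apply: eq_bigr => k _; rewrite mpolyXn.
under eq_bigr do rewrite E1 mcoeffX.
have t_iota (t : (size b).-tuple 'I_(size a)) : sorted ltn (map val t) ->
    (\sum_(k < size b) U_(tnth t k) *+ part b k)%MM = comp_mnm a ->
    map val t = iota 0 (size a).
  move=> ts /mnmP tE; apply: (irr_sorted_eq ltn_trans ltnn) => //.
    exact: iota_ltn_sorted.
  move=> i; rewrite mem_iota /= add0n; apply/mapP/idP => [[j _ ->]//|ia].
  exists (Ordinal ia) => //; have /eqP := tE (Ordinal ia).
  rewrite mnm_sumE mnmE; apply: contraLR => it.
  rewrite big1 => [|k _]; last first.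
    rewrite mulmnE mnm1E; case: eqP => [tk|//].
    by rewrite -tk mem_tnth in it.
  rewrite eq_sym; apply: contra (parts_pos a) => /eqP <-.
  exact: mem_nth.
have t_eq (t : (size b).-tuple 'I_(size a)) : sorted ltn (map val t) ->
    (\sum_(k < size b) U_(tnth t k) *+ part b k)%MM = comp_mnm a -> a = b.
  move=> ts tE; have ti := t_iota t ts tE; apply: parts_inj.
  have sz : size a = size b.
    by rewrite -(size_iota 0 (size a)) -ti size_map size_tuple.
  apply: (eq_from_nth (x0 := 0%N)) => // i ia.
  have ib : (i < size b)%N by rewrite -sz.
  have tk (k : 'I_(size b)) : tnth t k = k :> nat.
    rewrite (tnth_nth (Ordinal ia)) -(nth_map _ 0%N val) ?size_tuple //.
    by rewrite ti nth_iota ?add0n // sz.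
  have /mnmP/(_ (Ordinal ia)) := tE; rewrite [RHS]mnmE => tEi.
  rewrite -[LHS]tEi mnm_sumE (bigD1 (Ordinal ib)) //= big1 => [|k kb].
    rewrite addn0 mulmnE mnm1E; have -> : tnth t (Ordinal ib) = Ordinal ia.
      by apply: val_inj; rewrite /= tk.
    by rewrite eqxx mul1n.
  rewrite mulmnE mnm1E; case: eqP => [/(congr1 val)|//] /=; rewrite tk => ki.
  by case/eqP: kb; apply: val_inj.
have [ab|ab] := eqVneq a b; last first.
  apply: big1 => t ts; case: eqP => // tE.
  by case/eqP: ab; apply: t_eq tE.
case: _ / ab E1 t_iota t_eq => _ t_iota _.
have io : sorted ltn (map val (ord_tuple (size a))).
  by rewrite val_ord_tuple val_enum_ord iota_ltn_sorted.
rewrite (bigD1 (ord_tuple (size a))) //= [X in _ + X]big1 => [|t /andP[ts tn]].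
  rewrite addr0; case: eqP => // -[]; apply/mnmP => i.
  rewrite mnm_sumE mnmE (bigD1 i) //= big1 => [|k ki].
    by rewrite tnth_ord_tuple mulmnE mnm1E eqxx mul1n addn0.
  by rewrite tnth_ord_tuple mulmnE mnm1E (negPf ki).
case: eqP => // tE; case/eqP: tn; apply: val_inj; apply: (inj_map val_inj).
by rewrite (t_iota t) // val_ord_tuple val_enum_ord.
Qed.

Lemma pairing_nsH_qsM (a b : composition) : pairing (nsHc a) (qsM b) = (a == b)%:R.
Proof. by rewrite pairing_nsHc coef_M_qsM. Qed.

Lemma pairing_linear (c : rat) (F G : NSym) (f : series) :
  pairing (c *: F + G) f = c * pairing F f + pairing G f.
Proof.
have E0 F' : pairing F' f = monalg.mmap idfun (coef_M f) F' by [].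
rewrite !E0 raddfD /= (monalg.mmapEw (monalg.msuppZ_le c F)) mulr_sumr.
by congr (_ + _); apply: eq_bigr => a _; rewrite /= monalg.mcoeffZ mulrA.
Qed.

Definition hprod (N : nat) (a : composition) : mpoly N rat :=
  \prod_(i <- a) hsym i N.

Lemma hprod_mmorphism N : mmorphism (hprod N).
Proof.
split; last by rewrite /hprod big_nil.
by move=> a b; rewrite /hprod -big_cat -cat_compE.
Qed.

HB.instance Definition _ N :=
  isMultiplicative.Build composition (mpoly N rat) (hprod N)
    (hprod_mmorphism N).

Lemma chiE N F : chi F N = monalg.mmap (@mpolyC N rat) (hprod N) F.
Proof. by rewrite /chi /monalg.mmap; apply: eq_bigr => a _; rewrite mul_mpolyC. Qed.

Lemma chi_linear (c : rat) (F G : NSym) N :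
  chi (c *: F + G) N = c *: chi F N + chi G N.
Proof. by rewrite !chiE raddfD /= monalg.mmapZ mul_mpolyC. Qed.

Lemma chiM (F G : NSym) N : chi (F * G) N = chi F N * chi G N.
Proof. by rewrite !chiE rmorphM. Qed.

Lemma chi1 N : chi 1 N = 1.
Proof. by rewrite chiE monalg.mmap1. Qed.

Lemma chi_nsH n N : (0 < n)%N -> chi (nsH n) N = hsym n N.
Proof.
move=> n0; rewrite chiE /nsH monalg.mmapU mul_mpolyC scale1r /hprod /= n0.
by rewrite big_cons big_nil mulr1.
Qed.

(* Main.v *)
(* Call [step true] the relation of the right Pieri rule and [step false] its
   row-strict analogue, in which every row grows by at most one box. A sign
   reversing involution shows that the operators defined by the two relations
   on families indexed by compositions satisfy the identity
   [\sum_i (-1)^i E_i H_(n-i) = 0], so a family obeying the H-Pieri rule for one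
   of them obeys the E-Pieri rule for the other. Since tableaux are chains of
   steps, being dual to the row-strict extended Schur functions amounts to the
   H-Pieri rule for [step false]; the matrix of the numbers of tableaux need not
   be studied, its invertibility being a consequence of the duality itself.
   Products with ribbons then follow by adding the boxes of a strip one at a
   time and by Moebius inversion over compositions, and the image under the
   forgetful map is determined by the H-Pieri rule and its classical counterpart
   for Schur polynomials. *)

Require Import Defs.
From mathcomp Require Import all_boot all_fingroup all_algebra finmap zify.
From mathcomp.multinomials Require Import monalg mpoly.

Set Implicit Arguments.
Unset Strict Implicit.
Unset Printing Implicit Defensive.

Import GRing.Theory Num.Theory.
Local Open Scope ring_scope.

(** * Compositions and strips *)

(** Only the pairings of [RS a] with the series [RSstar b] are given, not even the homogeneity of
    [RS a]; the duality argument therefore works in one degree at a time, where the matrices are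
    square and a one-sided inverse is two-sided. For the exchange of H and E, only pairs formed by a
    [step false] followed by a [step true] are counted. In this order the clauses on later rows
    concern the two outer shapes and never the middle one, so that a box can pass from one step to
    the other. Read as E followed by H, such pairs serve a family with the shin rule; read as H
    followed by E, a family with the row-strict rule. Expanding [nsE] at either end lets one
    cancellation serve both. The complement of the composition in the ribbon expansions arises
    because the two kinds of tableaux coincide on standard fillings while their descents are
    complementary. For increasing compositions the E-Pieri rule can change only the last row and one
    new row; the difference of two such products is a single term, and this is the expansion of a
    Hessenberg determinant along its last row. *)

Local Notation comp0 := (mkcomp [::]).

Lemma comp_part_gt0 (a : composition) i : (0 < part a i)%N = (i < size a)%N.
Proof.
rewrite /part; have [ia|ai] := ltnP i (size a); last by rewrite nth_default.
by rewrite lt0n; apply: contraNneq (parts_pos a) => <-; rewrite mem_nth.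
Qed.

Lemma part_default (a : seq nat) i : (size a <= i)%N -> part a i = 0%N.
Proof. exact: nth_default. Qed.

Lemma comp_ext (a b : composition) : part a =1 part b -> a = b.
Proof.
move=> ab; apply: parts_inj; apply: (eq_from_nth (x0 := 0%N)) => [|i _]; last exact: ab.
have le (c d : composition) : part c =1 part d -> (size c <= size d)%N.
  by move=> cd; rewrite leqNgt -comp_part_gt0 cd comp_part_gt0 ltnn.
by apply/eqP; rewrite eqn_leq !le.
Qed.

Lemma sumn_part (a : seq nat) L :
  (size a <= L)%N -> sumn a = (\sum_(i < L) part a i)%N.
Proof.
move=> aL; rewrite -(subnKC aL) big_split_ord /= [X in (_ + X)%N]big1 ?addn0.
  by rewrite sumnE (big_nth 0%N) big_mkord.
by move=> i _; rewrite part_default ?leq_addr.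
Qed.

Lemma size_le_sumn (a : composition) : (size a <= sumn a)%N.
Proof.
rewrite (sumn_part (leqnn (size a))) -{1}[size a]card_ord -sum1_card.
by apply: leq_sum => i _; rewrite comp_part_gt0.
Qed.

Lemma part_le_sumn (a : seq nat) i : (part a i <= sumn a)%N.
Proof.
have [ia|ai] := ltnP i (size a); last by rewrite part_default.
by rewrite (sumn_part (leqnn (size a))) (bigD1 (Ordinal ia)) //= leq_addr.
Qed.

Lemma part_comp0 i : part comp0 i = 0%N.
Proof. by rewrite /part nth_nil. Qed.

Lemma comp_eq0 (a : composition) : sumn a = 0%N -> a = comp0.
Proof.
move=> a0; apply: comp_ext => i; rewrite part_comp0; apply/eqP.
by rewrite -leqn0 -a0 part_le_sumn.
Qed.

(** Compositions are handled through their part functions on all of [nat]. This is the condition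
    under which the removal of zeros in [mkcomp] shifts no entry. *)
Definition down0 (f : nat -> nat) := forall i j, (i <= j)%N -> f i = 0%N -> f j = 0%N.

Lemma down0_part (a : composition) : down0 (part a).
Proof.
by move=> i j ij /eqP; rewrite -leqn0 leqNgt comp_part_gt0 -leqNgt => ai;
  rewrite part_default ?(leq_trans ai).
Qed.

Definition comp_of_fun (f : nat -> nat) (L : nat) : composition := mkcomp (mkseq f L).

Lemma part_mkcomp (s : seq nat) : down0 (part s) -> part (mkcomp s) =1 part s.
Proof.
rewrite /part /=; elim: s => [//|x s IHs] sP i /=.
have sP' : down0 (nth 0%N s) by move=> j k jk; apply: (sP j.+1 k.+1).
case: x sP => [|x] sP /=; last by case: i => //= i; apply: IHs.
have s0 j : nth 0%N s j = 0%N by apply: (sP 0%N j.+1).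
by rewrite IHs // s0 (sP 0%N i).
Qed.

Lemma part_comp_of_fun f L : down0 f -> (forall i, (L <= i)%N -> f i = 0%N) ->
  part (comp_of_fun f L) =1 f.
Proof.
move=> f0 fL.
have E i : part (mkseq f L) i = f i.
  rewrite /part; have [iL|Li] := ltnP i L; first by rewrite nth_mkseq.
  by rewrite nth_default ?size_mkseq // fL.
by move=> i; rewrite part_mkcomp ?E // => j k jk; rewrite !E; apply: f0.
Qed.


(** The last clause looks at the column of the first box added to row [i]. If columns are strict, a
    later row must not reach this column even after the step; if they are weak, only its length
    before the step matters. *)
Definition Step (s : bool) (f g : nat -> nat) : Prop := forall i,
  [/\ (f i <= g i)%N, s || (g i <= (f i).+1)%N
    & (f i < g i)%N -> forall j, (i < j)%N -> ((if s then g j else f j) <= f i)%N].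

(* [s = true]: the relation [shin_sub]; [s = false]: its row-strict analogue,
   where one box at most is added to each row. *)
Definition step (s : bool) (a d : seq nat) : bool :=
  all (fun i => [&& (part a i <= part d i)%N, s || (part d i <= (part a i).+1)%N
    & (part a i < part d i)%N ==> all (fun j => (i < j)%N ==>
         ((if s then part d j else part a j) <= part a i)%N)
           (iota 0 (maxn (size a) (size d)))]) (iota 0 (maxn (size a) (size d))).

Lemma stepP s (a d : seq nat) : reflect (Step s (part a) (part d)) (step s a d).
Proof.
apply: (iffP allP) => [H i|H i _].
  have [iL|Li] := ltnP i (maxn (size a) (size d)); last first.
    move: Li; rewrite geq_max => /andP[ai di].
    by rewrite !part_default //; split=> //; rewrite orbT.
  have /H/and3P[H1 H2 H3] : i \in iota 0 (maxn (size a) (size d)) by rewrite mem_iota.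
  split=> // ad j ij; move: H3; rewrite ad /= => /allP/(_ j).
  have [jL|Lj] := ltnP j (maxn (size a) (size d)).
    by rewrite mem_iota ij /= => ->.
  move: Lj; rewrite geq_max => /andP[aj dj] _.
  by rewrite [part d j]part_default // [part a j]part_default //; case: (s).
have [-> -> H3] := H i; apply/implyP => ad; apply/allP => j _.
by apply/implyP => ij; apply: H3.
Qed.

Lemma stepS m (a d : composition) :
  shin_sub m a d = step true a d && (sumn d == sumn a + m)%N.
Proof.
apply/and3P/andP => [[/forallP H1 -> /forallP H3]|[/stepP H ->]]; split=> //.
- apply/stepP => i; have [ia|ai] := ltnP i (size a); last first.
    rewrite [part a i]part_default //; split=> // di j ij.
    have [jd|dj] := ltnP j (size d); last by rewrite part_default.
    rewrite comp_part_gt0 in di.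
    have := H3 (Ordinal di); rewrite /= [part a i]part_default // comp_part_gt0 di /=.
    by move=> /forallP/(_ (Ordinal jd)) /=; rewrite ij.
  have ad := H1 (Ordinal ia); split=> // ad' j ij.
  have [jd|dj] := ltnP j (size d); last by rewrite part_default.
  have := H3 (Ordinal (ltn_trans ij jd)); rewrite /= ad' /=.
  by move=> /forallP/(_ (Ordinal jd)) /=; rewrite ij.
- by apply/forallP => i; case: (H i).
- apply/forallP => i; apply/implyP => ad; apply/forallP => j; apply/implyP => ij.
  by case: (H i) => _ _ /(_ ad _ ij).
Qed.

Lemma Step_refl s f : Step s f f.
Proof. by move=> i; split; rewrite ?ltnn // leqnSn orbT. Qed.

Lemma step_size s (a d : composition) : step s a d -> (size a <= size d)%N.
Proof.
move=> /stepP H; rewrite leqNgt; apply/negP => da.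
by have [] := H (size d); rewrite [part d _]part_default // leqNgt comp_part_gt0 da.
Qed.

Lemma step_sumn s (a d : composition) : step s a d -> (sumn a <= sumn d)%N.
Proof.
move=> ad; rewrite (sumn_part (step_size ad)) (sumn_part (leqnn (size d))).
by apply: leq_sum => i _; case: (stepP _ _ _ ad i).
Qed.

Lemma step_eq s (a d : composition) : step s a d -> (sumn d <= sumn a)%N -> a = d.
Proof.
move=> ad; rewrite (sumn_part (step_size ad)) (sumn_part (leqnn (size d))) => da.
apply: comp_ext => i; have [id|di] := ltnP i (size d); last first.
  by rewrite !part_default // (leq_trans (step_size ad)).
have le j : (part a j <= part d j)%N by case: (stepP _ _ _ ad j).
apply/eqP; rewrite eqn_leq le /=; move: da; apply: contraLR; rewrite -!ltnNge => ad'.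
rewrite (bigD1 (Ordinal id)) //= [X in (_ < X)%N](bigD1 (Ordinal id)) //= -addSn.
by apply: leq_add => //; apply: leq_sum => j _.
Qed.

Lemma eq_bigr_seq (R : Type) (idx : R) (op : R -> R -> R) (I : eqType) (r : seq I)
    (P : pred I) (F G : I -> R) :
  (forall i, i \in r -> P i -> F i = G i) ->
  \big[op/idx]_(i <- r | P i) F i = \big[op/idx]_(i <- r | P i) G i.
Proof.
move=> FG; rewrite big_seq_cond [RHS]big_seq_cond.
by apply: eq_bigr => i /andP[]; apply: FG.
Qed.

Lemma big_seq_bij (V : nmodType) (I J : eqType) (r : seq I) (r' : seq J)
    (P : pred I) (Q : pred J) (h : J -> I) (h' : I -> J) (F : I -> V) :
  uniq r -> uniq r' ->
  (forall i, i \in r -> P i -> [/\ h' i \in r', Q (h' i) & h (h' i) = i]) ->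
  (forall j, j \in r' -> Q j -> [/\ h j \in r, P (h j) & h' (h j) = j]) ->
  \sum_(i <- r | P i) F i = \sum_(j <- r' | Q j) F (h j).
Proof.
move=> ur ur' h'P hP; rewrite -big_filter -[RHS]big_filter -(big_map h xpredT F).
apply: perm_big; apply: uniq_perm; first exact: filter_uniq.
  rewrite map_inj_in_uniq ?filter_uniq // => i j; rewrite !mem_filter.
  by move=> /andP[Qi /hP/(_ Qi)[_ _ {2}<-]] /andP[Qj /hP/(_ Qj)[_ _ {2}<-]] ->.
move=> i; rewrite mem_filter; apply/andP/mapP => [[Pi ir]|[j + ->]].
  by have [? ? <-] := h'P i ir Pi; exists (h' i); rewrite ?mem_filter; first apply/andP.
by rewrite mem_filter => /andP[Qj /hP/(_ Qj)[]].
Qed.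

Definition comps_range (n m : nat) : seq composition :=
  flatten [seq comps (n + k) | k <- iota 0 m.+1].

Lemma big_comps_range (V : nmodType) n m (P : pred composition) (F : composition -> V) :
  \sum_(d <- comps_range n m | P d) F d =
  \sum_(k < m.+1) \sum_(d <- comps (n + k) | P d) F d.
Proof.
rewrite /comps_range big_flatten big_map.
by rewrite -[iota 0 m.+1]/(index_iota 0 m.+1) big_mkord.
Qed.

Lemma mem_comps_range n m (d : composition) :
  (d \in comps_range n m) = (n <= sumn d <= n + m)%N.
Proof.
apply/flatten_mapP/andP => [[k]|[nd dm]].
  by rewrite mem_iota mem_comps => /andP[_ km] /eqP->; lia.
by exists (sumn d - n)%N; rewrite ?mem_iota ?mem_comps; lia.
Qed.

Lemma uniq_comps_range n m : uniq (comps_range n m).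
Proof.
rewrite /comps_range; elim: m.+1 0%N => [//|k IHk] j /=.
rewrite cat_uniq uniq_comps IHk andbT /=; apply/hasPn => d /flatten_mapP[i].
by rewrite mem_iota !mem_comps => /andP[ji _] /eqP->; lia.
Qed.

Lemma big_comps_head (V : nmodType) n (F : composition -> V) : (0 < n)%N ->
  \sum_(b <- comps n) F b =
  \sum_(k < n) \sum_(s <- comps (n - k.+1)) F (cat_comp (mkcomp [:: k.+1]) s).
Proof.
move=> n0; rewrite -(big_mkord xpredT
  (fun k => \sum_(s <- comps (n - k.+1)) F (cat_comp (mkcomp [:: k.+1]) s))).
transitivity (\sum_(p <- [seq (k, s) | k <- index_iota 0 n, s <- comps (n - k.+1)])
    F (cat_comp (mkcomp [:: p.1.+1]) p.2)); last by rewrite big_allpairs_dep.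
apply: (@big_seq_bij _ _ (nat * composition)%type _ _ _ _
  (fun p => cat_comp (mkcomp [:: p.1.+1]) p.2)
  (fun b => ((head 0%N b).-1, mkcomp (behead b)))).
- exact: uniq_comps.
- apply: allpairs_uniq_dep; first exact: iota_uniq; first by move=> *; apply: uniq_comps.
  by move=> [k s] [k' s'] _ _ /= [-> ->].
- move=> b; rewrite mem_comps => /eqP bn _.
  case bE: (parts b) (parts_pos b) bn => [|[|x] t] //=; first by lia.
  rewrite inE /= => t0 bn; split=> //; last first.
    by apply: parts_inj; rewrite cat_compE bE (mkcomp_id t0).
  apply/allpairsPdep; exists x, (mkcomp t); split=> //.
    by rewrite mem_iota; lia.
  by rewrite mem_comps mkcomp_id //; apply/eqP; lia.
- move=> [k s] /allpairsPdep[k' [s' [+ + [-> ->]]]] _.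
  rewrite mem_iota !mem_comps => kn /eqP sn; split=> //.
    by rewrite cat_compE /=; apply/eqP; lia.
  by rewrite cat_compE /= mkcompK.
Qed.

Lemma big_comps_last (V : nmodType) n (F : composition -> V) : (0 < n)%N ->
  \sum_(b <- comps n) F b =
  \sum_(k < n) \sum_(s <- comps (n - k.+1)) F (cat_comp s (mkcomp [:: k.+1])).
Proof.
pose rv (b : composition) := mkcomp (rev b).
have rvE b : rv b = rev b :> seq nat by rewrite mkcomp_id // mem_rev parts_pos.
have rvK : involutive rv by move=> b; apply: parts_inj; rewrite !rvE revK.
have big_rv m (G : composition -> V) :
    \sum_(b <- comps m) G b = \sum_(b <- comps m) G (rv b).
  apply: (@big_seq_bij _ _ _ _ _ _ _ rv rv); rewrite ?uniq_comps // => b;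
    by rewrite !mem_comps !rvE sumn_rev rvK.
move=> n0; rewrite big_rv big_comps_head //; apply: eq_bigr => k _.
rewrite big_rv; apply: eq_bigr => s _; congr F.
by apply: parts_inj; rewrite rvE !cat_compE rev_cat !rvE revK.
Qed.

Lemma nsHc_cat (a b : composition) : nsHc (cat_comp a b) = nsHc a * nsHc b.
Proof. by rewrite /nsHc cat_compE big_cat. Qed.

Lemma nsHc1 k : nsHc (mkcomp [:: k.+1]) = nsH k.+1.
Proof. by rewrite /nsHc /= big_cons big_nil mulr1. Qed.

Lemma nsE0 : nsE 0 = 1.
Proof. by rewrite /nsE /comps /= big_cons big_nil /nsHc /= big_nil scale1r addr0. Qed.

Lemma size_comp n (s : composition) : s \in comps n -> (size s <= n)%N.
Proof. by rewrite mem_comps => /eqP <-; apply: size_le_sumn. Qed.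

(** An additive map between rational vector spaces is linear, so distributivity suffices. *)
Lemma ns_scalerAr (c : rat) (F G : NSym) : F * (c *: G) = c *: (F * G).
Proof. exact: (@rat_linear NSym NSym ( *%R F)) (mulrBr F) c G. Qed.

(** The vanishing of the alternating sum of the products of H and E, solved for [nsE m]. The H
    factor is the first part of the composition here and the last part in [nsE_last]; without
    commutativity these are two separate recursions. *)
Lemma nsE_head m : (0 < m)%N ->
  nsE m = \sum_(k < m) (-1) ^+ k *: (nsH k.+1 * nsE (m - k.+1)).
Proof.
move=> m0; rewrite /nsE big_comps_head //; apply: eq_bigr => k _.
rewrite mulr_sumr scaler_sumr; apply: eq_big_seq => s /size_comp sk.
rewrite cat_compE nsHc_cat nsHc1 ns_scalerAr scalerA -exprD; congr ((-1) ^+ _ *: _).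
by rewrite /=; have := ltn_ord k; lia.
Qed.

Lemma nsE_last m : (0 < m)%N ->
  nsE m = \sum_(k < m) (-1) ^+ k *: (nsE (m - k.+1) * nsH k.+1).
Proof.
move=> m0; rewrite /nsE big_comps_last //; apply: eq_bigr => k _.
rewrite mulr_suml scaler_sumr; apply: eq_big_seq => s /size_comp sk.
rewrite cat_compE nsHc_cat nsHc1 -scalerAl scalerA -exprD; congr ((-1) ^+ _ *: _).
by rewrite size_cat /=; have := ltn_ord k; lia.
Qed.

(* The involution toggles the box of the last row in which [a] and [g] differ. *)
Lemma strip_cancel (a g : composition) m : (0 < m)%N -> sumn g = (sumn a + m)%N ->
  \sum_(k < m.+1) \sum_(d <- comps (sumn a + k) | step false a d && step true d g)
    (-1) ^+ k = 0 :> rat.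
Proof.
move=> m0 gm.
transitivity (\sum_(d <- comps_range (sumn a) m | step false a d && step true d g)
    (-1) ^+ (sumn d - sumn a) : rat).
  rewrite big_comps_range; apply: eq_bigr => k _.
  rewrite big_seq_cond [RHS]big_seq_cond; apply: eq_bigr => d.
  by rewrite mem_comps => /andP[/eqP-> _]; congr (_ ^+ _); lia.
set S := LHS; suff: S = - S by move/eqP; rewrite -addr_eq0 -mulr2n mulrn_eq0 => /eqP.
have [/existsP/= ex|none] := boolP [exists i : 'I_(size g), (part a i < part g i)%N];
  last first.
  suff -> : S = 0 by rewrite oppr0.
  apply: big1 => d /andP[/stepP ad /stepP dg].
  suff ag : a = g by move: gm m0; rewrite ag; lia.
  apply: comp_ext => i; have [[ai _ _] [di _ _]] := (ad i, dg i).
  have [ig|gi] := ltnP i (size g).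
    by move: none; rewrite negb_exists => /forallP/(_ (Ordinal ig)) /=; lia.
  by move: ai di; rewrite !(part_default gi); lia.
have ex' : exists i, (i < size g)%N && (part a i < part g i)%N.
  by case: ex => i ai; exists i; rewrite ltn_ord.
case: (@ex_maxnP _ (size g) ex') => [i /andP[]|i /andP[ig agi] imax]; first by lia.
have eq_after (d : composition) : step false a d -> step true d g ->
    forall j, (i < j)%N -> part d j = part a j /\ part g j = part a j.
  move=> /stepP ad /stepP dg j ij; have [[aj _ _] [dj _ _]] := (ad j, dg j).
  have [jg|gj] := ltnP j (size g); last by move: aj dj; rewrite !(part_default gj); lia.
  by have := imax j; rewrite jg /=; lia.
(* [part d i] is [part a i] or its successor; subtraction from the sum of these two numbers
   exchanges them. *)
pose f (d : composition) (j : nat) := if j == i then ((part a i).*2.+1 - part d i)%N else part d j.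
pose tog (d : composition) := comp_of_fun (f d) (size g).
have togP (d : composition) : step false a d -> step true d g ->
  [/\ part (tog d) =1 f d, step false a (tog d), step true (tog d) g &
      (sumn (tog d) + part d i = sumn d + f d i)%N].
  move=> sad sdg; have eqd := eq_after d sad sdg.
  move: (sad) (sdg) => /stepP ad /stepP dg.
  have pE : part (tog d) =1 f d.
    apply: part_comp_of_fun => [j k jk|j gj]; last first.
      rewrite /f; case: eqP => [ji|_]; first by lia.
      by rewrite part_default // (leq_trans (step_size sdg)).
    rewrite /f; case: eqP => [ji|/eqP ji] fj.
      case: eqP => [ki|/eqP ki]; first by move: fj; lia.
      have [[ai1 ai2 _] [di1 di2 _]] := (ad i, dg i).
      have [|-> _] := eqd k; first by lia.
      by apply: (@down0_part a i); lia.
    case: eqP => [ki|/eqP ki]; last exact: (down0_part jk fj).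
    (* An empty row [j] of [d] above row [i] would have to grow, and the second step would then
       force row [i] of [g] to be empty. *)
    have gj : (0 < part g j)%N by rewrite comp_part_gt0; lia.
    have [_ _ H] := dg j; have := H _ i; rewrite /= fj.
    by have [+ _ _] := dg i; lia.
  (* After row [i] the shapes [a], [d] and [g] agree, so the clauses of the two steps at row [i]
     bound the same lengths, and whichever holds for [d] gives the one needed for [tog d]. *)
  have saf : step false a (tog d).
    apply/stepP => j; rewrite pE /f; case: eqP => [->|_]; last exact: ad.
    have [[ai1 ai2 ai3] [di1 _ di3]] := (ad i, dg i); split; rewrite ?orFb; try lia.
    move=> afi k ik; have [_ <-] := eqd k ik; apply: leq_trans (di3 _ k ik) _; lia.
  have sfg : step true (tog d) g.
    apply/stepP => j; rewrite pE /f; case: eqP => [->|_]; last exact: dg.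
    have [[ai1 ai2 ai3] [di1 _ di3]] := (ad i, dg i); split=> //; try lia.
    move=> fgi k ik; have := eqd k ik; have := ai3 _ k ik; have := di3 _ k ik.
    by rewrite /=; lia.
  split=> //.
  rewrite (sumn_part (step_size sdg)) (sumn_part (step_size sfg)).
  rewrite (bigD1 (Ordinal ig)) //= [in RHS](bigD1 (Ordinal ig)) //= pE.
  rewrite (eq_bigr (fun k : 'I_(size g) => part d k)); last first.
    by move=> k ki; rewrite pE /f ifN //; apply: contra ki => /eqP ki; apply/eqP/val_inj.
  by lia.
have togK (d : composition) : step false a d -> step true d g -> tog (tog d) = d.
  move=> ad dg; have [E1 ad' dg' _] := togP d ad dg.
  have [E2 _ _ _] := togP _ ad' dg'; apply: comp_ext => j.
  rewrite E2 /f; case: eqP => [->|ji]; rewrite E1 /f ?eqxx; last by rewrite ifN //; apply/eqP.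
  by have [+ + _] := stepP _ _ _ ad i; lia.
rewrite /S -sumrN.
rewrite (@big_seq_bij _ _ _ _ (comps_range (sumn a) m) _
  (fun d => step false a d && step true d g) tog tog) ?uniq_comps_range //.
- rewrite big_seq_cond [RHS]big_seq_cond; apply: eq_bigr => d /andP[_ /andP[ad dg]].
  have [E1 ad' dg' sd] := togP d ad dg.
  have [[ai1 ai2 _] sd1 sd2] := And3 (stepP _ _ _ ad i) (step_sumn ad) (step_sumn ad').
  rewrite -signr_odd -[in RHS]signr_odd.
  have -> : odd (sumn (tog d) - sumn a) = ~~ odd (sumn d - sumn a).
    by move: sd; rewrite /f eqxx; lia.
  by case: odd; rewrite ?expr1 ?expr0 ?opprK.
- move=> d _ /andP[ad dg]; have [_ ad' dg' _] := togP d ad dg.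
  rewrite togK // ad' dg' mem_comps_range; split=> //.
  by rewrite (step_sumn ad') -gm (step_sumn dg').
- move=> d _ /andP[ad dg]; have [_ ad' dg' _] := togP d ad dg.
  rewrite togK // ad' dg' mem_comps_range; split=> //.
  by rewrite (step_sumn ad') -gm (step_sumn dg').
Qed.

(** * Pieri rules *)
Local Opaque nsH nsE.



Definition pieri (A : pzRingType) (s : bool) (B : composition -> A) (X : nat -> A) :=
  forall (a : composition) m, (0 < m)%N ->
    B a * X m = \sum_(d <- comps (sumn a + m) | step s a d) B d.

Lemma big_step0 (V : nmodType) s (a : composition) (B : composition -> V) :
  \sum_(d <- comps (sumn a) | step s a d) B d = B a.
Proof.
rewrite big_mkcond (bigD1_seq a) ?mem_comps ?uniq_comps //=.
have -> : step s a a by apply/stepP/Step_refl.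
rewrite big_seq_cond big1 ?addr0 // => d; rewrite mem_comps => /andP[/eqP da].
by case: ifP => // ad; rewrite (step_eq ad) ?da ?eqxx.
Qed.

Lemma exchange_strips (V : lmodType rat) (r r' : seq composition) (P : pred composition)
    (Q : rel composition) (B : composition -> V) :
  \sum_(d <- r | P d) \sum_(g <- r' | Q d g) B g =
  \sum_(g <- r') (\sum_(d <- r | P d && Q d g) 1) *: B g.
Proof.
under eq_bigr do rewrite big_mkcond; rewrite exchange_big /=.
apply: eq_bigr => g _; rewrite scaler_suml -big_mkcondr.
by apply: eq_bigr => d _; rewrite scale1r.
Qed.

(** With the smaller E expanded by induction, the coefficient of [B g] is a signed sum of the counts
    [N k g] from which one extreme index is missing. By [strip_cancel] it equals the missing term up
    to sign, and there one of the two steps is trivial, so that the count is the indicator of the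
    other. *)
Lemma pieri_nsE s (B : composition -> NSym) : pieri s B nsH -> pieri (~~ s) B nsE.
Proof.
move=> BH a m; elim/ltn_ind: m a => m IHm a m0.
pose N k (g : composition) : rat :=
  \sum_(d <- comps (sumn a + k) | step false a d && step true d g) 1.
have Nsum (g : composition) : g \in comps (sumn a + m) ->
    \sum_(k < m.+1) (-1) ^+ k * N k g = 0.
  rewrite mem_comps => /eqP ag; apply: etrans (strip_cancel m0 ag).
  by apply: eq_bigr => k _; rewrite /N mulr_sumr; apply: eq_bigr => d _; rewrite mulr1.
have N0 g : N 0%N g = (step true a g)%:R.
  by rewrite /N addn0 big_mkcondr big_step0; case: step.
have Nm g : g \in comps (sumn a + m) -> N m g = (step false a g)%:R.
  rewrite mem_comps => /eqP ag; rewrite /N -ag big_mkcond (bigD1_seq g) ?mem_comps ?uniq_comps //=.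
  have -> : step true g g by apply/stepP/Step_refl.
  rewrite andbT big_seq_cond big1 ?addr0; first by case: step.
  move=> d; rewrite mem_comps => /andP[/eqP dg ndg].
  by case: ifP => // /andP[_ sdg]; rewrite (step_eq sdg) ?dg ?eqxx in ndg.
have IH0 b k : (k < m)%N -> B b * nsE k = \sum_(d <- comps (sumn b + k) | step (~~ s) b d) B d.
  case: k => [|k] km; last exact: IHm.
  by rewrite nsE0 mulr1 addn0 big_step0.
case: s BH IH0 {IHm} => BH IHm.
  transitivity (\sum_(k < m) (-1) ^+ k *:
      \sum_(g <- comps (sumn a + m)) N (m - k.+1)%N g *: B g).
    rewrite nsE_last // mulr_sumr; apply: eq_bigr => k _.
    rewrite ns_scalerAr mulrA IHm; last by have := ltn_ord k; lia.
    rewrite mulr_suml -exchange_strips; congr (_ *: _).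
    apply: eq_bigr_seq => d; rewrite mem_comps => /eqP dk _.
    rewrite BH // dk; have -> // : (sumn a + (m - k.+1) + k.+1 = sumn a + m)%N.
    by have := ltn_ord k; lia.
  under eq_bigr do rewrite scaler_sumr; rewrite exchange_big /= [RHS]big_mkcond.
  apply: eq_big_seq => g ag; under eq_bigr do rewrite scalerA.
  (* So far the index measures the H strip, which comes second; reversal makes it the size of the
     first strip, as in [Nsum]. *)
  rewrite -scaler_suml (reindex_inj rev_ord_inj) /=.
  have := Nsum g ag; rewrite big_ord_recr /= Nm // => /eqP.
  rewrite addr_eq0 => /eqP E.
  have -> : \sum_(i < m) (-1) ^+ (m - i.+1) * N (m - (m - i.+1).+1)%N g =
      - (-1) ^+ m * \sum_(k < m) (-1) ^+ k * N k g.
    rewrite mulr_sumr; apply: eq_bigr => k _; rewrite mulrA mulNr -exprD.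
    have -> : (m - (m - k.+1).+1 = k)%N by have := ltn_ord k; lia.
    congr (_ * _); rewrite -[RHS]mulN1r -exprS -signr_odd -[RHS]signr_odd.
    by congr (_ ^+ _); have := ltn_ord k; lia.
  rewrite E mulrNN mulrA -exprD -signr_odd oddD addbb mul1r.
  by case: step; rewrite ?scale1r ?scale0r.
transitivity (\sum_(k < m) (-1) ^+ k *:
      \sum_(g <- comps (sumn a + m)) N k.+1 g *: B g).
  rewrite nsE_head // mulr_sumr; apply: eq_bigr => k _.
  rewrite ns_scalerAr.
  rewrite mulrA.
  have BHk := BH a k.+1 isT.
  rewrite BHk.
  rewrite mulr_suml -exchange_strips; congr (_ *: _).
  apply: eq_bigr_seq => d; rewrite mem_comps => /eqP dk _.
  rewrite IHm ?dk; last by have := ltn_ord k; lia.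
  have -> // : (sumn a + k.+1 + (m - k.+1) = sumn a + m)%N.
  by have := ltn_ord k; lia.
under eq_bigr do rewrite scaler_sumr; rewrite exchange_big /= [RHS]big_mkcond.
apply: eq_big_seq => g ag; under eq_bigr do rewrite scalerA.
rewrite -scaler_suml; have := Nsum g ag; rewrite big_ord_recl expr0 mul1r N0 => /eqP.
rewrite addr_eq0 => /eqP E.
have -> : \sum_(i < m) (-1) ^+ i * N i.+1 g = (step true a g)%:R.
  by rewrite E -sumrN; apply: eq_bigr => k _; rewrite exprS mulN1r mulNr opprK.
by case: step; rewrite ?scale1r ?scale0r.
Qed.

(** * Duality *)
Lemma big_supp_eq (V : nmodType) (I : eqType) (r r' : seq I) (F : I -> V) :
  uniq r -> uniq r' -> (forall i, F i != 0 -> (i \in r) = (i \in r')) ->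
  \sum_(i <- r) F i = \sum_(i <- r') F i.
Proof.
move=> ur ur' rr'; rewrite (bigID (fun i => F i != 0)) [RHS](bigID (fun i => F i != 0)) /=.
rewrite [X in _ + X]big1 ?[X in _ = _ + X]big1 => [|i /negPn/eqP//|i /negPn/eqP//].
rewrite !addr0 -big_filter -[RHS]big_filter; apply: perm_big.
apply: uniq_perm; rewrite ?filter_uniq // => i; rewrite !mem_filter.
by case: (boolP (F i != 0)) => //= /rr'.
Qed.

Section Duality.
Variables (RS : composition -> NSym) (kappa : composition -> composition -> rat).
Local Notation x a c := (monalg.mcoeff c (RS a)).
Hypothesis kappa0 : forall b c : composition, sumn b != sumn c -> kappa b c = 0.
Hypothesis dual : forall a b : composition,
  \sum_(c <- monalg.msupp (RS a)) x a c * kappa b c = (a == b)%:R.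

(** The support of [RS a] is unknown, but [kappa b] vanishes outside the degree of [b]. *)
Let dual_comps (a b : composition) :
  \sum_(c <- comps (sumn b)) x a c * kappa b c = (a == b)%:R.
Proof.
rewrite -dual; apply: big_supp_eq; rewrite ?uniq_comps ?fset_uniq // => c.
rewrite mulf_eq0 negb_or => /andP[]; rewrite monalg.mcoeff_neq0 => -> kbc.
by rewrite mem_comps; apply: contraNT kbc => bc; rewrite kappa0 // eq_sym.
Qed.

Let cn n i := nth comp0 (comps n) i.
Let Xm n : 'M[rat]_(size (comps n)) := \matrix_(i, j) x (cn n i) (cn n j).
Let Km n : 'M[rat]_(size (comps n)) := \matrix_(i, j) kappa (cn n j) (cn n i).

Let sumn_cn n (i : 'I_(size (comps n))) : sumn (cn n i) = n.
Proof. by apply/eqP; rewrite -mem_comps mem_nth. Qed.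

Let big_cn n (F : composition -> rat) :
  \sum_(c <- comps n) F c = \sum_(i < size (comps n)) F (cn n i).
Proof. by rewrite (big_nth comp0) big_mkord. Qed.

Let cnK n (c : composition) : sumn c = n -> exists i : 'I_(size (comps n)), c = cn n i.
Proof.
move=> cnn; have cin : c \in comps n by rewrite mem_comps cnn.
have ic : (index c (comps n) < size (comps n))%N by rewrite index_mem.
by exists (Ordinal ic); rewrite /cn nth_index.
Qed.

(** The duality is the product in the other order. For square matrices both products are the
    identity, and this one is the expansion of the H basis in the family [RS]. *)
Let KX1 n : Km n *m Xm n = 1%:M.
Proof.
apply: mulmx1C; apply/matrixP => i l; rewrite !mxE.
under eq_bigr do rewrite !mxE.
rewrite -(big_cn _ (fun c => x (cn n i) c * kappa (cn n l) c)).
have := dual_comps (cn n i) (cn n l); rewrite sumn_cn => ->.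
by rewrite /cn nth_uniq ?uniq_comps.
Qed.

(** The row of coefficients of [RS a] in a degree other than that of [a] is annihilated by the
    invertible matrix [Km]. *)
Lemma dual_homog (a c : composition) : sumn a != sumn c -> x a c = 0.
Proof.
move=> ac; have [j cj] := cnK (erefl (sumn c)).
pose y : 'rV[rat]_(size (comps (sumn c))) := \row_i x a (cn (sumn c) i).
suff y0 : y = 0 by have /matrixP/(_ 0 j) := y0; rewrite !mxE -cj.
rewrite -[y]mulmx1 -(KX1 (sumn c)) mulmxA.
suff -> : y *m Km (sumn c) = 0 by rewrite mul0mx.
apply/matrixP => i l; rewrite !mxE; under eq_bigr do rewrite !mxE.
rewrite -(big_cn _ (fun d => x a d * kappa (cn (sumn c) l) d)).
have := dual_comps a (cn (sumn c) l); rewrite sumn_cn => ->.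
suff /negPf-> : a != cn (sumn c) l by []; by apply: contra ac => /eqP->; rewrite sumn_cn.
Qed.

Lemma dual_orth (a b : composition) :
  \sum_(c <- comps (sumn a)) x a c * kappa b c = (a == b)%:R.
Proof.
have [ab|ab] := eqVneq (sumn a) (sumn b); first by rewrite ab dual_comps.
rewrite big1_seq => [|c]; last first.
  by rewrite mem_comps => /andP[_ /eqP ca]; rewrite kappa0 ?mulr0 // ca eq_sym.
suff /negPf-> : a != b by []; by apply: contra ab => /eqP->.
Qed.

Lemma dual_expand (a : composition) :
  RS a = \sum_(c <- comps (sumn a)) x a c *: nsHc c.
Proof.
apply/monalg.malgP => d; rewrite raddf_sum /=.
under eq_bigr => c _ do rewrite monalg.mcoeffZ nsHcE monalg.mcoeffU1.
have [da|da] := eqVneq (sumn d) (sumn a).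
  rewrite (bigD1_seq d) ?uniq_comps ?mem_comps ?da //= eqxx mulr1 big1 ?addr0 // => c cd.
  by rewrite (negPf cd) mulr0.
rewrite dual_homog 1?eq_sym // big1_seq // => c /andP[_]; rewrite mem_comps => /eqP ca.
suff /negPf-> : c != d by rewrite mulr0.
by apply: contra da => /eqP<-; rewrite ca.
Qed.

Lemma nsHc_expand (c : composition) :
  nsHc c = \sum_(b <- comps (sumn c)) kappa b c *: RS b.
Proof.
apply/monalg.malgP => d; rewrite raddf_sum /= nsHcE monalg.mcoeffU1.
under eq_bigr => b _ do rewrite monalg.mcoeffZ.
have [dc|dc] := eqVneq (sumn d) (sumn c); last first.
  rewrite big1_seq => [|b]; last first.
    rewrite mem_comps => /andP[_ /eqP bc]; rewrite dual_homog ?mulr0 // bc.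
    by rewrite eq_sym.
  suff /negPf-> : c != d by []; by apply: contra dc => /eqP->.
have [i ci] := cnK (erefl (sumn c)); have [j dj] := cnK dc.
rewrite big_cn; transitivity ((Km (sumn c) *m Xm (sumn c)) i j); last first.
  by rewrite mxE; apply: eq_bigr => l _; rewrite !mxE -ci -dj.
by rewrite KX1 mxE {1}ci dj /cn nth_uniq ?uniq_comps.
Qed.

End Duality.

(** * Tableaux as chains of compositions *)
Section Boxes.
Variables g a : seq nat.
Implicit Type b : box g a.

Lemma box_inj b c : box_row b = box_row c -> box_col b = box_col c -> b = c.
Proof.
move=> r cl; apply: val_inj; rewrite [LHS]surjective_pairing [RHS]surjective_pairing.
by congr (_, _); apply: val_inj.
Qed.

Lemma box_ex i j : (part a i <= j < part g i)%N ->
  exists b, box_row b = i /\ box_col b = j.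
Proof.
move=> aij; have /andP[_ jg] := aij.
have ig : (i < size g)%N.
  by rewrite ltnNge; apply/negP => gi; rewrite part_default in jg.
have js : (j < sumn g)%N by apply: leq_trans jg (part_le_sumn _ _).
by exists (exist _ (Ordinal ig, Ordinal js) aij).
Qed.

Lemma box_bounds b : (part a (box_row b) <= box_col b < part g (box_row b))%N.
Proof. exact: (valP b). Qed.

Lemma box_row_lt b : (box_row b < size g)%N.
Proof. exact: ltn_ord. Qed.

Lemma card_row i k :
  #|[set b : box g a | (box_row b == i) && (box_col b < k)%N]| = (minn k (part g i) - part a i)%N.
Proof.
set A := [set b : box g a | _]; rewrite cardE -(size_map box_col).
rewrite -(size_iota (part a i) (minn k (part g i) - part a i)).
apply: perm_size; apply: uniq_perm; last 1 first.
- move=> j; rewrite mem_iota; apply/mapP/idP => [[b]|].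
    rewrite mem_enum inE => /andP[/eqP <- bk] ->.
    by have := box_bounds b; lia.
  move=> ij; have [|b [bi bj]] := @box_ex i j; first by lia.
  by exists b; rewrite ?mem_enum ?inE ?bi ?bj ?eqxx //=; lia.
- rewrite map_inj_in_uniq ?enum_uniq // => b c.
  rewrite !mem_enum !inE => /andP[/eqP bi _] /andP[/eqP ci _].
  by apply: box_inj; rewrite bi ci.
- exact: iota_uniq.
Qed.

Lemma card_rows (P : pred (box g a)) :
  #|[set b : box g a | P b]| = (\sum_(i < size g) #|[set b : box g a | (box_row b == i) && P b]|)%N.
Proof.
rewrite -sum1_card (partition_big (fun b => (val b).1) xpredT) //=.
apply: eq_bigr => i _; rewrite -sum1_card; apply: eq_bigl => b.
by rewrite !inE andbC -val_eqE.
Qed.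

Lemma card_box :
  (forall i, part a i <= part g i)%N -> (#|{: box g a}| + sumn a = sumn g)%N.
Proof.
move=> ag; rewrite -cardsT -(eq_card (_ : [set b : box g a | true] =i _)); last first.
  by move=> b; rewrite !inE.
rewrite card_rows (sumn_part (leqnn (size g))).
have sza : sumn a = (\sum_(i < size g) part a i)%N.
  have [sa|sa] := leqP (size a) (size g); first exact: sumn_part.
  rewrite (sumn_part (leqnn _)) -(subnKC (ltnW sa)) big_split_ord /=.
  rewrite [X in (_ + X)%N]big1 ?addn0 // => i _; apply/eqP; rewrite -leqn0.
  by rewrite -[0%N](@part_default g (size g + i)) ?ag ?leq_addr.
rewrite sza -big_split; apply: eq_bigr => i _ /=.
rewrite -(eq_card (_ : [set b : box g a | (box_row b == i) && (box_col b < part g i)%N] =i _)).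
  by rewrite card_row minnn subnK.
move=> b; rewrite !inE andbT; case: eqP => // <-.
by have /andP[] := box_bounds b.
Qed.

End Boxes.

Section Shapes.
Variables (g a : composition) (N : nat).
Implicit Type T : filling g a N.

(* [T b < p] says that the entry of [b], which is [T b + 1], is at most [p]. *)
Definition shp T p i := (part a i + #|[set b : box g a | (box_row b == i) && (T b < p)%N]|)%N.

Definition tabs s T := if s then shin_tab T else rs_tab T.

Lemma skew_shapeP :
  reflect ((forall i, part a i <= part g i)%N /\
    forall i, (part a i < part g i)%N -> forall j, (i < j)%N -> (part a j <= part a i)%N)
  (skew_shape g a).
Proof.
apply: (iffP andP) => [[/andP[sa /forallP le] /forallP sk]|[le sk]]; split.
- move=> i; have [ia|ai] := ltnP i (size a); last by rewrite part_default.
  exact: (le (Ordinal ia)).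
- move=> i ag j ij; have [ja|aj] := ltnP j (size a); last by rewrite part_default.
  have ig : (i < size g)%N by rewrite -comp_part_gt0; lia.
  have := sk (Ordinal ig); rewrite /= ag => /forallP/(_ (Ordinal ja)) /=.
  by rewrite ij.
- apply/andP; split; last by apply/forallP => i.
  rewrite leqNgt -comp_part_gt0 -leqNgt; apply: leq_trans (le _) _.
  by rewrite part_default.
- apply/forallP => i; apply/implyP => ag; apply/forallP => j; apply/implyP => ij.
  exact: sk ij.
Qed.

Lemma shp0 T : shp T 0 =1 part a.
Proof.
move=> i; rewrite /shp (_ : [set b | _] = set0) ?cards0 ?addn0 //.
by apply/setP => b; rewrite !inE andbF.
Qed.

Lemma shp_mono T p q i : (p <= q)%N -> (shp T p i <= shp T q i)%N.
Proof.
move=> pq; rewrite leq_add2l; apply/subset_leq_card/subsetP => b.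
by rewrite !inE => /andP[-> bp]; apply: leq_trans pq.
Qed.

(** Read as the number 0 or 1, [s] treats weak and strict inequalities together: for 1 the rows are
    weak and the columns strict, for 0 the reverse. *)
Lemma tabs_rows (s : bool) T b c : tabs s T -> box_row b = box_row c ->
  (box_col b < box_col c)%N -> (T b < T c + s)%N.
Proof.
case: s => /andP[+ _] bc bcc => /forallP/(_ b)/forallP/(_ c);
  by rewrite bc eqxx bcc /=; lia.
Qed.

Lemma tabs_cols (s : bool) T b c : tabs s T -> box_col b = box_col c ->
  (box_row b < box_row c)%N -> (T b + s <= T c)%N.
Proof.
case: s => /andP[_ +] bc bcc => /forallP/(_ b)/forallP/(_ c);
  by rewrite bc eqxx bcc /=; lia.
Qed.

Lemma tabsP (s : bool) T :
  (forall b c, box_row b = box_row c -> (box_col b < box_col c)%N -> (T b < T c + s)%N) ->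
  (forall b c, box_col b = box_col c -> (box_row b < box_row c)%N -> (T b + s <= T c)%N) ->
  tabs s T.
Proof.
move=> H1 H2; case: s H1 H2 => H1 H2; apply/andP; split;
  apply/forallP => b; apply/forallP => c; apply/implyP => /andP[/eqP bc bcc];
  by [have := H1 b c bc bcc; lia | have := H2 b c bc bcc; lia].
Qed.

Section Tableau.
Variables (s : bool) (T : filling g a N).
Hypotheses (sk : skew_shape g a) (tT : tabs s T).

(** Rows increase at least weakly for both kinds of tableaux, so the entries at most [p] fill an
    initial segment of each row, and their number locates them. *)
Lemma ltn_shp b p : (T b < p)%N = (box_col b < shp T p (box_row b))%N.
Proof.
have [ag _] := skew_shapeP sk; have /andP[ab bg] := box_bounds b.
have le c d : box_row c = box_row d -> (box_col c <= box_col d)%N -> (T c <= T d)%N.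
  move=> cd; rewrite leq_eqVlt => /orP[/eqP cdc|cdc].
    by rewrite (box_inj cd cdc).
  by have := tabs_rows tT cd cdc; case: (s) => /=; lia.
rewrite /shp; apply/idP/idP => [Tb|].
  have := card_row g a (box_row b) (box_col b).+1.
  rewrite (minn_idPl bg); move/eqP.
  rewrite -(eqn_add2l (part a (box_row b))) (subnKC (leqW ab)) => /eqP <-.
  rewrite leq_add2l; apply/subset_leq_card/subsetP => c.
  rewrite !inE => /andP[/eqP cb]; rewrite ltnS cb eqxx /= => /(le _ _ cb).
  by move=> Tcb; apply: leq_ltn_trans Tb.
apply: contraTT; rewrite -!leqNgt => Tb.
have := card_row g a (box_row b) (box_col b).
rewrite (minn_idPl (ltnW bg)); move/eqP.
rewrite -(eqn_add2l (part a (box_row b))) subnKC // => /eqP <-.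
rewrite leq_add2l; apply/subset_leq_card/subsetP => c.
rewrite !inE => /andP[/eqP cb Tc]; rewrite cb eqxx /= ltnNge.
by apply/negP => /(le _ _ (esym cb)); lia.
Qed.

Lemma shpN : shp T N =1 part g.
Proof.
have [ag _] := skew_shapeP sk; move=> i; rewrite /shp.
rewrite -(eq_card (_ : [set b : box g a | (box_row b == i) && (box_col b < part g i)%N] =i _)).
  by rewrite card_row minnn subnKC.
move=> b; rewrite !inE ltn_ord; case: eqP => // <-.
by have /andP[] := box_bounds b.
Qed.

Lemma shp_bounds p i : (p <= N)%N -> (part a i <= shp T p i <= part g i)%N.
Proof. by move=> pN; rewrite leq_addr -shpN shp_mono. Qed.

Lemma shp_box p q i j : (shp T p i <= j < shp T q i)%N -> (q <= N)%N ->
  exists b : box g a, [/\ box_row b = i, box_col b = j & (p <= T b < q)%N].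
Proof.
move=> /andP[pj jq] qN; have [|b [bi bj]] := @box_ex g a i j.
  have /andP[_ ?] := shp_bounds i qN.
  by have : (part a i <= shp T p i)%N := leq_addr _ _; lia.
by exists b; rewrite leqNgt !ltn_shp bi bj; split=> //; lia.
Qed.

Lemma shp_step p : (p < N)%N -> Step s (shp T p) (shp T p.+1).
Proof.
move=> pN i; have [ag ska] := skew_shapeP sk.
have lep := shp_bounds i (ltnW pN); have leSp := shp_bounds i pN.
split; first exact: shp_mono.
- rewrite -implyNb; apply/implyP => s0; rewrite leqNgt; apply/negP => lt2.
  have [|b [bi bj Tb]] := @shp_box p p.+1 i (shp T p i) _ pN; first by lia.
  have [|c [ci cj Tc]] := @shp_box p p.+1 i (shp T p i).+1 _ pN; first by lia.
  by have := @tabs_rows s T b c tT; rewrite bi bj ci cj (negPf s0) => /(_ erefl); lia.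
- move=> lt1 j ij.
  have [|b [bi bj Tb]] := @shp_box p p.+1 i (shp T p i) _ pN; first by lia.
  have aj := ska i _ j ij.
  rewrite leqNgt; apply/negP => jlt.
  (* Columns satisfy [T b + s <= T c] for [c] below [b]. Here [b] has the value [p], so a box below
     it with a value under [p + s] is a contradiction. *)
  have [||c [cj cc Tc]] := @shp_box 0 (p + s) j (shp T p i).
  + by rewrite shp0; case: (s) jlt => /= jlt; rewrite ?addn1 ?addn0; have := aj; lia.
  + by case: (s); lia.
  have := @tabs_cols s T b c tT; rewrite bi bj cj cc => /(_ erefl ij).
  by lia.
Qed.

(** This makes the intermediate shapes compositions: a nonempty row below an empty one would put, in
    the first column, a value under [p] below a value of at least [p]. *)
Lemma down0_shp p : (p <= N)%N -> down0 (shp T p).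
Proof.
move=> pN i j; rewrite leq_eqVlt => /orP[/eqP->//|ij i0].
have [ag ska] := skew_shapeP sk.
have ai : part a i = 0%N by have := shp_bounds i pN; lia.
have [gi|gi] := posnP (part g i).
  by have := @down0_part g i j (ltnW ij) gi; have := shp_bounds j pN; lia.
have aj : part a j = 0%N by have := ska i _ j ij; lia.
apply/eqP; rewrite -leqn0 leqNgt; apply/negP => j0.
have [|c [cj cc Tc]] := @shp_box 0 p j 0 _ pN; first by rewrite shp0 aj.
have [|b [bi bj Tb]] := @shp_box p N i 0 _ (leqnn N); first by rewrite shpN i0.
by have := @tabs_cols s T b c tT; rewrite bi bj cj cc => /(_ erefl ij); lia.
Qed.

End Tableau.

(** Each box receives the index of the step at which the growing shapes first cover it. *)
Lemma fill_ex (c : nat -> nat -> nat) : (forall i, c 0%N i = part a i) ->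
    (forall i, c N i = part g i) -> (forall p i, (p < N)%N -> (c p i <= c p.+1 i)%N) ->
  exists T, (forall b p, (p <= N)%N -> (T b < p)%N = (box_col b < c p (box_row b))%N)
            /\ (forall p, (p <= N)%N -> shp T p =1 c p).
Proof.
move=> c0 cN cS.
have mono p q i : (p <= q)%N -> (q <= N)%N -> (c p i <= c q i)%N.
  elim: q => [|q IHq]; first by rewrite leqn0 => /eqP->.
  rewrite leq_eqVlt => /orP[/eqP->//|pq qN].
  exact: leq_trans (IHq pq (ltnW qN)) (cS _ _ qN).
pose P (b : box g a) p := (box_col b < c p.+1 (box_row b))%N.
pose v b := find (P b) (iota 0 N).
have hasP b : has (P b) (iota 0 N).
  case N0: N cN c0 => [|M] cN c0.
    by have := box_bounds b; rewrite -c0 -cN; lia.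
  by apply/hasP; exists M; rewrite ?mem_iota //= /P cN; have /andP[] := box_bounds b.
have vN b : (v b < N)%N by rewrite -[X in (_ < X)%N](size_iota 0) -has_find.
have vE b p : (p <= N)%N -> (v b < p)%N = (box_col b < c p (box_row b))%N.
  move=> pN; apply/idP/idP => [vp|].
    have := nth_find 0%N (hasP b); rewrite -/(v b) nth_iota // add0n => Pv.
    exact: leq_trans Pv (mono _ _ _ vp pN).
  case: p pN => [|p] pN; first by rewrite c0; have := box_bounds b; lia.
  move=> bp; rewrite ltnNge; apply/negP => /(before_find 0%N).
  by rewrite nth_iota // add0n /P bp.
exists [ffun b => Ordinal (vN b)]; split=> [b p pN|p pN i]; first by rewrite ffunE /= vE.
rewrite /shp -(eq_card (_ : [set b : box g a | (box_row b == i) && (box_col b < c p i)%N] =i _)).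
  rewrite card_row; have := (mono 0%N p i (leq0n _) pN, mono p N i pN (leqnn _)).
  by rewrite c0 cN => -[? ?]; rewrite (minn_idPl _) // subnKC.
by move=> b; rewrite !inE ffunE /= vE //; case: eqP => // ->.
Qed.

(** The step that adds a box bounds the later rows by the column of that box. For the first box
    added to a row this gives the condition on the skew shape; for two boxes of one column it gives
    the column condition. *)
Lemma fill_tabs (s : bool) (T : filling g a N) :
    (forall b p, (p <= N)%N -> (T b < p)%N = (box_col b < shp T p (box_row b))%N) ->
    shp T N =1 part g -> (forall p, (p < N)%N -> Step s (shp T p) (shp T p.+1)) ->
  skew_shape g a && tabs s T.
Proof.
move=> TE TN Ts; have Tb b := TE b (T b) (ltnW (ltn_ord _)).
have TSb b := TE b (T b).+1 (ltn_ord _).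
have lb b : (shp T (T b) (box_row b) <= box_col b)%N by rewrite leqNgt -Tb ltnn.
have ub b : (box_col b < shp T (T b).+1 (box_row b))%N by rewrite -TSb.
apply/andP; split.
  apply/skew_shapeP; split=> i; first by rewrite -TN leq_addr.
  move=> ai j ij; have [|b [bi bj]] := @box_ex g a i (part a i); first by lia.
  have [_ _ H] := Ts (T b) (ltn_ord _) i.
  have E : shp T (T b) i = part a i.
    by apply/eqP; rewrite eqn_leq leq_addr andbT -bj -bi lb.
  have := H _ j ij; rewrite E => H'.
  have {}H' : ((if s then shp T (T b).+1 j else shp T (T b) j) <= part a i)%N.
    by apply: H'; rewrite -bj -bi ub.
  by apply: leq_trans H'; case: (s); rewrite leq_addr.
apply: tabsP => b c bc bcc.
  have bcT : (T b <= T c)%N.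
    by rewrite leqNgt (TE c (T b) (ltnW (ltn_ord _))) -leqNgt -bc (leq_trans (lb b) (ltnW bcc)).
  case: s Ts => Ts; rewrite ?addn1 ?ltnS ?addn0 // ltn_neqAle bcT andbT.
  apply/eqP => bcE; have := lb b; have := ub c; rewrite -bcE -bc => u l.
  by have [_ + _] := Ts (T b) (ltn_ord _) (box_row b); rewrite /=; lia.
have [_ _ H] := Ts (T b) (ltn_ord _) (box_row b).
have u := ub b; have {}H := H (leq_ltn_trans (lb b) u) _ bcc.
have {}H := leq_trans H (lb b).
case: s Ts H => _ /= H; rewrite ?addn1 ?addn0 leqNgt.
  by rewrite (TE c (T b).+1 (ltn_ord _)) -leqNgt -bc.
by rewrite (TE c (T b) (ltnW (ltn_ord _))) -leqNgt -bc.
Qed.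

End Shapes.

(** * Chains of steps and the number of tableaux of a given type *)

Fixpoint Chains (s : bool) (a g : composition) (N : nat) : seq (seq composition) :=
  if N is M.+1 then
    flatten [seq [seq rcons c g | c <- Chains s a d M]
            | d : composition <- comps_range 0 (sumn g) & step s d g]
  else if a == g then [:: [:: a]] else [::].

Lemma ChainsS s a g N : Chains s a g N.+1 =
  flatten [seq [seq rcons c g | c <- Chains s a d N]
          | d : composition <- comps_range 0 (sumn g) & step s d g].
Proof. by []. Qed.

Lemma ChainsP s a g N c :
  reflect [/\ size c = N.+1, nth comp0 c 0 = a, nth comp0 c N = g
           & forall p, (p < N)%N -> step s (nth comp0 c p) (nth comp0 c p.+1)]
  (c \in Chains s a g N).
Proof.
elim: N g c => [|N IHN] g c.
  apply: (iffP idP) => [|[]] /=.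
    by case: eqP => // ->; rewrite inE => /eqP->.
  by case: c => [//|x [|//]] _ /= -> -> _; rewrite eqxx inE.
rewrite ChainsS; apply: (iffP flatten_mapP) => [[d]|[]].
  rewrite mem_filter => /andP[dg _] /mapP[c' /IHN[sz c0 cN cs] ->].
  split; rewrite ?size_rcons ?nth_rcons ?sz ?ltnn ?eqxx // => p pN.
  have [->|pN'] : p = N \/ (p < N)%N by lia.
    by rewrite !nth_rcons sz ltnSn ltnn eqxx cN.
  by rewrite !nth_rcons sz !ltnS (ltnW pN') pN' cs.
case/lastP: c => [//|c x]; rewrite size_rcons => -[sz] + + cs.
rewrite !nth_rcons sz ltn0Sn ltnn eqxx => c0 xg.
exists (nth comp0 c N).
  have := cs N (ltnSn N); rewrite !nth_rcons sz ltnSn ltnn eqxx xg => sg.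
  by rewrite mem_filter sg mem_comps_range /= add0n; apply: step_sumn sg.
rewrite xg; apply: map_f; apply/IHN; split=> // p pN.
by have := cs p (ltnW pN); rewrite !nth_rcons sz !ltnS pN (ltnW pN).
Qed.

Lemma uniq_Chains s a g N : uniq (Chains s a g N).
Proof.
elim: N g => [|N IHN] g; [by rewrite /=; case: eqP | rewrite ChainsS].
have : uniq [seq d : composition <- comps_range 0 (sumn g) | step s d g].
  by rewrite filter_uniq ?uniq_comps_range.
elim: [seq _ <- _ | _] => [//|d r IHr] /= /andP[dr ur].
rewrite cat_uniq IHr // andbT map_inj_uniq ?IHN /=; last first.
  by move=> c c' /rcons_inj[].
apply/hasPn => c /flatten_mapP[d' d'r /mapP[c' /ChainsP[_ _ cd' _] ->]].
apply/mapP => -[c'' /ChainsP[_ _ cd _] /rcons_inj[E]].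
by rewrite -E cd' in cd; rewrite -cd d'r in dr.
Qed.

Section ChainOfTableau.
Variables (g a : composition) (N : nat).
Implicit Type T : filling g a N.

Definition chain T : seq composition := [seq comp_of_fun (shp T p) (size g) | p <- iota 0 N.+1].

Lemma part_chain s T p : skew_shape g a -> tabs s T -> (p <= N)%N ->
  part (nth comp0 (chain T) p) =1 shp T p.
Proof.
move=> sk tT pN i; rewrite (nth_map 0%N) ?size_iota // nth_iota // add0n part_comp_of_fun //.
  exact: (down0_shp sk tT pN).
move=> j gj; apply/eqP; rewrite -leqn0 -(@part_default g j) //.
by have /andP[] := shp_bounds T sk j pN.
Qed.

(** The bijection between tableaux and chains, for an arbitrary commutative operation because it is
    applied both to cardinalities and to generating polynomials. *)
Lemma big_tabs (R : Type) (idx : R) (op : Monoid.com_law idx) s (F : seq composition -> R) :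
  \big[op/idx]_(T : filling g a N | skew_shape g a && tabs s T) F (chain T) =
  \big[op/idx]_(c <- Chains s a g N) F c.
Proof.
rewrite -big_enum -(big_map chain xpredT F); apply: perm_big; apply: uniq_perm.
- rewrite map_inj_in_uniq ?enum_uniq // => T T'.
  rewrite !mem_enum => /andP[sk tT] /andP[_ tT'] TT'.
  have E b p : (p <= N)%N -> (T b < p)%N = (T' b < p)%N.
    by move=> pN; rewrite (ltn_shp sk tT) (ltn_shp sk tT') -(part_chain sk tT) //
       TT' (part_chain sk tT').
  apply/ffunP => b; apply/val_inj/eqP; rewrite eqn_leq /=.
  by rewrite -ltnS E // ltnS leqnn -ltnS -E // ltnS leqnn.
- exact: uniq_Chains.
move=> c; apply/mapP/ChainsP => [[T]|[sz c0 cN cs]].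
  rewrite mem_enum => /andP[sk tT ->]; have pc p := @part_chain s T p sk tT.
  split; first by rewrite size_map size_iota.
  - by apply: comp_ext => i; rewrite pc // shp0.
  - by apply: comp_ext => i; rewrite pc // (shpN T sk).
  - move=> p pN; have [pc1 pc2] := (pc p (ltnW pN), pc p.+1 pN).
    apply/stepP => i; have [h1 h2 h3] := shp_step sk tT pN i.
    by rewrite pc1 pc2; split=> // h j ij; rewrite pc1 pc2; apply: h3.
have [|||T [TE Tc]] := @fill_ex g a N (fun p => part (nth comp0 c p)).
- by rewrite c0.
- by rewrite cN.
- by move=> p i /cs/stepP/(_ i)[].
have /andP[sk tT] : skew_shape g a && tabs s T.
  apply: fill_tabs => [b p pN||p pN]; first by rewrite Tc // TE.
    by move=> i; rewrite Tc // cN.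
  have [Tc1 Tc2] := (Tc p (ltnW pN), Tc p.+1 pN).
  move=> i; have [h1 h2 h3] := stepP _ _ _ (cs _ pN) i.
  by rewrite Tc1 Tc2; split=> // h j ij; rewrite Tc1 Tc2; apply: h3.
exists T; first by rewrite mem_enum; apply/andP.
apply: (eq_from_nth (x0 := comp0)); rewrite ?size_map ?size_iota ?sz // => p pN.
by apply: comp_ext => i; rewrite (part_chain sk tT) // Tc.
Qed.

Lemma sumn_chain s T p : skew_shape g a -> tabs s T -> (p <= N)%N ->
  sumn (nth comp0 (chain T) p) = (sumn a + #|[set b | (T b < p)%N]|)%N.
Proof.
move=> sk tT pN; have [ag _] := skew_shapeP g a sk.
have szc : (size (nth comp0 (chain T) p) <= size g)%N.
  rewrite leqNgt -comp_part_gt0 (part_chain sk tT) // -leqNgt.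
  by have /andP[_] := shp_bounds T sk (size g) pN; rewrite [part g _]part_default.
have sza : (size a <= size g)%N.
  by rewrite leqNgt -comp_part_gt0 -leqNgt; apply: leq_trans (ag _) _; rewrite part_default.
rewrite (sumn_part szc) (sumn_part sza) card_rows -big_split.
by apply: eq_bigr => i _; rewrite (part_chain sk tT).
Qed.

End ChainOfTableau.

Definition ctype (c : seq composition) : seq nat :=
  mkseq (fun p => sumn (nth comp0 c p.+1) - sumn (nth comp0 c p))%N (size c).-1.

Lemma tab_type_chain (g a : composition) N s (T : filling g a N) (p : 'I_N) :
  skew_shape g a -> tabs s T -> tab_type T p = nth 0%N (ctype (chain T)) p.
Proof.
move=> sk tT; rewrite mnmE nth_mkseq ?size_map ?size_iota //.
rewrite (sumn_chain sk tT (ltn_ord p)) (sumn_chain sk tT (ltnW (ltn_ord p))) subnDl.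
rewrite -cardsDS; last by apply/subsetP => b; rewrite !inE => /ltnW; rewrite ltnS.
by apply: eq_card => b; rewrite !inE ltnS -leqNgt -val_eqE eqn_leq andbC.
Qed.


Lemma size_ctype c : size (ctype c) = (size c).-1.
Proof. exact: size_mkseq. Qed.

Lemma tab_type_ctype (g a : composition) (b : seq nat) s (T : filling g a (size b)) :
  skew_shape g a -> tabs s T -> (tab_type T == comp_mnm b) = (ctype (chain T) == b).
Proof.
move=> sk tT; apply/eqP/eqP => [/mnmP E|E].
  apply: (eq_from_nth (x0 := 0%N)); rewrite size_ctype size_map size_iota // => i ib.
  by have := E (Ordinal ib); rewrite (tab_type_chain _ sk tT) mnmE.
by apply/mnmP => i; rewrite (tab_type_chain _ sk tT) mnmE E.
Qed.

Definition nb_tab (s : bool) (a g : composition) (b : seq nat) : nat :=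
  count (fun c => ctype c == b) (Chains s a g (size b)).

Lemma card_nb_tab (s : bool) (g a : composition) (b : seq nat) :
  #|[set T : filling g a (size b) |
     [&& skew_shape g a, tabs s T & tab_type T == comp_mnm b]]| = nb_tab s a g b.
Proof.
rewrite /nb_tab -sum1_count big_mkcond /= -(big_tabs g a (size b) _ s (fun c => if ctype c == b then 1%N else 0%N)).
rewrite -big_mkcondr -sum1_card; apply: eq_bigl => T; rewrite !inE -andbA.
case: (boolP (skew_shape g a)) => //= sk; case: (boolP (tabs s T)) => //= tT.
by rewrite (tab_type_ctype sk tT).
Qed.

Lemma skew_shape0 (g : composition) : skew_shape g comp0.
Proof. by apply/skew_shapeP; split=> [i|i _ j _]; rewrite !part_comp0. Qed.

Lemma K_sh_nb_tab (g b : composition) : K_sh g b = nb_tab true comp0 g b.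
Proof.
by rewrite -card_nb_tab; apply: eq_card => T; rewrite !inE skew_shape0.
Qed.

Lemma K_RS_nb_tab (g b : composition) : K_RS g b = nb_tab false comp0 g b.
Proof.
by rewrite -card_nb_tab; apply: eq_card => T; rewrite !inE skew_shape0.
Qed.

Lemma nb_tab_nil s a g : nb_tab s a g [::] = (a == g).
Proof. by rewrite /nb_tab /=; case: eqP => //= ->. Qed.

Lemma ctype_rcons c g : c != [::] ->
  ctype (rcons c g) = rcons (ctype c) (sumn g - sumn (nth comp0 c (size c).-1))%N.
Proof.
case/lastP: c => // c x _; rewrite /ctype !size_rcons /=.
have mkseqS (f : nat -> nat) n : mkseq f n.+1 = rcons (mkseq f n) (f n).
  by rewrite /mkseq -addn1 iotaD map_cat cats1.
rewrite mkseqS; congr rcons; last by rewrite !nth_rcons !size_rcons !ltnn !eqxx ltnSn.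
apply/eq_in_map => p; rewrite mem_iota add0n => /= pc.
by rewrite nth_rcons size_rcons ltnS pc [nth _ (rcons (rcons c x) g) p]nth_rcons size_rcons (leqW pc).
Qed.

Lemma nb_tab_rcons s a g b m : nb_tab s a g (rcons b m) =
  (\sum_(d <- comps_range 0 (sumn g) | step s d g && (sumn g - sumn d == m)) nb_tab s a d b)%N.
Proof.
rewrite /nb_tab size_rcons ChainsS count_flatten sumnE big_map big_map big_filter.
rewrite big_mkcondr; apply: eq_bigr => d _; rewrite count_map.
case: eqP => [dm|dm].
  apply: eq_in_count => c /ChainsP[sz _ cN _] /=.
  rewrite ctype_rcons -?size_eq0 ?sz //= cN dm.
  by rewrite eqseq_rcons eqxx andbT.
rewrite -(count_pred0 (Chains s a d (size b))); apply: eq_in_count => c /ChainsP[sz _ cN _] /=.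
rewrite ctype_rcons -?size_eq0 ?sz //= cN eqseq_rcons; apply/negP => /andP[_ /eqP] //.
Qed.

Lemma nb_tab_rcons_comps s (a g : composition) b m n : sumn g = (n + m)%N ->
  nb_tab s a g (rcons b m) = (\sum_(d <- comps n | step s d g) nb_tab s a d b)%N.
Proof.
move=> gn; rewrite nb_tab_rcons -big_filter -[RHS]big_filter; apply: perm_big; apply: uniq_perm.
- by rewrite filter_uniq ?uniq_comps_range.
- by rewrite filter_uniq ?uniq_comps.
move=> d; rewrite !mem_filter mem_comps mem_comps_range add0n /= -andbA.
by case: (boolP (step s d g)) => //= /step_sumn; rewrite gn; lia.
Qed.

Lemma nb_tab_sumn s (a g : composition) b : sumn g != (sumn a + sumn b)%N -> nb_tab s a g b = 0%N.
Proof.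
elim/last_ind: b g => [|b m IHb] g.
  by rewrite nb_tab_nil addn0 => ne; case: (a =P g) ne => // ->; rewrite eqxx.
move=> ne; rewrite nb_tab_rcons big1 // => d /andP[/step_sumn dg /eqP gm].
apply: IHb; apply: contra ne => /eqP dab; rewrite sumn_rcons; lia.
Qed.

(** Each factor adds one strip, so the coefficients count chains. The ring is arbitrary because the
    rule is iterated in [NSym] and, for the forgetful map, among polynomials. *)
Lemma pieri_prod (A : pzRingType) s (B : composition -> A) (X : nat -> A) :
  pieri s B X -> forall (a b : composition),
  B a * \prod_(i <- b) X i = \sum_(g <- comps (sumn a + sumn b)) B g *+ nb_tab s a g b.
Proof.
move=> BX a b; elim/last_ind: (parts b) (parts_pos b) => [_|{}b m IHb].
  rewrite big_nil mulr1 addn0 (bigD1_seq a) ?uniq_comps ?mem_comps //= nb_tab_nil eqxx.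
  by rewrite big1 ?addr0 // => g ga; rewrite nb_tab_nil eq_sym (negPf ga).
rewrite -cats1 mem_cat negb_or => /andP[b0]; rewrite inE eq_sym -lt0n => m0.
rewrite cats1 -cats1 big_cat /= big_seq1 mulrA {}IHb // mulr_suml.
transitivity (\sum_(d <- comps (sumn a + sumn b))
  \sum_(g <- comps (sumn a + sumn b + m)) if step s d g then B g *+ nb_tab s a d b else 0).
  apply: eq_big_seq => d; rewrite mem_comps => /eqP dab.
  by rewrite mulrnAl BX // dab -sumrMnl big_mkcond.
rewrite exchange_big /= cats1 sumn_rcons addnA; apply: eq_big_seq => g.
by rewrite mem_comps => /eqP gab; rewrite -big_mkcond (nb_tab_rcons_comps _ _ _ gab) -sumrMnr.
Qed.

Lemma shin_pieri (Sh : composition -> NSym) : shin_basis Sh -> pieri true Sh nsH.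
Proof.
case=> _ H a m m0; rewrite H // big_seq_cond [RHS]big_seq_cond; apply: eq_bigl => d.
by rewrite stepS mem_comps; case: eqP => //= _; rewrite andbT.
Qed.

Lemma coef_RSstar (b c : composition) : coef_M (RSstar b) c = (K_RS b c)%:R.
Proof.
rewrite /coef_M /RSstar raddf_sum /= /K_RS -sum1_card natr_sum big_mkcond [RHS]big_mkcond.
apply: eq_bigr => T _; rewrite inE mcoeffX.
by case: rs_tab => //=; case: eqP.
Qed.

(** * Pieri rules and E-expansions for the row-strict and the shin bases *)

Section RowStrict.
Variable RS : composition -> NSym.
Hypothesis hRS : row_strict_shin_basis RS.

Let kappa (b c : composition) : rat := (nb_tab false comp0 b c)%:R.

Let kappa0 (b c : composition) : sumn b != sumn c -> kappa b c = 0.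
Proof. by move=> bc; rewrite /kappa nb_tab_sumn. Qed.

Let dual (a b : composition) :
  \sum_(c <- monalg.msupp (RS a)) monalg.mcoeff c (RS a) * kappa b c = (a == b)%:R.
Proof.
rewrite -hRS /pairing; apply: eq_bigr => c _.
by rewrite coef_RSstar K_RS_nb_tab.
Qed.

Lemma nsHc_RS (c : composition) :
  nsHc c = \sum_(b <- comps (sumn c)) (nb_tab false comp0 b c)%:R *: RS b.
Proof. exact: (nsHc_expand kappa0 dual). Qed.

Lemma RS_nsHc (a : composition) :
  RS a = \sum_(c <- comps (sumn a)) monalg.mcoeff c (RS a) *: nsHc c.
Proof. exact: (dual_expand kappa0 dual). Qed.

Lemma RS_orth (a b : composition) :
  \sum_(c <- comps (sumn a)) monalg.mcoeff c (RS a) * (nb_tab false comp0 b c)%:R = (a == b)%:R.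
Proof. exact: (dual_orth kappa0 dual). Qed.

Lemma RS0 : RS comp0 = 1.
Proof.
transitivity (nsHc comp0); last by rewrite /nsHc big_nil.
by rewrite nsHc_RS /= big_cons big_nil addr0 nb_tab_nil scale1r.
Qed.

(** Multiplication by H appends a part to every composition in the H-expansion of [RS a], hence a
    last strip to the chains being counted. Orthogonality then keeps only the chains whose last
    shape but one is [a]. *)
Lemma RS_pieri : pieri false RS nsH.
Proof.
move=> a m m0; have -> : nsH m = nsHc (mkcomp [:: m]).
  by rewrite -(prednK m0) nsHc1.
rewrite {1}RS_nsHc mulr_suml.
transitivity (\sum_(c <- comps (sumn a)) \sum_(g <- comps (sumn a + m))
  \sum_(d <- comps (sumn a) | step false d g)
    (monalg.mcoeff c (RS a) * (nb_tab false comp0 d c)%:R) *: RS g).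
  apply: eq_big_seq => c; rewrite mem_comps => /eqP ca.
  rewrite -scalerAl -nsHc_cat nsHc_RS.
  have catE : cat_comp c (mkcomp [:: m]) = rcons c m :> seq nat.
    by rewrite cat_compE (@mkcomp_id [:: m]) ?cats1 // inE eq_sym -lt0n.
  rewrite catE sumn_rcons ca scaler_sumr; apply: eq_big_seq => g.
  rewrite mem_comps => /eqP gE; rewrite (nb_tab_rcons_comps _ _ _ gE) natr_sum scalerA.
  by rewrite mulr_sumr scaler_suml.
rewrite exchange_big /= [RHS]big_mkcond; apply: eq_big_seq => g _.
rewrite exchange_big /=; transitivity (\sum_(d <- comps (sumn a) | step false d g)
    (a == d)%:R *: RS g).
  by apply: eq_bigr => d _; rewrite -scaler_suml RS_orth.
rewrite big_mkcond (bigD1_seq a) ?mem_comps ?uniq_comps //= eqxx scale1r.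
rewrite big1 ?addr0 // => d da; rewrite eq_sym (negPf da) scale0r.
by case: ifP.
Qed.

End RowStrict.

Lemma pieri_prod0 s (B : composition -> NSym) (X : nat -> NSym) :
  B comp0 = 1 -> pieri s B X -> forall b : composition,
  \prod_(i <- b) X i = \sum_(g <- comps (sumn b)) (nb_tab s comp0 g b)%:R *: B g.
Proof.
move=> B0 BX b; have := pieri_prod BX comp0 b; rewrite B0 mul1r => ->.
by apply: eq_bigr => g _; rewrite scaler_nat.
Qed.

Lemma nsEc_RS (RS : composition -> NSym) (b : composition) : row_strict_shin_basis RS ->
  nsEc b = \sum_(a <- comps (sumn b)) (K_sh a b)%:R *: RS a.
Proof.
move=> hRS; rewrite /nsEc (pieri_prod0 (RS0 hRS) (pieri_nsE (RS_pieri hRS))).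
by apply: eq_bigr => a _; rewrite K_sh_nb_tab.
Qed.

Lemma nsEc_Sh (Sh : composition -> NSym) (b : composition) : shin_basis Sh ->
  nsEc b = \sum_(a <- comps (sumn b)) (K_RS a b)%:R *: Sh a.
Proof.
move=> hSh; rewrite /nsEc (pieri_prod0 hSh.1 (pieri_nsE (shin_pieri hSh))).
by apply: eq_bigr => a _; rewrite K_RS_nb_tab.
Qed.

Lemma RS_nsE (RS : composition -> NSym) (a : composition) m : row_strict_shin_basis RS ->
  (0 < m)%N ->
  RS a * nsE m = \sum_(d <- comps (sumn a + m) | shin_sub m a d) RS d.
Proof.
move=> hRS m0; have P := pieri_nsE (RS_pieri hRS); rewrite P //.
rewrite big_seq_cond [RHS]big_seq_cond; apply: eq_bigl => d.
by rewrite stepS mem_comps; case: eqP => //= _; rewrite andbT.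
Qed.

(** * Ribbons *)
Lemma psums_cons x s : s != [::] ->
  psums (x :: s) = x :: [seq (x + j)%N | j <- psums s].
Proof.
case: s => // y s _; rewrite /psums /= addn0; congr (_ :: _).
rewrite -[2%N]/(1 + 1)%N iotaDl -!map_comp; exact: eq_map.
Qed.

Lemma psums_incr x s : psums (x.+1 :: s) = [seq j.+1 | j <- psums (x :: s)].
Proof.
by rewrite /psums -map_comp; apply/eq_in_map => -[|i]; rewrite mem_iota.
Qed.

Lemma size_psums s : size (psums s) = (size s).-1.
Proof. by rewrite size_map size_iota. Qed.

Lemma psums_sorted (b : composition) :
  sorted ltn (psums b) /\ forall i, i \in psums b -> (0 < i < sumn b)%N.
Proof.
elim: (parts b) (parts_pos b) => [//|x s IHs].
rewrite inE negb_or eq_sym -lt0n => /andP[x0 s0]; have [IH1 IH2] := IHs s0.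
have [->|sn] := eqVneq s [::]; first by [].
have s1 : (0 < sumn s)%N by case: s sn s0 {IHs IH1 IH2} => // -[//|y] s _ _.
rewrite psums_cons //; split.
  rewrite /= path_sortedE; last exact: ltn_trans.
  apply/andP; split; first by apply/allP => _ /mapP[j /IH2 j0 ->] /=; lia.
  by rewrite sorted_map; apply: sub_sorted IH1 => i j /=; rewrite ltn_add2l.
move=> i; rewrite inE => /orP[/eqP->|/mapP[j /IH2 js ->]] /=; lia.
Qed.

Lemma psumsK s : s != [::] ->
  pairmap (fun x y => (y - x)%N) 0%N (rcons (psums s) (sumn s)) = s.
Proof.
suff H x0 : s != [::] -> pairmap (fun x y => (y - x)%N) x0
    (rcons [seq (x0 + j)%N | j <- psums s] (x0 + sumn s)%N) = s.
  by move=> /(H 0%N); rewrite (eq_map (g := id)) ?map_id.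
elim: s x0 => // x s IHs x0 _; have [->|sn] := eqVneq s [::].
  by rewrite /= addn0 addKn.
rewrite psums_cons //= addKn -map_comp; congr (_ :: _).
apply: etrans (IHs (x0 + x)%N sn); rewrite addnA; congr (pairmap _ _ (rcons _ _)).
by apply: eq_map => j /=; rewrite addnA.
Qed.

Lemma psums_pairmap x0 l n : path ltn x0 (rcons l n) ->
  let s := pairmap (fun x y => (y - x)%N) x0 (rcons l n) in
  [/\ 0%N \notin s, psums s = [seq (y - x0)%N | y <- l] & sumn s = (n - x0)%N].
Proof.
elim: l x0 => [|y l IHl] x0 /=.
  by rewrite andbT => xn; rewrite inE addn0 /psums /=; split=> //; lia.
move=> /andP[xy pl]; have [H1 H2 H3] := IHl y pl.
have yn : (y < n)%N.
  move: pl; rewrite path_sortedE => [/andP[/allP/(_ n) + _]|]; last exact: ltn_trans.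
  by apply; rewrite mem_rcons inE eqxx.
rewrite inE negb_or H1 H3; split; [by apply/andP; split=> //; lia| |lia].
rewrite psums_cons; last by case: (l).
rewrite H2 -map_comp; congr (_ :: _); apply/eq_in_map => z zl /=.
suff : (y < z)%N by lia.
move: pl; rewrite path_sortedE => [/andP[/allP/(_ z) + _]|]; last exact: ltn_trans.
by apply; rewrite mem_rcons inE zl orbT.
Qed.

(** The bijection between compositions of [n] and subsets of [[n-1]], in the form in which it is
    used: equality of descent compositions becomes a pointwise comparison of sets. *)
Lemma comp_ofP n (S : pred nat) (b : composition) : (comp_of n S == b) =
  (sumn b == n) && all (fun i => S i == (i \in psums b)) (iota 1 n.-1).
Proof.
have [->|n0] := posnP n.
  apply/eqP/andP => [<-//|[/eqP b0 _]].
  by rewrite (comp_eq0 b0); apply: parts_inj.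
have pth : path ltn 0 (rcons [seq i <- iota 1 n.-1 | S i] n).
  rewrite rcons_path path_sortedE; last exact: ltn_trans.
  have lP i : i \in [seq i <- iota 1 n.-1 | S i] -> (0 < i < n)%N.
    by rewrite mem_filter mem_iota => /andP[_]; lia.
  apply/andP; split; last first.
    by have := mem_last 0%N [seq i <- iota 1 n.-1 | S i]; rewrite inE => /orP[/eqP->|/lP/andP[]].
  apply/andP; split; first by apply/allP => i /lP/andP[].
  apply: sorted_filter; [exact: ltn_trans|exact: iota_ltn_sorted].
have [H1 H2 H3] := psums_pairmap pth.
apply/eqP/andP => [<-|[/eqP bn /allP H]].
  rewrite /comp_of mkcomp_id // H3 subn0 eqxx; split=> //; apply/allP => i ii.
  rewrite H2 (eq_map (g := id)) ?map_id => [|j]; last by rewrite subn0.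
  by rewrite mem_filter ii andbT.
have [bs br] := psums_sorted b.
have E : [seq i <- iota 1 n.-1 | S i] = psums b.
  apply: (irr_sorted_eq ltn_trans ltnn) => //.
    apply: sorted_filter; [exact: ltn_trans|exact: iota_ltn_sorted].
  move=> i; rewrite mem_filter; apply/andP/idP => [[Si ii]|ib].
    by have := H i ii; rewrite Si => /eqP<-.
  have := br i ib; rewrite bn => i0; have ii : i \in iota 1 n.-1 by rewrite mem_iota; lia.
  by have := H i ii; rewrite ib => /eqP->.
apply: parts_inj; rewrite /comp_of mkcomp_id // E -bn psumsK //.
by rewrite -size_eq0; apply: contraTneq n0 => /eqP; rewrite size_eq0 => /eqP b0; rewrite -bn b0.
Qed.

Lemma comp_complP (b : composition) : sumn (comp_compl b) = sumn b /\
  forall i, (0 < i < sumn b)%N -> (i \in psums (comp_compl b)) = (i \notin psums b).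
Proof.
have := eqxx (comp_compl b); rewrite {1}/comp_compl comp_ofP => /andP[/eqP sb /allP H].
split=> // i ib; have := H i; rewrite mem_iota => /(_ _)/eqP <- //; lia.
Qed.

Lemma count_psums (b : composition) :
  count (mem (psums b)) (iota 1 (sumn b).-1) = (size b).-1.
Proof.
have [bs br] := psums_sorted b.
rewrite -size_filter -size_psums; apply: perm_size; apply: uniq_perm.
- by rewrite filter_uniq ?iota_uniq.
- by apply: sorted_uniq bs; [apply: ltn_trans | apply: ltnn].
- move=> i; rewrite mem_filter mem_iota; apply/andP/idP => [[]//|ib]; split=> //.
  by have := br i ib; lia.
Qed.

(* The left-hand side factors over the elements [i] of [1, n - 1]: each
   contributes [~~ D i - P i]. *)
Lemma comps_seq_moebius n (D P : pred nat) : (0 < n)%N ->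
  \sum_(c <- comps_seq n | all P (psums c) &&
      all (fun i => D i ==> (i \in psums c)) (iota 1 n.-1)) (-1) ^+ size c =
  (-1) ^+ (count P (iota 1 n.-1)).+1 *+ all (fun i => D i == P i) (iota 1 n.-1) :> rat.
Proof.
elim: n D P => // n IHn D P _; have [->|n0] := posnP n.
  by rewrite /= big_cons big_nil /= addr0.
have sn c : c \in comps_seq n -> c != [::].
  by rewrite mem_comps_seq; case: c => //= /eqP n0'; rewrite -n0' in n0.
have iotaS : iota 1 n.+1.-1 = 1%N :: [seq i.+1 | i <- iota 1 n.-1].
  by case: (n) n0 => // m _ /=; rewrite (iotaDl 1 1).
rewrite iotaS [comps_seq n.+1]/(_ ++ _) big_cat !big_map /=.
set PS := fun i => P i.+1; set DS := fun i => D i.+1.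
have memS (r : seq nat) i : (i.+1 \in [seq j.+1 | j <- r]) = (i \in r).
  by rewrite mem_map //; apply: succn_inj.
have -> : all (fun i => D i == P i) [seq i.+1 | i <- iota 1 n.-1] =
    all (fun i => DS i == PS i) (iota 1 n.-1) by rewrite all_map.
have -> : count P [seq i.+1 | i <- iota 1 n.-1] = count PS (iota 1 n.-1) by rewrite count_map.
set X := \sum_(c <- comps_seq n | all PS (psums c) &&
      all (fun i => DS i ==> (i \in psums c)) (iota 1 n.-1)) (-1) ^+ size c : rat.
(* First part 1: the element 1 lies in [psums], which requires [P 1], and the additional part
   changes the sign. *)
have E1 : \sum_(c <- comps_seq n | all P (psums (1%N :: c)) &&
   ((D 1%N ==> (1%N \in psums (1%N :: c))) &&
    all (fun i => D i ==> (i \in psums (1%N :: c))) [seq i.+1 | i <- iota 1 n.-1]))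
   (-1) ^+ (size c).+1 = - (X *+ P 1%N) :> rat.
  rewrite -sumrMnl -sumrN big_seq_cond [RHS]big_seq_cond big_mkcond [RHS]big_mkcond.
  apply: eq_bigr => c _; case: (boolP (c \in comps_seq n)) => //= cn.
  rewrite psums_cons ?sn //= inE eqxx implybT /= !all_map.
  have -> : all (preim succn (fun i => D i ==> (i \in 1%N :: [seq (1 + j)%N | j <- psums c])))
     (iota 1 n.-1) = all (fun i => DS i ==> (i \in psums c)) (iota 1 n.-1).
    apply: eq_in_all => i; rewrite mem_iota /= inE => /andP[i0 _].
    rewrite eqSS; have -> /= : (i == 0%N) = false by lia.
    by rewrite (eq_map (g := succn)) ?memS // => j; rewrite add1n.
  by case: (P 1%N) => //=; case: ifP; rewrite ?mulr0n ?mulr1n ?oppr0 // exprS mulN1r.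
(* First part at least 2: the element 1 is not in [psums], which requires [~~ D 1], and the number
   of parts is that of [c]. *)
have E2 : \sum_(c <- [seq c <- comps_seq n | c != [::]] |
   all P (psums ((head 0%N c).+1 :: behead c)) &&
   ((D 1%N ==> (1%N \in psums ((head 0%N c).+1 :: behead c))) &&
    all (fun i => D i ==> (i \in psums ((head 0%N c).+1 :: behead c)))
      [seq i.+1 | i <- iota 1 n.-1])) (-1) ^+ (size (behead c)).+1 = X *+ ~~ D 1%N :> rat.
  rewrite big_filter_cond -sumrMnl big_seq_cond [RHS]big_seq_cond big_mkcond [RHS]big_mkcond.
  apply: eq_bigr => c _; case: (boolP (c \in comps_seq n)) => //= cn.
  have := sn c cn; case: c cn => [//|x c] cn _ /=.
  rewrite psums_incr !all_map.
  have -> : (1%N \in [seq j.+1 | j <- psums (x :: c)]) = false.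
    rewrite memS; apply/negP; move: cn; rewrite mem_comps_seq => /andP[c0 _].
    by have [_ H] := psums_sorted (Composition c0) => /H.
  have -> : all (preim succn (fun i => D i ==> (i \in [seq j.+1 | j <- psums (x :: c)])))
     (iota 1 n.-1) = all (fun i => DS i ==> (i \in psums (x :: c))) (iota 1 n.-1).
    by apply: eq_in_all => i _; rewrite /= memS.
  by case: (D 1%N) => /=; rewrite ?andbF ?mulr0n ?mulr1n //; case: ifP.
rewrite E1 E2 /X IHn //.
have signS k : (-1) ^+ k.+1 = - (-1) ^+ k :> rat by rewrite exprS mulN1r.
case: (P 1%N) => /=; case: (D 1%N) => /=.
- by rewrite mulr1n mulr0n addr0 -mulNrn -signS add1n.
- by rewrite mulr0n !mulr1n addNr.
- by rewrite !mulr0n oppr0 addr0.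
- by rewrite mulr0n oppr0 add0r mulr1n.
Qed.

(** Inclusion-exclusion over the sets between [D] and the set of [b]. The truncated subtraction in
    the exponent is harmless because a coarsening has no more parts than [b]. *)
Lemma moebius_psums (D : pred nat) (b : composition) :
  \sum_(c <- comps (sumn b) | coarsens c b &&
      all (fun i => D i ==> (i \in psums c)) (iota 1 (sumn b).-1)) (-1) ^+ (size b - size c) =
  (all (fun i => D i == (i \in psums b)) (iota 1 (sumn b).-1))%:R :> rat.
Proof.
have [b0|b0] := posnP (sumn b).
  rewrite b0 (comp_eq0 b0) /= /comps /= big_cons big_nil /= /coarsens /= addr0.
  by rewrite expr0.
pose sgn := (-1) ^+ size b : rat.
transitivity (sgn * \sum_(c <- comps_seq (sumn b) | all (mem (psums b)) (psums c) &&
      all (fun i => D i ==> (i \in psums c)) (iota 1 (sumn b).-1)) (-1) ^+ size c).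
  rewrite mulr_sumr /comps big_map; rewrite big_seq_cond [RHS]big_seq_cond.
  apply: eq_big => [c|c /andP[cn /andP[cb _]]].
    case: (boolP (c \in comps_seq _)) => //; rewrite mem_comps_seq => /andP[c0 _].
    by rewrite mkcomp_id.
  move: cn cb; rewrite mem_comps_seq => /andP[c0 /eqP cn]; rewrite mkcomp_id // => /allP cb.
  have [cs _] := psums_sorted (Composition c0).
  have : (size (psums c) <= size (psums b))%N.
    by apply: uniq_leq_size => //; apply: sorted_uniq cs; [apply: ltn_trans | apply: ltnn].
  rewrite !size_psums /sgn -exprD -signr_odd -[RHS]signr_odd => szle; congr (_ ^+ _).
  suff : (0 < size b)%N by lia.
  by rewrite lt0n size_eq0; apply: contraTneq b0 => ->.
rewrite comps_seq_moebius // count_psums prednK; last first.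
  by rewrite lt0n size_eq0; apply: contraTneq b0 => ->.
by rewrite mulrnAr /sgn -exprD -signr_odd oddD addbb expr0.
Qed.

(** * Words of rows: shapes built one box at a time *)

Fixpoint words (K n : nat) : seq (seq nat) :=
  if n is m.+1 then [seq i :: w | i <- iota 0 K, w <- words K m] else [:: [::]].

Lemma mem_words K n w : (w \in words K n) = (size w == n) && all (gtn K) w.
Proof.
elim: n w => [|n IHn] [|i w] //=.
  by apply/allpairsP => -[[j v] []].
apply/allpairsP/andP => [[[j v] /= [jK vn [-> ->]]]|[sw /andP[iK wK]]].
  by move: jK vn; rewrite mem_iota IHn eqSS => /andP[_ ->] /andP[-> ->].
by exists (i, w); rewrite mem_iota IHn -eqSS sw wK.
Qed.

Lemma uniq_words K n : uniq (words K n).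
Proof.
elim: n => //= n IHn; apply: allpairs_uniq; rewrite ?iota_uniq //.
by move=> [i v] [j w] _ _ /= [-> ->].
Qed.

Lemma big_words_add (V : nmodType) K m n (F : seq nat -> V) :
  \sum_(w <- words K (m + n)) F w =
  \sum_(u <- words K m) \sum_(v <- words K n) F (u ++ v).
Proof.
elim: m F => [|m IHm] F; first by rewrite add0n big_seq1.
rewrite addSn /= !big_allpairs_dep; apply: eq_bigr => i _.
exact: (IHm (fun w => F (i :: w))).
Qed.

Definition rowlen (a : composition) (u : seq nat) (j : nat) : nat :=
  (part a j + count_mem j u)%N.

(** For a single box both values of [s] in [step] impose this same condition on later rows; the
    first clause keeps the shape a composition. The finite list in the second clause contains every
    row that can be nonempty. *)
Definition addable (a : composition) (u : seq nat) (i : nat) : bool :=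
  all (fun j => 0 < rowlen a u j)%N (iota 0 i) &&
  all (fun j => (i < j)%N ==> (rowlen a u j <= rowlen a u i)%N) (iota 0 (size a) ++ u).

(* The word [w] lists the rows to which boxes are added, one box at a time,
   starting from the shape [a]. *)
Definition valid (a : composition) (w : seq nat) : bool :=
  all (fun p => addable a (take p w) (nth 0%N w p)) (iota 0 (size w)).

(** The second argument of [comp_of_fun] only has to exceed every row in use; the sum of the [i.+1]
    is a crude bound for the rows of [u]. *)
Definition wshape (a : composition) (u : seq nat) : composition :=
  comp_of_fun (rowlen a u) (size a + \sum_(i <- u) i.+1).

Lemma addableP a u i :
  reflect ((forall j, (j < i)%N -> (0 < rowlen a u j)%N) /\
           (forall j, (i < j)%N -> (rowlen a u j <= rowlen a u i)%N)) (addable a u i).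
Proof.
apply: (iffP andP) => [[/allP H1 /allP H2]|[H1 H2]]; split.
- by move=> j ji; apply: H1; rewrite mem_iota.
- move=> j ij; have := H2 j; rewrite ij mem_cat mem_iota /=.
  have [ja|aj] := ltnP j (size a); first by apply.
  have [ju|ju] := boolP (j \in u); first by apply.
  by rewrite {1 3}/rowlen part_default // (count_memPn ju).
- by apply/allP => j; rewrite mem_iota => /H1.
- by apply/allP => j _; apply/implyP/H2.
Qed.

Lemma valid_rcons a u i : valid a (rcons u i) = valid a u && addable a u i.
Proof.
rewrite /valid size_rcons -addn1 iotaD all_cat /= andbT add0n nth_rcons ltnn eqxx.
rewrite -cats1 take_size_cat //; congr (_ && _); apply: eq_in_all => p.
by rewrite mem_iota /= add0n => pu; rewrite takel_cat 1?ltnW // nth_cat pu.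
Qed.

Lemma rowlen_rcons a u i j : rowlen a (rcons u i) j = (rowlen a u j + (i == j))%N.
Proof. by rewrite /rowlen -cats1 count_cat /= addn0 addnA. Qed.

Lemma part_wshape a u : valid a u -> part (wshape a u) =1 rowlen a u.
Proof.
move=> va; apply: part_comp_of_fun => [|j]; last first.
  move=> aj; rewrite /rowlen part_default ?(leq_trans _ aj) ?leq_addr //; apply/count_memPn.
  apply/negP => ju; move: aj; rewrite (big_rem j) //=; lia.
elim/last_ind: u va => [|u i IHu]; first by move=> _ j k; rewrite /rowlen !addn0; apply: down0_part.
rewrite valid_rcons => /andP[/IHu{}IHu /addableP[H _]] j k jk; rewrite !rowlen_rcons => fj.
rewrite (IHu j k) ?add0n //; last by lia.
by apply/eqP; rewrite eqb0; apply/eqP => ik; have := H j; move: fj; case: eqP; lia.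
Qed.

Lemma valid_cat a u v : valid a (u ++ v) = valid a u && valid (wshape a u) v.
Proof.
elim/last_ind: v => [|v i IHv]; first by rewrite cats0 [valid _ [::]]/= andbT.
rewrite -rcons_cat !valid_rcons {}IHv -andbA; case: (boolP (valid a u)) => //= vu.
congr (_ && _).
have E j : rowlen a (u ++ v) j = rowlen (wshape a u) v j.
  by rewrite {2}/rowlen part_wshape // /rowlen count_cat addnA.
by apply/addableP/addableP => -[H1 H2]; split=> j; [have := H1 j | have := H2 j|
  have := H1 j | have := H2 j]; rewrite !E.
Qed.

Lemma wshape_cat a u v : valid a (u ++ v) -> wshape a (u ++ v) = wshape (wshape a u) v.
Proof.
move=> vuv; have := vuv; rewrite valid_cat => /andP[vu vv]; apply: comp_ext => j.
by rewrite !part_wshape // /rowlen part_wshape // /rowlen count_cat addnA.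
Qed.

Lemma wshape_nil a : wshape a [::] = a.
Proof. by apply: comp_ext => j; rewrite part_wshape // /rowlen addn0. Qed.

Lemma sumn_wshape a u : valid a u -> sumn (wshape a u) = (sumn a + size u)%N.
Proof.
elim/last_ind: u => [|u i IHu]; first by rewrite wshape_nil addn0.
rewrite valid_rcons => /andP[vu ai]; rewrite size_rcons addnS -IHu //.
have vui : valid a (rcons u i) by rewrite valid_rcons vu.
pose L := (size (wshape a u) + size (wshape a (rcons u i)) + i.+1)%N.
have iL : (i < L)%N by rewrite /L; lia.
rewrite !(@sumn_part _ L) /L; try lia.
rewrite (eq_bigr (fun j : 'I_L => part (wshape a u) j + (i == j))%N); last first.
  by move=> j _; rewrite !part_wshape // rowlen_rcons.
rewrite big_split /= [X in (_ + X)%N](bigD1 (Ordinal iL)) //= eqxx.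
rewrite [X in (_ + (_ + X))%N]big1 ?addn1 // => j /eqP ji.
by case: eqP => // ij; case: ji; apply: val_inj.
Qed.

(** With [x] and [y] the rows of two consecutive entries, this is the condition of [Des_sh] for
    [true] and of [Des_RS] for [false]; the two are complementary. *)
Definition desc (s : bool) (x y : nat) : bool := if s then (x < y)%N else (y <= x)%N.

(** Entries are numbered from 1 and positions in the word from 0, so the entries [i] and [i + 1]
    stand at the positions [i.-1] and [i]. *)
Definition wdes (s : bool) (w : seq nat) (i : nat) : bool :=
  desc s (nth 0%N w i.-1) (nth 0%N w i).

Definition incs (s : bool) (w : seq nat) : bool :=
  sorted (fun x y => ~~ desc s x y) w.

Definition rowle (s : bool) : rel nat := fun x y => if s then (y <= x)%N else (x <= y)%N.

(** A word without descents runs weakly upwards through the rows of the diagram if [s] is true,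
    strictly downwards otherwise. Being sorted, it is determined by how often each row occurs. *)
Lemma incsE s w : incs s w = (s || uniq w) && sorted (rowle s) w.
Proof.
case: s; rewrite /incs /rowle /=; first by apply: eq_sorted => x y; rewrite -leqNgt.
by rewrite -ltn_sorted_uniq_leq; apply: eq_sorted => x y; rewrite -ltnNge.
Qed.

Lemma rowle_trans s : transitive (rowle s).
Proof. by case: s => y x z; rewrite /rowle; lia. Qed.

Lemma rowle_anti s : antisymmetric (rowle s).
Proof. by case: s => x y; rewrite /rowle; lia. Qed.

Lemma rowle_total s : total (rowle s).
Proof. by case: s => x y; rewrite /rowle; lia. Qed.

Lemma sorted_split s w p : sorted (rowle s) w -> (p < size w)%N ->
  (forall j, j \in take p w -> rowle s j (nth 0%N w p)) /\
  (forall j, j \in drop p w -> rowle s (nth 0%N w p) j).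
Proof.
rewrite sorted_pairwise; last exact: rowle_trans.
rewrite -{1}(cat_take_drop p w) pairwise_cat => /and3P[/allrelP H1 _ H2] pw.
split=> j jw; first by apply: H1 => //; rewrite (drop_nth 0%N) // mem_head.
move: H2 jw; rewrite (drop_nth 0%N) // pairwise_cons => /andP[/allP H2 _].
by rewrite inE => /orP[/eqP->|/H2//]; case: (s) => /=.
Qed.

Lemma notin_take_index (T : eqType) (x : T) (w : seq T) : x \notin take (index x w) w.
Proof.
elim: w => //= y w IHw; case: eqP => [//|yx] /=.
by rewrite inE negb_or IHw andbT eq_sym; apply/eqP.
Qed.

Lemma eq_count_perm (T : eqType) (u v : seq T) :
  (forall x, count_mem x u = count_mem x v) -> perm_eq u v.
Proof. by move=> uv; apply/allP => x _; rewrite /= uv. Qed.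

(** The bound on row [j] is the one in force when the earlier row [i] receives its first box. If [s]
    is true, row [j] receives nothing after that moment, so the bound holds for the final shape as
    well. *)
Lemma strip_step s a w : valid a w -> incs s w -> step s a (wshape a w).
Proof.
rewrite incsE => va /andP[uw sw]; apply/stepP => i; rewrite part_wshape //.
split; first by rewrite /rowlen leq_addr.
- by case: s uw {sw} => //= uw; rewrite /rowlen count_uniq_mem //; case: (i \in w); lia.
- rewrite /rowlen -{1}[part a i]addn0 ltn_add2l => iw j ij.
  have {}iw : i \in w by rewrite -has_pred1 has_count.
  have pw : (index i w < size w)%N by rewrite index_mem.
  have := allP va (index i w); rewrite mem_iota add0n => /(_ pw)/addableP[_].
  move=> /(_ j); rewrite nth_index // => /(_ ij).
  rewrite /rowlen (count_memPn (notin_take_index i w)) addn0.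
  have [_ H] := sorted_split sw pw.
  have jd : s -> count_mem j (drop (index i w) w) = 0%N.
    by move=> s1; apply/count_memPn/negP => /H; rewrite nth_index // s1 /=; lia.
  case: s jd {uw sw H} => [jd|_]; last by lia.
  rewrite part_wshape // /rowlen -[in count_mem j w](cat_take_drop (index i w) w).
  by rewrite count_cat jd // addn0.
Qed.

Lemma count_flatten_nseq (f : nat -> nat) m K j :
  count_mem j (flatten [seq nseq (f i) i | i <- iota m K]) =
  if (m <= j < m + K)%N then f j else 0%N.
Proof.
elim: K m => [|K IHK] m /=; first by case: ifP => //; lia.
rewrite count_cat count_nseq /= IHK; case: eqP => [->|mj].
  by rewrite mul1n ltnn leqnn /= addn0; case: ifP => //; lia.
by rewrite mul0n; congr (if _ then _ else _); lia.
Qed.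

Definition strip_word (s : bool) (K : nat) (a d : composition) : seq nat :=
  sort (rowle s) (flatten [seq nseq (part d i - part a i) i | i <- iota 0 K]).

Lemma count_strip_word s K (a d : composition) j : (size d <= K)%N ->
  count_mem j (strip_word s K a d) = (part d j - part a j)%N.
Proof.
move=> dK; rewrite (seq.permP (permEl (perm_sort _ _))) count_flatten_nseq /= add0n.
by case: ltnP => // Kj; rewrite [part d j]part_default // (leq_trans dK).
Qed.

(** When a box goes into row [i], the sorted order has the later rows at their final length and the
    earlier ones at their original length if [s] is true, and the reverse if it is false. This is
    what the clause of [step] on later rows speaks of. For [true], an earlier row that was still
    empty would have to grow and would force row [i] of [d] to be empty. *)
Lemma strip_wordP s K (a d : composition) : (size d <= K)%N -> step s a d ->
  let w := strip_word s K a d in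
  [/\ incs s w, valid a w & wshape a w = d].
Proof.
move=> dK sad w; have cw j : count_mem j w = (part d j - part a j)%N.
  exact: count_strip_word.
have H := stepP _ _ _ sad.
have fE j : rowlen a w j = part d j by have [] := H j; rewrite /rowlen cw; lia.
have sw : sorted (rowle s) w by apply: sort_sorted; apply: rowle_total.
have iw : incs s w.
  rewrite incsE sw andbT -implyNb; apply/implyP => s0.
  apply: count_mem_uniq => x; have [_ + _] := H x; rewrite (negPf s0) /=.
  have := cw x; rewrite -has_pred1 has_count; case: (count_mem x w) => [|[|n]] //=; lia.
have va : valid a w.
  apply/allP => p; rewrite mem_iota /= add0n => pw; set i := nth 0%N w p.
  have [Ht Hd] := sorted_split sw pw; rewrite -/i in Ht Hd.
  have fE1 j : j \notin drop p w -> rowlen a (take p w) j = part d j.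
    by move=> jd; rewrite -fE /rowlen -[in RHS](cat_take_drop p w) count_cat (count_memPn jd) addn0.
  have fE2 j : j \notin take p w -> rowlen a (take p w) j = part a j.
    by move=> jd; rewrite /rowlen (count_memPn jd) addn0.
  have iin : i \in w by apply: mem_nth.
  have adi : (part a i < part d i)%N.
    by have := cw i; move: iin; rewrite -has_pred1 has_count; lia.
  have ge_a j : (part a j <= rowlen a (take p w) j)%N by rewrite /rowlen leq_addr.
  have [_ _ /(_ adi) Hi] := H i.
  have dj j : (j < i)%N -> (0 < part d j)%N.
    by move=> ji; rewrite comp_part_gt0 (ltn_trans ji) // -comp_part_gt0; lia.
  have jt j : (if s then j < i else i < j)%N -> j \notin take p w.
    by case: (s) Ht => Ht ij; apply/negP => /Ht; rewrite /rowle; lia.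
  have jd j : (if s then i < j else j < i)%N -> j \notin drop p w.
    by case: (s) Hd => Hd ij; apply/negP => /Hd; rewrite /rowle; lia.
  apply/addableP; split=> j ij.
    have := dj j ij; have [_ _] := H j.
    case: (s) (jt j) (jd j) => [/(_ ij) jt' _|_ /(_ ij) jd' _].
      by rewrite fE2 // => Hj d0; rewrite lt0n; apply/eqP => a0; have := Hj _ i ij; lia.
    by rewrite fE1.
  apply: leq_trans (ge_a i); have := Hi j ij.
  by case: (s) (jt j) (jd j) => [_ /(_ ij) jd'|/(_ ij) jt' _]; [rewrite fE1|rewrite fE2].
split=> //; apply: comp_ext => j; by rewrite part_wshape.
Qed.

Lemma strip_word_wshape s K a w : valid a w -> incs s w -> (size (wshape a w) <= K)%N ->
  strip_word s K a (wshape a w) = w.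
Proof.
move=> va; rewrite incsE => /andP[_ sw] wK.
apply: (sorted_eq (@rowle_trans s) (@rowle_anti s)) => //.
  exact/sort_sorted/rowle_total.
apply: eq_count_perm => j; rewrite count_strip_word // part_wshape // /rowlen; lia.
Qed.

(** The boxes of a strip can be inserted in exactly one order without descents. The bound [K] on the
    rows makes the set of words finite. *)
Lemma pieri_words (V : nmodType) s K (B : composition -> V) (a : composition) m :
  (sumn a + m <= K)%N ->
  \sum_(d <- comps (sumn a + m) | step s a d) B d =
  \sum_(w <- words K m | valid a w && incs s w) B (wshape a w).
Proof.
move=> aK; apply: (@big_seq_bij _ _ _ _ _ _ _ (wshape a) (strip_word s K a)).
- exact: uniq_comps.
- exact: uniq_words.
- move=> d; rewrite mem_comps => /eqP da sad.
  have dK : (size d <= K)%N by apply: leq_trans (size_le_sumn d) _; rewrite da.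
  have [iw va sE] := strip_wordP dK sad; rewrite va iw sE; split=> //.
  rewrite mem_words; apply/andP; split.
    by have := sumn_wshape va; rewrite sE da => /eqP; rewrite eqn_add2l eq_sym.
  apply/allP => j jw /=; apply: leq_trans (dK); rewrite -comp_part_gt0.
  by have := count_strip_word s a j dK; move: jw; rewrite -has_pred1 has_count; lia.
- move=> w; rewrite mem_words => /andP[/eqP wm _] /andP[va iw]; split.
  + by rewrite mem_comps sumn_wshape // wm.
  + exact: strip_step.
  + apply: strip_word_wshape => //; apply: leq_trans (size_le_sumn _) _.
    by rewrite sumn_wshape // wm.
Qed.

Definition desub (s : bool) (w b : seq nat) : bool :=
  all (fun i => wdes s w i ==> (i \in psums b)) (iota 1 (size w).-1).

Lemma desubP s w b : reflect
  (forall i, (0 < i < size w)%N -> wdes s w i -> i \in psums b) (desub s w b).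
Proof.
apply: (iffP allP) => H i.
  by move=> ib; apply/implyP/H; rewrite mem_iota; lia.
by rewrite mem_iota => ib; apply/implyP/H; lia.
Qed.

Lemma incsP s w : reflect (forall i, (0 < i < size w)%N -> ~~ wdes s w i) (incs s w).
Proof.
apply: (iffP (sortedP 0%N)) => H i; last by move=> iw; apply: (H i.+1).
by case: i => // i; apply: H.
Qed.

(** The smallest element of the set of [m :: b] is [m] when [b] is nonempty: no descent may occur
    inside [u], while the junction of [u] and [v] is unrestricted. *)
Lemma desub_cat s u v m b : size u = m -> (0 < m)%N -> 0%N \notin b ->
  size v = sumn b -> desub s (u ++ v) (m :: b) = incs s u && desub s v b.
Proof.
move=> um m0 b0 vb.
have E1 i : (i < m)%N -> wdes s (u ++ v) i = wdes s u i.
  by move=> im; rewrite /wdes !nth_cat um im (leq_ltn_trans (leq_pred i) im).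
have E2 i : (0 < i)%N -> wdes s (u ++ v) (m + i) = wdes s v i.
  move=> i0; rewrite /wdes !nth_cat um; have -> : ((m + i).-1 < m)%N = false by lia.
  have -> : (m + i < m)%N = false by lia.
  by congr (desc _ (nth _ _ _) (nth _ _ _)); lia.
have [bn|bn] := eqVneq b [::].
  have v0 : v = [::] by apply: size0nil; rewrite vb bn.
  rewrite v0 cats0 bn [desub s [::] _]/= andbT.
  apply/desubP/incsP => H i ib; last by rewrite (negPf (H i ib)).
  by apply/negP => /(H i ib).
have [bs br] := psums_sorted (Composition b0).
rewrite /desub; apply/desubP/andP => [H|[/incsP H1 /desubP H2] i].
  split; [apply/incsP => i ib|apply/desubP => i ib w1].
    apply/negP; rewrite -E1 => [wi|]; last by lia.
    have : i \in psums (m :: b) by apply: H wi; rewrite size_cat; lia.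
    by rewrite psums_cons // inE => /orP[/eqP|/mapP[j _]]; lia.
  rewrite -E2 in w1; last by lia.
  have : (m + i)%N \in psums (m :: b) by apply: H w1; rewrite size_cat; lia.
  by rewrite psums_cons // inE => /orP[/eqP|/mapP[j jb /addnI->//]]; lia.
rewrite size_cat um => ib wd; rewrite psums_cons // inE.
have [im|mi|->] := ltngtP i m; last by [].
  by rewrite E1 // (negPf (H1 i _)) in wd; lia.
have iE : i = (m + (i - m))%N by lia.
rewrite iE E2 in wd; last by lia.
by rewrite iE; apply/orP; right; apply: map_f; apply: H2 wd; lia.
Qed.

Section Ribbon.
Variables (s : bool) (B : composition -> NSym).
Hypothesis BH : pieri s B nsH.

Lemma nsHc_words K (a b : composition) : (sumn a + sumn b <= K)%N ->
  B a * nsHc b = \sum_(w <- words K (sumn b) | valid a w && desub s w b) B (wshape a w).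
Proof.
rewrite /nsHc; elim: (parts b) (parts_pos b) a => [|m c IHc] + a.
  by move=> _ _; rewrite big_nil mulr1 big_mkcond big_seq1 /= wshape_nil.
rewrite inE negb_or eq_sym -lt0n => /andP[m0 c0] /= aK.
rewrite big_cons mulrA BH // (@pieri_words _ s K) ?mulr_suml; last by lia.
rewrite [RHS]big_mkcond big_words_add /= big_mkcond; apply: eq_big_seq => u.
rewrite mem_words => /andP[/eqP um _].
case: (boolP (valid a u)) => [va|nva] /=; last first.
  by rewrite big1 // => v _; rewrite valid_cat (negPf nva).
have E v : v \in words K (sumn c) -> (valid a (u ++ v) && desub s (u ++ v) (m :: c)) =
    incs s u && (valid (wshape a u) v && desub s v c).
  rewrite mem_words => /andP[/eqP vc _]; rewrite valid_cat va desub_cat //=.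
  by rewrite andbCA.
case: ifP => iu; last by rewrite big1_seq // => v /E->; rewrite iu.
rewrite IHc //; last by rewrite sumn_wshape // um -addnA.
rewrite big_mkcond; apply: eq_big_seq => v vw; rewrite E // iu /=.
case: ifP => // /andP[vv _]; rewrite wshape_cat // valid_cat va //.
Qed.

(** Products with H count words whose descents lie in a given set; the alternating sum over
    coarsenings, carried out for each word separately, turns this inclusion into equality. *)
Lemma nsR_words K (a b : composition) : (sumn a + sumn b <= K)%N ->
  B a * nsR b = \sum_(w <- words K (sumn b) | valid a w &&
    all (fun i => wdes s w i == (i \in psums b)) (iota 1 (sumn b).-1)) B (wshape a w).
Proof.
move=> aK; rewrite /nsR mulr_sumr.
transitivity (\sum_(c <- comps (sumn b) | coarsens c b)
   \sum_(w <- words K (sumn b)) if valid a w && desub s w c then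
     (-1) ^+ (size b - size c) *: B (wshape a w) else 0).
  apply: eq_bigr_seq => c; rewrite mem_comps => /eqP cb _.
  rewrite ns_scalerAr (@nsHc_words K) ?cb // scaler_sumr big_mkcond //.
rewrite exchange_big /= [RHS]big_mkcond; apply: eq_big_seq => w.
rewrite mem_words => /andP[/eqP wb _]; case: (boolP (valid a w)) => va /=; last by rewrite big1.
rewrite -big_mkcondr -scaler_suml /desub wb moebius_psums.
by case: all; rewrite ?scale1r ?scale0r.
Qed.

End Ribbon.

(** * Standard fillings and their words *)

Section Standard.
Variables (g a : composition) (N : nat).
Implicit Type T : filling g a N.

Definition rowat T (p : nat) : nat :=
  oapp box_row 0%N [pick b : box g a | val (T b) == p].

Definition word T : seq nat := mkseq (rowat T) N.

Lemma size_word T : size (word T) = N.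
Proof. exact: size_mkseq. Qed.

Section StandardFilling.
Variable T : filling g a N.
Hypothesis sT : standard T.

Lemma standard_inj : injective T.
Proof.
move=> b c bc; have /forallP/(_ (T b))/cards1P[x /setP E] := sT.
by have := E b; have := E c; rewrite !inE -bc eqxx => /esym/eqP-> /esym/eqP->.
Qed.

Lemma standard_ex (p : 'I_N) : exists b, T b = p.
Proof.
have /forallP/(_ p)/cards1P[x /setP/(_ x)] := sT.
by rewrite !inE eqxx => /eqP <-; exists x.
Qed.

Lemma rowatE b : rowat T (T b) = box_row b.
Proof.
rewrite /rowat; case: pickP => [c /eqP/val_inj/standard_inj->//|/(_ b)].
by rewrite eqxx.
Qed.

Lemma nth_word b : nth 0%N (word T) (T b) = box_row b.
Proof. by rewrite nth_mkseq // rowatE. Qed.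

Lemma shp_word p : (p <= N)%N -> shp T p =1 rowlen a (take p (word T)).
Proof.
elim: p => [_|p IHp pN] i; first by rewrite shp0 take0 /rowlen addn0.
rewrite (take_nth 0%N) ?size_word // rowlen_rcons -IHp 1?ltnW // /shp -addnA.
congr (_ + _)%N; have [b0 b0p] := standard_ex (Ordinal pN).
have pE : p = T b0 by rewrite b0p.
set A := [set b | (box_row b == i) && (T b < p)%N].
have -> : [set b | (box_row b == i) && (T b < p.+1)%N] =
    if box_row b0 == i then b0 |: A else A.
  apply/setP => b; have bb0 : (T b < p.+1)%N = (b == b0) || (T b < p)%N.
    rewrite ltnS leq_eqVlt; congr (_ || _); apply/eqP/eqP => [bp|->//].
    by apply: standard_inj; apply: val_inj; rewrite /= bp pE.
  by case: ifP => bi; rewrite !inE bb0; case: (eqVneq b b0) => //= ->; rewrite bi.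
have -> : nth 0%N (word T) p = box_row b0 by rewrite {1}pE nth_word.
case: ifP => bi; last by rewrite addn0.
by rewrite cardsU1 addnC inE pE ltnn andbF.
Qed.

Definition des s : pred nat := if s then Des_sh T else Des_RS T.

Lemma des_word s i : (0 < i < N)%N -> des s i = wdes s (word T) i.
Proof.
case: i => // i iN; have [b bi] := standard_ex (Ordinal (ltnW iN)).
have [c ci] := standard_ex (Ordinal iN).
have wd : wdes s (word T) i.+1 = desc s (box_row b) (box_row c).
  by have := (nth_word b, nth_word c); rewrite bi ci /= => -[<- <-].
rewrite wd.
have inj x (k : 'I_N) y : T y = k -> (T x).+1 == k.+1 -> x = y.
  by move=> yk /eqP[xk]; apply: standard_inj; apply: val_inj; rewrite /= xk yk.
have P r : [exists x : box g a, exists y : box g a,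
    [&& (T x).+1 == i.+1, (T y).+1 == i.+2 & r (box_row x) (box_row y)]] =
    r (box_row b) (box_row c) :> bool.
  apply/existsP/idP => [[x /existsP[y /and3P[xi yi]]]|rbc].
    by rewrite (inj x (Ordinal (ltnW iN)) b bi xi) (inj y (Ordinal iN) c ci yi).
  by exists b; apply/existsP; exists c; rewrite bi ci /= !eqxx.
by case: s wd => wd; [apply: (P (fun x y => x < y)%N) | apply: (P (fun x y => y <= x)%N)].
Qed.

Definition co s : composition := if s then co_sh T else co_RS T.

Lemma co_word s (b : composition) : (co s == b) =
  (sumn b == N) && all (fun i => wdes s (word T) i == (i \in psums b)) (iota 1 N.-1).
Proof.
have -> : co s = comp_of N (des s) by rewrite /co /des; case: (s).
rewrite comp_ofP; congr (_ && _); apply: eq_in_all => i; rewrite mem_iota => iN.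
by rewrite des_word //; lia.
Qed.

(** At every position of the word exactly one of the two kinds of descent occurs; this is the source
    of [comp_compl] in the ribbon expansions. *)
Lemma co_compl s (b : composition) : (co s == comp_compl b) = (co (~~ s) == b).
Proof.
rewrite !co_word; have [-> H] := comp_complP b; case: eqP => //= bN.
apply: eq_in_all => i; rewrite mem_iota => iN; rewrite H; last by lia.
have -> : wdes s (word T) i = ~~ wdes (~~ s) (word T) i.
  by rewrite /wdes /desc; case: (s); rewrite /= -?leqNgt -?ltnNge.
by case: wdes; case: (_ \in _).
Qed.

(** The entries are distinct, so weak and strict inequalities between different boxes coincide. *)
Lemma standard_tabs s : tabs s T = tabs (~~ s) T.
Proof.
suff H r : tabs r T -> tabs (~~ r) T by apply/idP/idP => /H //; rewrite negbK.
move=> tT; have ne b c : b <> c -> val (T b) <> val (T c).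
  by move=> bc /val_inj/standard_inj.
apply: tabsP => b c bc bcc.
  have := tabs_rows tT bc bcc; have := ne b c; case: r {tT}; rewrite /= ?addn0 ?addn1; last by lia.
  by move=> H; have : b <> c by [move=> E; rewrite E ltnn in bcc]; move=> /H /=; lia.
have := tabs_cols tT bc bcc; have := ne b c; case: r {tT}; rewrite /= ?addn0 ?addn1; first by lia.
by move=> H; have : b <> c by [move=> E; rewrite E ltnn in bcc]; move=> /H /=; lia.
Qed.

End StandardFilling.

(** The word gives the shapes of all initial sets of entries, hence the tableau; conversely the
    shapes of a valid word ending at [g] define a filling by [fill_ex]. Since boxes come one at a
    time, the words do not depend on [s]. *)
Lemma card_standard s K (Q : pred (seq nat)) : (sumn g <= K)%N ->
  #|[set T : filling g a N | [&& standard T, skew_shape g a && tabs s T & Q (word T)]]| =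
  (\sum_(w <- words K N | [&& valid a w, wshape a w == g & Q w]) 1)%N.
Proof.
move=> gK; rewrite cardE -sum1_size -[LHS](big_map word xpredT (fun=> 1%N)) -[RHS]big_filter.
apply: perm_big; apply: uniq_perm.
- rewrite map_inj_in_uniq ?enum_uniq // => T T'.
  rewrite !mem_enum !inE => /and3P[sT /andP[sk tT] _] /and3P[sT' /andP[_ tT'] _] TT'.
  have E b p : (p <= N)%N -> (T b < p)%N = (T' b < p)%N.
    by move=> pN; rewrite (ltn_shp sk tT) (ltn_shp sk tT') (shp_word sT) // (shp_word sT') // TT'.
  apply/ffunP => b; apply/val_inj/eqP; rewrite eqn_leq /=.
  by rewrite -ltnS E // ltnS leqnn -ltnS -E // ltnS leqnn.
- by rewrite filter_uniq ?uniq_words.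
move=> w; rewrite mem_filter; apply/mapP/andP => [[T]|[/and3P[va /eqP sg Qw]]].
  rewrite mem_enum inE => /and3P[sT /andP[sk tT] QT] ->; rewrite QT andbT.
  have wE p : (p < N)%N -> exists b, T b = p :> nat /\ nth 0%N (word T) p = box_row b.
    by move=> pN; have [b bp] := standard_ex sT (Ordinal pN); exists b;
       rewrite -(nth_word sT) bp.
  have va : valid a (word T).
    apply/allP => p; rewrite mem_iota size_word add0n /= => pN.
    have [b [bp ->]] := wE p pN; set i := box_row b.
    have fS j : rowlen a (take p.+1 (word T)) j = (rowlen a (take p (word T)) j + (i == j))%N.
      by rewrite (take_nth 0%N) ?size_word // rowlen_rcons -bp (nth_word sT).
    have [E0 E1] := (shp_word sT (ltnW pN), shp_word sT pN).
    have [_ _] := shp_step sk tT pN i; rewrite E0 E1 fS eqxx addn1 => H.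
    apply/addableP; split=> j ji.
      (* The shape after this box is a composition with a nonempty row [i], so no earlier row is
         empty. *)
      rewrite lt0n; apply/eqP => fj0.
      have := down0_shp sk tT pN (ltnW ji); rewrite !E1 !fS fj0 eqxx.
      by rewrite (_ : (i == j) = false) ?addn0 => [/(_ erefl)|]; lia.
    have := H (ltnSn _) j ji; rewrite E0 E1 fS.
    by case: (s) => //; rewrite (_ : (i == j) = false) ?addn0 //; lia.
  split; last first.
    rewrite mem_words size_word eqxx /=; apply/allP => i /mapP[p]; rewrite mem_iota => pN ->.
    have [b bp] := standard_ex sT (Ordinal (_ : (p < N)%N)); rewrite /=.
    have -> : p = T b by rewrite bp.
    rewrite rowatE //; apply: leq_trans (box_row_lt b) (leq_trans (size_le_sumn _) gK).
  rewrite va; apply/eqP/comp_ext => i; rewrite part_wshape //.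
  by rewrite -(shpN T sk) (shp_word sT) // take_oversize ?size_word.
rewrite mem_words => /andP[/eqP wN _].
have [|||T [TE Tc]] := @fill_ex g a N (fun p => rowlen a (take p w)).
- by move=> i; rewrite take0 /rowlen addn0.
- by move=> i; rewrite take_oversize ?wN // -sg part_wshape.
- by move=> p i pN; rewrite (take_nth 0%N) ?wN // rowlen_rcons leq_addr.
have ok p (pN : (p < N)%N) : addable a (take p w) (nth 0%N w p).
  by have := allP va p; rewrite mem_iota wN; apply.
have tb p i : (p < N)%N -> shp T p.+1 i = (shp T p i + (nth 0%N w p == i))%N.
  by move=> pN; rewrite (Tc p (ltnW pN)) (Tc _ pN) (take_nth 0%N) ?wN // rowlen_rcons.
have /andP[sk tT] : skew_shape g a && tabs s T.
  apply: fill_tabs => [b p pN|i|p pN].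
  - by rewrite Tc // TE.
  - by rewrite Tc // take_oversize ?wN // -sg part_wshape.
  have [H1 H2] := addableP _ _ _ (ok p pN).
  move=> i; rewrite tb //; split; [by rewrite leq_addr| by case: eqP; lia|].
  case: eqP => [<-|_] h j ij; last by lia.
  have := H2 j ij; rewrite tb //; have -> : (nth 0%N w p == j) = false by lia.
  by rewrite addn0 if_same !(Tc p (ltnW pN)).
have cT (p : 'I_N) b : (T b == p) = (nth 0%N w p == box_row b) && 
   (shp T p (box_row b) <= box_col b < shp T p.+1 (box_row b))%N.
  have := ltn_shp sk tT b p; have := ltn_shp sk tT b p.+1.
  by rewrite -val_eqE tb //=; case: (_ == box_row b) => /=; lia.
have sT : standard T.
  apply/forallP => p; apply/cards1P; set i := nth 0%N w p.
  have [||b [bi bj Tb]] := @shp_box g a N s T sk tT p p.+1 i (shp T p i).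
  - by rewrite leqnn tb // eqxx addn1 /=.
  - by [].
  exists b; apply/setP => c; rewrite !inE cT; apply/andP/eqP => [[/eqP ic]|->].
    rewrite -ic tb // eqxx addn1 ltnS -eqn_leq => /eqP ij.
    by apply: box_inj; rewrite ?bi ?bj.
  by rewrite bi bj eqxx leqnn tb // eqxx addn1 /=.
have wT : word T = w.
  apply: (eq_from_nth (x0 := 0%N)); rewrite size_word ?wN // => p pN.
  have [b bp] := standard_ex sT (Ordinal pN).
  have -> : nth 0%N (word T) p = box_row b by rewrite -(nth_word sT) bp.
  by have := cT (Ordinal pN) b; rewrite bp eqxx => /esym/andP[/eqP].
by exists T; rewrite ?wT // mem_enum inE sT sk tT wT.
Qed.

End Standard.

Definition nb_standard (s : bool) (g a b : composition) : nat :=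
  #|[set U : full_filling g a |
     [&& standard U, skew_shape g a && tabs s U & co U s == b]]|.

Lemma nb_standard_words s K (g a b : composition) : (sumn g <= K)%N ->
  sumn g = (sumn a + sumn b)%N ->
  nb_standard s g a b = (\sum_(w <- words K (sumn b) | [&& valid a w, wshape a w == g &
    all (fun i => wdes s w i == (i \in psums b)) (iota 1 (sumn b).-1)]) 1)%N.
Proof.
(* The range of entries of a [full_filling] is its number of boxes, known to be [sumn b] when [a] is
   contained in [g]. If [skew_shape] fails, both sides are zero. *)
move=> gK gab; have W N : N = sumn b ->
    #|[set U : filling g a N | [&& standard U, skew_shape g a && tabs s U & co U s == b]]| =
    (\sum_(w <- words K (sumn b) | [&& valid a w, wshape a w == g &
      all (fun i => wdes s w i == (i \in psums b)) (iota 1 (sumn b).-1)]) 1)%N.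
  move=> Nb; rewrite -Nb -(card_standard a N s _ gK); apply: eq_card => U; rewrite !inE.
  by case: (boolP (standard U)) => //= sU; rewrite co_word // -Nb eqxx -andbA.
have [sk|nsk] := boolP (skew_shape g a).
  apply: W; have [ag _] := skew_shapeP g a sk.
  by have := card_box ag; lia.
rewrite -(W _ erefl) /nb_standard !(eq_card (B := pred0)) ?card0 // => U;
  by rewrite !inE (negPf nsk) andbF.
Qed.

Lemma pieri_nsR s (B : composition -> NSym) (a b : composition) : pieri s B nsH ->
  B a * nsR b = \sum_(g <- comps (sumn a + sumn b)) B g *+ nb_standard s g a b.
Proof.
move=> BH; rewrite (nsR_words BH (leqnn _)).
transitivity (\sum_(g <- comps (sumn a + sumn b))
   \sum_(w <- words (sumn a + sumn b) (sumn b)) if [&& valid a w, wshape a w == g &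
     all (fun i => wdes s w i == (i \in psums b)) (iota 1 (sumn b).-1)] then B g else 0).
  rewrite exchange_big /= big_mkcond; apply: eq_big_seq => w.
  rewrite mem_words => /andP[/eqP wb _]; case: (boolP (valid a w)) => va /=; last by rewrite big1.
  rewrite (bigD1_seq (wshape a w)) ?uniq_comps ?mem_comps ?sumn_wshape ?wb //= eqxx /=.
  by rewrite big1 ?addr0 // => g; rewrite eq_sym => /negPf->.
apply: eq_big_seq => g; rewrite mem_comps => /eqP gab.
by rewrite (@nb_standard_words s (sumn a + sumn b)) ?gab // -big_mkcond -sumrMnr.
Qed.

Lemma nb_standard_compl s (g b : composition) :
  #|[set U : full_filling g comp0 | [&& standard U, tabs s U & co U s == comp_compl b]]| =
  nb_standard (~~ s) g comp0 b.
Proof.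
apply: eq_card => U; rewrite !inE skew_shape0 /=.
by case: (boolP (standard U)) => //= sU; rewrite co_compl // standard_tabs.
Qed.

Lemma nsR_expand s (B : composition -> NSym) (b : composition) :
  B comp0 = 1 -> pieri s B nsH ->
  nsR b = \sum_(g <- comps (sumn b))
    #|[set U : full_filling g comp0 |
        [&& standard U, tabs (~~ s) U & co U (~~ s) == comp_compl b]]|%:R *: B g.
Proof.
move=> B0 BH; have := pieri_nsR comp0 b BH; rewrite B0 mul1r => ->.
by apply: eq_bigr => g _; rewrite nb_standard_compl negbK scaler_nat.
Qed.

Lemma nsR_RS (RS : composition -> NSym) (b : composition) : row_strict_shin_basis RS ->
  nsR b = \sum_(a <- comps (sumn b)) (L_sh a (comp_compl b))%:R *: RS a.
Proof. by move=> hRS; apply: nsR_expand (RS0 hRS) (RS_pieri hRS). Qed.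

Lemma nsR_Sh (Sh : composition -> NSym) (b : composition) : shin_basis Sh ->
  nsR b = \sum_(a <- comps (sumn b)) (L_RS a (comp_compl b))%:R *: Sh a.
Proof. by move=> hSh; apply: nsR_expand hSh.1 (shin_pieri hSh). Qed.

Lemma RS_nsR (RS : composition -> NSym) (a b : composition) : row_strict_shin_basis RS ->
  RS a * nsR b = \sum_(g <- comps (sumn a + sumn b))
    \sum_(U : full_filling g a | [&& standard U, skew_rs_tab U & co_RS U == b]) RS g.
Proof.
move=> hRS; rewrite (pieri_nsR a b (RS_pieri hRS)); apply: eq_bigr => g _.
by rewrite sumr_const /nb_standard cardsE.
Qed.

(** * Strictly increasing compositions *)
Lemma big_lift_perm (V : nmodType) n (i j : 'I_n.+1) (F : 'S_n.+1 -> V) :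
  \sum_(s : 'S_n.+1 | s i == j) F s = \sum_(t : 'S_n) F (lift_perm i j t).
Proof.
rewrite (reindex (lift_perm i j)) /=.
  by apply: eq_bigl => t; rewrite lift_perm_id eqxx.
(* The default [k] is never reached, because [s] takes the value [s i] only at [i]. *)
pose g (s : 'S_n.+1) k := odflt k (unlift (s i) (s (lift i k))).
have gE (s : 'S_n.+1) k : lift (s i) (g s k) = s (lift i k).
  rewrite /g; case: unliftP => [m ->//|/perm_inj/eqP].
  by rewrite eq_sym (negPf (neq_lift i k)).
have g_inj (s : 'S_n.+1) : injective (g s).
  by move=> k l kl; apply: (@lift_inj _ i); apply: (@perm_inj _ s); rewrite -!gE kl.
exists (fun s : 'S_n.+1 => perm (@g_inj s)) => [t _|s /eqP si]; apply/permP => k.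
  by apply: (@lift_inj _ j); have := gE (lift_perm i j t) k; rewrite lift_perm_id lift_perm_lift permE.
by case: (unliftP i k) => [l|] ->; rewrite ?lift_perm_id // lift_perm_lift permE -si gE.
Qed.

Section Hessenberg.
Variables (A : lalgType rat) (e : nat -> A).

(** The determinant of the Hessenberg matrix with entry [e (x j)] in row [i] and column [j] if
    [i <= j.+1], and 0 otherwise, the factors being multiplied in the order of the rows. *)
Definition hess (n : nat) (x : nat -> nat) : A :=
  \sum_(s : 'S_n | [forall i : 'I_n, (i <= (s i).+1)%N])
    (-1) ^+ s *: \prod_(i < n) e (x (s i)).

Lemma hess0 x : hess 0 x = 1.
Proof.
rewrite /hess big_mkcond (bigD1 1%g) //= [X in _ + X]big1 ?addr0 => [|s s1]; last first.
  by case/eqP: s1; apply/permP => -[].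
by rewrite big_ord0 odd_perm1 expr0 scale1r; case: forallP => // -[] [].
Qed.

(* Expansion along the last row, whose only admissible entries are the last two. *)
Lemma hess_rec n x : hess n.+2 x =
  hess n.+1 x * e (x n.+1) - hess n.+1 (x \o bump n) * e (x n).
Proof.
have nn : (n < n.+2)%N by [].
pose P (s : 'S_n.+2) := [forall i : 'I_n.+2, (i <= (s i).+1)%N].
pose F (s : 'S_n.+2) : A := if P s then (-1) ^+ s *: \prod_(i < n.+2) e (x (s i)) else 0.
have E : hess n.+2 x = \sum_(s : 'S_n.+2 | s ord_max == ord_max) F s +
    \sum_(s : 'S_n.+2 | s ord_max == Ordinal nn) F s.
  rewrite /hess big_mkcond -/(F _) (bigID (fun s : 'S_n.+2 => s ord_max == ord_max)) /=.
  congr (_ + _); rewrite big_mkcond [RHS]big_mkcond; apply: eq_bigr => s _.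
  rewrite /F -/(P s); case: (boolP (P s)) => [/forallP/(_ ord_max) /= Ps|_]; last by rewrite !if_same.
  congr (if _ then _ else _); rewrite -!val_eqE /=.
  by have := ltn_ord (s ord_max); lia.
have PE (j : 'I_n.+2) (t : 'S_n.+1) : (n <= j)%N ->
    P (lift_perm ord_max j t) = [forall i : 'I_n.+1, (i <= (t i).+1)%N].
  move=> nj; apply/forallP/forallP => H k; last first.
    case: (unliftP ord_max k) => [l|] ->; last by rewrite lift_perm_id.
    rewrite lift_perm_lift lift_max /=; apply: leq_trans (H l) _.
    by rewrite /bump; lia.
  have := H (lift ord_max k); rewrite lift_perm_lift lift_max /= /bump.
  by have := ltn_ord k; lia.
have prodE (j : 'I_n.+2) (t : 'S_n.+1) :
    \prod_(i < n.+2) e (x (lift_perm ord_max j t i)) =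
    \prod_(i < n.+1) e (x (bump j (t i))) * e (x j).
  rewrite big_ord_recr /= lift_perm_id; congr (_ * _); apply: eq_bigr => i _.
  have -> : widen_ord (leqnSn n.+1) i = lift ord_max i.
    by apply: val_inj; rewrite /= /bump leqNgt ltn_ord.
  by rewrite lift_perm_lift.
rewrite E !big_lift_perm /F; congr (_ + _).
  rewrite -big_mkcond /hess mulr_suml; apply: eq_big => [t|t _]; first by rewrite PE.
  rewrite prodE /= odd_lift_perm addbb -scalerAl; congr (_ *: (_ * _)).
  by apply: eq_bigr => i _; rewrite /bump leqNgt ltn_ord.
rewrite -big_mkcond /hess mulr_suml -sumrN; apply: eq_big => [t|t _]; first by rewrite PE.
rewrite prodE /= odd_lift_perm /= -scalerAl -scaleNr; congr (_ *: _).
by case: odd; case: (odd_perm t).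
Qed.

End Hessenberg.

Definition seqcomp (n : nat) (x : nat -> nat) : composition := mkcomp (mkseq x n).

Definition incr_pos (n : nat) (x : nat -> nat) : Prop :=
  (forall i, (i < n)%N -> (0 < x i)%N) /\ (forall i, (i.+1 < n)%N -> (x i < x i.+1)%N).

Lemma seqcompE n x : incr_pos n x -> seqcomp n x = mkseq x n :> seq nat.
Proof.
by case=> x0 _; rewrite mkcomp_id //; apply/mapP => -[i]; rewrite mem_iota => /x0; lia.
Qed.

Lemma part_seqcomp n x i : incr_pos n x ->
  part (seqcomp n x) i = if (i < n)%N then x i else 0%N.
Proof.
move=> xP; rewrite /part seqcompE //; case: ltnP => ni; first by rewrite nth_mkseq.
by rewrite nth_default ?size_mkseq.
Qed.

Lemma sumn_seqcomp n x : incr_pos n x -> sumn (seqcomp n x) = (\sum_(i < n) x i)%N.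
Proof.
move=> xP; rewrite (@sumn_part _ n) ?seqcompE ?size_mkseq //.
by apply: eq_bigr => i _; rewrite /part nth_mkseq.
Qed.

Lemma incr_posW n x : incr_pos n.+1 x -> incr_pos n x.
Proof. by case=> H1 H2; split=> i ni; [apply: H1|apply: H2]; lia. Qed.

Lemma incr_pos_bump n x : incr_pos n.+2 x -> incr_pos n.+1 (x \o bump n).
Proof.
case=> H1 H2; split=> i ni /=; first by apply: H1; rewrite /bump; lia.
rewrite (_ : bump n i = i); last by rewrite /bump; lia.
have [ni'|ni'] := leqP n i.+1.
  rewrite (_ : bump n i.+1 = i.+2); last by rewrite /bump; lia.
  by apply: ltn_trans (H2 i _) (H2 i.+1 _); lia.
rewrite (_ : bump n i.+1 = i.+1); last by rewrite /bump; lia.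
by apply: H2; lia.
Qed.

(** A row before the last one cannot grow, since the next row is already longer. Below the last row
    only one new row can appear, because starting it from length 0 forces the rows after it to be
    empty. *)
Lemma step_seqcomp n y (d : composition) : incr_pos n.+1 y ->
  step true (seqcomp n.+1 y) d <->
  [/\ forall i, (i < n)%N -> part d i = y i, (y n <= part d n)%N,
      (y n < part d n)%N -> (part d n.+1 <= y n)%N & part d n.+2 = 0%N].
Proof.
move=> yP; have pE i := part_seqcomp i yP; have [y0 yS] := yP.
split=> [/stepP H|[H1 H2 H3 H4]].
  have D i : (i < n)%N -> part d i = y i.
    move=> ni; have e1 : part (seqcomp n.+1 y) i = y i by rewrite pE ifT //; lia.
    have e2 : part (seqcomp n.+1 y) i.+1 = y i.+1 by rewrite pE ifT.
    have [h1 _ h3] := H i; have [h4 _ _] := H i.+1; rewrite e1 in h1 h3; rewrite e2 in h4.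
    have [//|lt] : part d i = y i \/ (y i < part d i)%N by lia.
    by have := h3 lt i.+1 (ltnSn i); have := yS i ni; lia.
  split=> //.
  - by have [+ _ _] := H n; rewrite pE ltnSn.
  - by have [_ _ K] := H n; rewrite pE ltnSn in K => h; apply: (K h n.+1 (ltnSn n)).
  have [d0|d0] := posnP (part d n.+1); first exact: down0_part d0.
  have [_ _ K] := H n.+1; rewrite pE ltnn in K.
  by have := K d0 n.+2 (ltnSn _); lia.
have d0 j : (n.+2 <= j)%N -> part d j = 0%N by move=> nj; apply: down0_part nj H4.
apply/stepP => i; rewrite pE; split=> //.
- case: ltnP => // ni; have [->//|ni'] : i = n \/ (i < n)%N by lia.
  by rewrite H1.
- move=> + j ij; case: (ltnP i n.+1) => ni h; last by rewrite d0 //; lia.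
  have [iE|ni'] : i = n \/ (i < n)%N by lia.
    rewrite iE in h ij *; have [->|jn] : j = n.+1 \/ (n.+2 <= j)%N by lia.
      exact: H3.
    by rewrite d0.
  by rewrite H1 // ltnn in h.
Qed.

Lemma sumn_part2 n (d : composition) : part d n.+2 = 0%N ->
  sumn d = (\sum_(i < n) part d i + part d n + part d n.+1)%N.
Proof.
move=> d0; rewrite (@sumn_part _ n.+2) ?big_ord_recr //.
by rewrite leqNgt -comp_part_gt0 d0.
Qed.

(** In all terms of both products the rows [n] and [n.+1] have the total length [x n + x n.+1]. The
    terms of the second product are exactly those of the first whose row [n] exceeds [x n]; the only
    other term of the first is the wanted one. *)
Lemma RS_rec (RS : composition -> NSym) n x : row_strict_shin_basis RS -> incr_pos n.+2 x ->
  RS (seqcomp n.+2 x) = RS (seqcomp n.+1 x) * nsE (x n.+1) -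
    RS (seqcomp n.+1 (x \o bump n)) * nsE (x n).
Proof.
move=> hRS xP; have P := pieri_nsE (RS_pieri hRS).
have xP1 := incr_posW xP; have xP2 := incr_pos_bump xP; have [x0 xS] := xP.
have bmp i : (i < n)%N -> bump n i = i by rewrite /bump; lia.
have bmpn : bump n n = n.+1 by rewrite /bump leqnn.
rewrite [X in X - _]P ?[X in _ - X]P ?x0 //; try lia.
set S := (sumn _ + _)%N; set S' := (sumn _ + _)%N.
have sE : S = (\sum_(i < n) x i + x n + x n.+1)%N.
  by rewrite /S sumn_seqcomp // big_ord_recr.
have sE' : S' = S.
  rewrite sE /S' sumn_seqcomp // big_ord_recr /= bmpn addnAC; congr (_ + _ + _)%N.
  by apply: eq_bigr => i _; rewrite bmp.
have gE i : part (seqcomp n.+2 x) i = if (i < n.+2)%N then x i else 0%N by rewrite part_seqcomp.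
have gS : sumn (seqcomp n.+2 x) = S by rewrite sE sumn_seqcomp // !big_ord_recr.
have sg : step true (seqcomp n.+1 x) (seqcomp n.+2 x).
  apply/(step_seqcomp _ xP1); rewrite !gE ltnn !ltnS leqnn leqnSn ltnn; split=> //.
  by move=> i ni; rewrite gE; case: ltnP => //; lia.
rewrite sE' /= big_mkcond (bigD1_seq (seqcomp n.+2 x)) ?uniq_comps ?mem_comps ?gS //= sg.
rewrite -addrA -[LHS]addr0; congr (_ + _); apply/esym/eqP; rewrite subr_eq0; apply/eqP.
rewrite big_mkcond [RHS]big_mkcond; apply: eq_big_seq => d; rewrite mem_comps => /eqP dS.
rewrite -[if step _ _ _ then _ else _]/(if step true (seqcomp n.+1 x) d then RS d else 0).
have -> : (if d != seqcomp n.+2 x then if step true (seqcomp n.+1 x) d then RS d else 0 else 0) =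
   if (d != seqcomp n.+2 x) && step true (seqcomp n.+1 x) d then RS d else 0.
  by case: (d != _).
congr (if _ then _ else _); have xn := xS n (ltnSn _).
have xb : (x \o bump n) n = x n.+1 by rewrite /= bmpn.
apply/andP/idP => [[dg /(step_seqcomp _ xP1)[H1 H2 H3 H4]]|/(step_seqcomp _ xP2)[H1 H2 H3 H4]].
  have dS' : (part d n + part d n.+1 = x n + x n.+1)%N.
    move: dS; rewrite sE (sumn_part2 H4) -!addnA; under eq_bigr => i _ do rewrite H1 //.
    by move=> /addnI.
  have dn : (x n < part d n)%N.
    rewrite ltn_neqAle H2 andbT; apply: contra dg => /eqP dn.
    apply/eqP/comp_ext => i; rewrite gE.
    have [ni|[->|[->|ni]]] : (i < n)%N \/ i = n \/ i = n.+1 \/ (n.+2 <= i)%N by lia.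
    - by rewrite H1 // ifT //; lia.
    - by rewrite ltnS leqnSn dn.
    - by rewrite ltnSn; lia.
    - by rewrite ltnNge ni /=; apply: down0_part ni H4.
  have := H3 dn => dn1.
  apply/(step_seqcomp _ xP2); rewrite xb; split=> //; try lia.
  by move=> i ni; rewrite H1 //= bmp.
rewrite xb in H2 H3.
have H1' i : (i < n)%N -> part d i = x i by move=> ni; rewrite H1 //= bmp.
have dS' : (part d n + part d n.+1 = x n + x n.+1)%N.
  move: dS; rewrite sE (sumn_part2 H4) -!addnA; under eq_bigr => i _ do rewrite H1' //.
  by move=> /addnI.
split; last by apply/(step_seqcomp _ xP1); split=> //; lia.
apply/eqP => /(congr1 (fun c : composition => part c n)); rewrite gE ltnS leqnSn; lia.
Qed.

Lemma RS_hess (RS : composition -> NSym) n x : row_strict_shin_basis RS -> incr_pos n x ->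
  RS (seqcomp n x) = hess nsE n x.
Proof.
move=> hRS; elim/ltn_ind: n x => -[|[|n]] IHn x xP.
- by rewrite hess0 -(RS0 hRS).
- have [x0 _] := xP; have P := pieri_nsE (RS_pieri hRS).
  have h1 : hess nsE 1 x = nsE (x 0%N).
    rewrite /hess big_mkcond (bigD1 1%g) //= [X in _ + X]big1 ?addr0 => [|s s1]; last first.
      by case/eqP: s1; apply/permP => i; apply: val_inj; rewrite /= !ord1.
    rewrite big_ord1 odd_perm1 expr0 scale1r perm1 ifT //.
    by apply/forallP => i; rewrite ord1.
  rewrite h1; have := P comp0 (x 0%N) (x0 0%N isT); rewrite (RS0 hRS) mul1r => ->.
  have cS : sumn (seqcomp 1 x) = x 0%N by rewrite sumn_seqcomp // big_ord1.
  have s0 : step true comp0 (seqcomp 1 x).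
    apply/stepP => -[|i]; rewrite part_comp0 part_seqcomp //; split=> // _ [|j] // _.
    by rewrite part_seqcomp.
  rewrite big_mkcond (bigD1_seq (seqcomp 1 x)) ?uniq_comps ?mem_comps ?cS //= s0.
  rewrite big1_seq ?addr0 // => d /andP[dne]; rewrite mem_comps => /eqP ds'.
  have ds : sumn d = x 0%N by rewrite ds' add0n.
  case: ifP => // /stepP/(_ 0%N)[_ _ H]; case/eqP: dne; apply: comp_ext => i.
  rewrite part_seqcomp //; rewrite part_comp0 /= in H.
  have d0 : (0 < part d 0%N)%N by rewrite lt0n; apply/eqP => d0;
    have := x0 0%N isT; rewrite -ds (sumn_part (leqnn _)) big1 // => j _; exact: down0_part d0.
  have dj j : part d j.+1 = 0%N by apply/eqP; rewrite -leqn0 H.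
  case: i => [|i] /=; last exact: dj.
  rewrite -ds (@sumn_part _ 1) ?big_ord1 //.
  by rewrite leqNgt -comp_part_gt0 dj.
rewrite RS_rec // hess_rec !IHn //; [exact: incr_pos_bump|exact: incr_posW].
Qed.

Lemma RS_increasing (RS : composition -> NSym) (gamma : composition) :
  row_strict_shin_basis RS ->
  (forall i, (i.+1 < size gamma)%N -> (part gamma i < part gamma i.+1)%N) ->
  RS gamma =
    \sum_(s : 'S_(size gamma) | [forall i : 'I_(size gamma), (i <= (s i).+1)%N])
      (-1) ^+ s *: \prod_(i < size gamma) nsE (part gamma (s i)).
Proof.
move=> hRS gS; rewrite -/(hess nsE _ _) -(RS_hess hRS); last first.
  by split=> // i ig; rewrite comp_part_gt0.
congr RS; apply: parts_inj; rewrite seqcompE; last by split=> // i ig; rewrite comp_part_gt0.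
exact/esym/mkseq_nth.
Qed.

(** * The forgetful map *)
Lemma partitionP (a : composition) :
  reflect (forall i, (part a i.+1 <= part a i)%N) (is_partition a).
Proof.
apply: (iffP (sortedP 0%N)) => H i; last by move=> _; apply: H.
have [ia|ai] := ltnP i.+1 (size a); first exact: H.
by rewrite part_default.
Qed.

Lemma partition_mono (a : composition) i j :
  is_partition a -> (i <= j)%N -> (part a j <= part a i)%N.
Proof.
move=> /partitionP H; elim: j => [|j IHj]; first by rewrite leqn0 => /eqP->.
by rewrite leq_eqVlt => /orP[/eqP->//|/IHj]; apply: leq_trans (H j).
Qed.

(** For a partition [l] the clause on later rows reduces to the next row, and the relation becomes
    the interlacing that characterizes horizontal strips. *)
Lemma hstripP (m l : composition) : is_partition l ->
  reflect (forall i, (part l i.+1 <= part m i <= part l i)%N) (step true m l).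
Proof.
move=> lP; apply: (iffP (stepP _ _ _)) => H i.
  have [le _ K] := H i; rewrite le andbT; have := partition_mono lP (leqnSn i).
  by have := K _ i.+1 (ltnSn i); lia.
have /andP[H1 H2] := H i; split=> // _ j ij.
by apply: leq_trans H1; apply: partition_mono.
Qed.

Lemma hstrip_partition (m l : composition) :
  is_partition l -> step true m l -> is_partition m.
Proof.
move=> lP /(hstripP m lP) H; apply/partitionP => i.
by have /andP[+ _] := H i; have /andP[_ +] := H i.+1; apply: leq_trans.
Qed.

Section LocalRule.
Variables (l v : composition) (m : nat).
Hypotheses (lP : is_partition l) (vP : is_partition v).

Let mn i := minn (part l i) (part v i).
Let mx i := maxn (part l i) (part v i).
Let L := (size l + size v)%N.

Let L0 i : (L <= i)%N -> (part l i = 0%N) * (part v i = 0%N).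
Proof. by rewrite /L => Li; rewrite !part_default //; lia. Qed.

Let mxmn : (\sum_(i < L) mn i + (mx 0 + \sum_(i < L) mx i.+1) = sumn l + sumn v)%N.
Proof.
have -> : (mx 0 + \sum_(i < L) mx i.+1 = \sum_(i < L) mx i)%N.
  rewrite -(big_ord_recl L (fun i : 'I_L.+1 => mx i)) big_ord_recr /=.
  by rewrite {2}/mx !L0 // maxnn addn0.
rewrite -big_split (@sumn_part l L) ?(@sumn_part v L) ?leq_addl ?leq_addr // -big_split.
by apply: eq_bigr => i _ /=; rewrite /mn /mx; lia.
Qed.

(** No equation of the local rule involves row 0; its length is chosen so that the total size
    becomes [sumn l + m]. *)
Let up (u : composition) : composition :=
  comp_of_fun (fun i => if i is k.+1 then mn k + mx i - part u k else mx 0 + (sumn u + m - sumn v))%N L.+1.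

Let down (r : composition) : composition :=
  comp_of_fun (fun i => mn i + mx i.+1 - part r i.+1)%N L.

Let upP (u : composition) : step true u l -> step true u v -> (sumn v <= sumn u + m)%N ->
  [/\ forall k, part (up u) k.+1 = (mn k + mx k.+1 - part u k)%N,
      part (up u) 0 = (mx 0 + (sumn u + m - sumn v))%N & is_partition (up u)].
Proof.
move=> /(hstripP u lP) ul /(hstripP u vP) uv _.
set f := fun i => if i is k.+1 then (mn k + mx i - part u k)%N else (mx 0 + (sumn u + m - sumn v))%N.
have fS i : (f i.+1 <= f i)%N.
  case: i => [|i]; rewrite /f /mn /mx.
    by have := ul 0%N; have := uv 0%N; have := ul 1%N; have := uv 1%N; lia.
  by have := ul i; have := uv i; have := ul i.+1; have := uv i.+1; lia.
have fmono i j : (i <= j)%N -> (f j <= f i)%N.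
  elim: j => [|j IHj]; first by rewrite leqn0 => /eqP->.
  by rewrite leq_eqVlt => /orP[/eqP->//|/IHj]; apply: leq_trans (fS j).
have upE : part (up u) =1 f.
  apply: part_comp_of_fun => [i j ij fi|[//|i] Li].
    by have := fmono _ _ ij; move: fi; rewrite -/(f i) => ->; rewrite leqn0 => /eqP.
  by rewrite /f /mn /mx !L0 //; lia.
split=> [k||]; rewrite ?upE //.
by apply/partitionP => i; rewrite !upE.
Qed.

Let sumn_up (u r : composition) :
  (forall k, part r k.+1 + part u k = mn k + mx k.+1)%N ->
  (sumn r + mx 0 + sumn u = part r 0 + sumn l + sumn v)%N.
Proof.
move=> ur; have u0 k : (L <= k)%N -> part u k = 0%N /\ part r k.+1 = 0%N.
  move=> Lk; have := ur k; rewrite /mn /mx !L0 //; lia.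
have su : (size u <= L)%N by rewrite leqNgt -comp_part_gt0 -leqNgt (u0 L _).1.
have sr : (size r <= L.+1)%N by rewrite leqNgt -comp_part_gt0 -leqNgt (u0 L _).2.
have -> : sumn r = (part r 0 + \sum_(i < L) part r i.+1)%N.
  by rewrite (sumn_part sr) big_ord_recl.
have : (\sum_(i < L) part r i.+1 + \sum_(i < L) part u i =
   \sum_(i < L) mn i + \sum_(i < L) mx i.+1)%N.
  by rewrite -!big_split; apply: eq_bigr => i _; rewrite /= ur.
by rewrite (sumn_part su); have := mxmn; lia.
Qed.

(* The local rule of growth diagrams: [u] and [r] determine each other by
   [r_(k+1) + u_k = min (l_k, v_k) + max (l_(k+1), v_(k+1))]. *)
Lemma local_rule :
  (\sum_(u <- comps_range 0 (sumn l) | [&& step true u l, step true u v & sumn v <= sumn u + m]) 1 =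
   \sum_(r <- comps (sumn l + m) | [&& is_partition r, step true l r & step true v r]) 1)%N.
Proof.
apply: (@big_seq_bij _ _ _ _ _ _ _ down up (fun=> 1%N)).
- exact: uniq_comps_range.
- exact: uniq_comps.
- move=> u _ /and3P[ul uv uvm]; have [E1 E2 rP] := upP ul uv uvm.
  move/(hstripP u lP): (ul) => Hl; move/(hstripP u vP): (uv) => Hv.
  have ur k : (part (up u) k.+1 + part u k = mn k + mx k.+1)%N.
    by rewrite E1 /mn /mx; have := Hl k; have := Hv k; lia.
  split.
  + by rewrite mem_comps; apply/eqP; have := sumn_up ur; rewrite E2; lia.
  + rewrite rP andTb; apply/andP; split; apply/(hstripP _ rP) => -[|i]; rewrite ?E2 !E1 /mn /mx.
    * by have := Hl 0%N; have := Hv 0%N; have := Hl 1%N; have := Hv 1%N; lia.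
    * by have := Hl i; have := Hv i; have := Hl i.+1; have := Hv i.+1; lia.
    * by have := Hl 0%N; have := Hv 0%N; have := Hl 1%N; have := Hv 1%N; lia.
    * by have := Hl i; have := Hv i; have := Hl i.+1; have := Hv i.+1; lia.
  + apply: comp_ext => i; rewrite part_comp_of_fun.
    * by rewrite E1 /mn /mx; have := Hl i; have := Hv i; lia.
    * move=> j k jk; have := ur j; have := ur k; have := down0_part jk (a := u); lia.
    * by move=> j /L0 Lj; rewrite E1 /mn /mx; have := Hl j; have := Hv j; rewrite !Lj; lia.
- move=> r; rewrite mem_comps => /eqP rm /and3P[rP /(hstripP l rP) lr /(hstripP v rP) vr].
  have dE i : part (down r) i = (mn i + mx i.+1 - part r i.+1)%N.
    apply: (part_comp_of_fun (f := fun i => (mn i + mx i.+1 - part r i.+1)%N)) => [j k jk|j Lj].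
      rewrite /mn /mx; have [->//|jk'] : j = k \/ (j < k)%N by lia.
      have := partition_mono lP jk'; have := partition_mono vP jk'.
      have := lr j.+1; have := vr j.+1; have := lr k.+1; have := vr k.+1.
      by have := lr j; have := vr j; have := lr k; have := vr k; lia.
    by rewrite /mn /mx !L0 //; lia.
  have ru k : (part r k.+1 + part (down r) k = mn k + mx k.+1)%N.
    by rewrite dE /mn /mx; have := lr k; have := vr k; lia.
  have szE := sumn_up ru.
  have r0 : (mx 0 <= part r 0)%N by have := lr 0%N; have := vr 0%N; rewrite /mx; lia.
  have dl : step true (down r) l.
    by apply/(hstripP _ lP) => i; rewrite dE /mn /mx; have := lr i; have := vr i; 
      have := lr i.+1; have := vr i.+1; lia.
  have dv : step true (down r) v.
    by apply/(hstripP _ vP) => i; rewrite dE /mn /mx; have := lr i; have := vr i; 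
      have := lr i.+1; have := vr i.+1; lia.
  have dm : (sumn v <= sumn (down r) + m)%N by lia.
  split; first by rewrite mem_comps_range add0n (step_sumn dl).
    by rewrite dl dv dm.
  have [E1 E2 _] := upP dl dv dm; apply: comp_ext => -[|i].
    by rewrite E2; lia.
  by rewrite E1; have := ru i; lia.
Qed.

End LocalRule.

(** * Schur polynomials by recursion on the number of variables *)

Section SchurRecursion.
Variables (A : comPzRingType) (x : nat -> A).

Fixpoint schur_rec (N : nat) (g : composition) : A :=
  if N is M.+1 then
    \sum_(d <- comps_range 0 (sumn g) | step true d g) x M ^+ (sumn g - sumn d) * schur_rec M d
  else (g == comp0)%:R.

Fixpoint hsym_rec (N m : nat) : A :=
  if N is M.+1 then \sum_(j < m.+1) x M ^+ (m - j) * hsym_rec M j else (m == 0)%:R.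

Lemma schur_recS N g : schur_rec N.+1 g =
  \sum_(d <- comps_range 0 (sumn g) | step true d g) x N ^+ (sumn g - sumn d) * schur_rec N d.
Proof. by []. Qed.

Lemma schur_rec0 N : schur_rec N comp0 = 1.
Proof.
elim: N => [//|N IHN].
by rewrite schur_recS /comps_range /= big_cons big_nil IHN subnn expr0 mul1r addr0.
Qed.

Lemma schur_rec_chains N (g : composition) :
  \sum_(c <- Chains true comp0 g N) \prod_(p < N) x p ^+ nth 0%N (ctype c) p = schur_rec N g.
Proof.
elim: N g => [|N IHN] g.
  rewrite /= eq_sym; case: eqP => _; first by rewrite big_seq1 big_ord0.
  by rewrite big_nil.
rewrite ChainsS big_flatten big_map big_filter schur_recS; apply: eq_bigr => d _.
rewrite big_map -IHN mulr_sumr; apply: eq_big_seq => c /ChainsP[sz _ cN _].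
rewrite big_ord_recr /= mulrC ctype_rcons -?size_eq0 ?sz //= cN.
rewrite nth_rcons size_ctype sz /= ltnn eqxx; congr (_ * _).
by apply: eq_bigr => p _; rewrite nth_rcons size_ctype sz /= ltn_ord.
Qed.

(* Peeling off the last variable on both sides reduces the Pieri rule to [local_rule]. *)
Lemma pieri_schur_rec N m (l : composition) : is_partition l ->
  schur_rec N l * hsym_rec N m = \sum_(r <- comps (sumn l + m) | is_partition r && step true l r) schur_rec N r.
Proof.
elim: N m l => [|N IHN] m l lP.
  rewrite /= -natrM mulnb.
  have [->|m0] := eqVneq m 0%N.
    rewrite addn0 andbT; under eq_bigl do rewrite andbC.
    by rewrite big_mkcondr big_step0 lP.
  rewrite andbF big1_seq // => r /andP[_]; rewrite mem_comps => /eqP rm.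
  by case: eqP => // r0; move: rm m0; rewrite r0 /=; case: (m) => // k; rewrite addnS.
rewrite schur_recS [hsym_rec _ _]/= mulr_suml.
pose r := comps_range 0 (sumn l + m).
transitivity (\sum_(u <- comps_range 0 (sumn l) | step true u l)
   \sum_(v <- r) if [&& is_partition v, step true u v & (sumn v <= sumn u + m)%N]
     then x N ^+ (sumn l + m - sumn v) * schur_rec N v else 0).
  apply: eq_bigr => u ul; have uP := hstrip_partition lP ul.
  transitivity (\sum_(v <- comps_range (sumn u) m | is_partition v && step true u v)
     x N ^+ (sumn l + m - sumn v) * schur_rec N v).
    rewrite big_comps_range mulr_sumr; apply: eq_bigr => j _.
    rewrite mulrACA -exprD IHN // mulr_sumr; apply: eq_bigr_seq => v.
    rewrite mem_comps => /eqP vE _; congr (_ ^+ _ * _).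
    by have := step_sumn ul; have := ltn_ord j; lia.
  rewrite -[RHS]big_mkcond -[LHS]big_filter -[RHS]big_filter; apply: perm_big; apply: uniq_perm.
  - by rewrite filter_uniq ?uniq_comps_range.
  - by rewrite filter_uniq ?uniq_comps_range.
  move=> v; rewrite !mem_filter !mem_comps_range add0n -!andbA; congr (_ && _).
  case: (boolP (step true u v)) => //= /step_sumn uv.
  by have := step_sumn ul; lia.
rewrite exchange_big.
transitivity (\sum_(r' <- comps (sumn l + m) | is_partition r' && step true l r')
   \sum_(v <- r) if is_partition v && step true v r'
     then x N ^+ (sumn l + m - sumn v) * schur_rec N v else 0); last first.
  apply: eq_bigr_seq => r' + /andP[rP _]; rewrite mem_comps => /eqP rm.
  rewrite schur_recS rm [RHS]big_mkcond; apply: eq_bigr => v _.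
  by case: (boolP (step true v r')) => [/(hstrip_partition rP)->|_]; rewrite ?andbF.
(* The summands depend only on [v], so it remains to compare the number of partitions below both [l]
   and [v] with the number of those above both. *)
rewrite [RHS]exchange_big /=; apply: eq_bigr => v _.
have [vP|_] /= := boolP (is_partition v); last by rewrite !big1.
rewrite -!big_mkcondr /= -[in LHS](mulr1n (_ * _)) -[in RHS](mulr1n (_ * _)) !sumrMnr.
congr (_ *+ _); apply: etrans (etrans _ (local_rule m lP vP)) _.
  by apply: eq_bigl => u; rewrite !andbA.
by apply: eq_bigl => u; rewrite !andbA.
Qed.

End SchurRecursion.

(** * Conjugate partitions and the transposition of strips *)

Definition conj (l : composition) : composition := mkcomp (conj_part l).

Lemma count_partition (l : seq nat) i j : is_partition l ->
  (i < count (fun x => j < x)%N l)%N = (j < part l i)%N.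
Proof.
rewrite /part; elim: l i => [|x l IHl] i; first by rewrite nth_nil.
move=> xl; have lP : is_partition l by move: xl; apply: path_sorted.
rewrite /=; case: (ltnP j x) => jx; first by case: i => [|i] //=; rewrite add1n ltnS IHl.
have le k : (nth 0%N (x :: l) k <= j)%N.
  have [kl|lk] := ltnP k (size (x :: l)); last by rewrite nth_default.
  apply: leq_trans jx; case: k kl => // k kl /=.
  have : all (geq x) l by apply: order_path_min xl => ? ? ? /= *; lia.
  by move=> /allP; apply; apply: mem_nth.
rewrite add0n; have -> : count (fun y => (j < y)%N) l = 0%N.
  apply/eqP; rewrite -leqn0 leqNgt -has_count; apply/hasPn => y yl /=.
  by rewrite -leqNgt; have := le (index y l).+1; rewrite /= nth_index.
by rewrite ltn0; have := le i; lia.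
Qed.

Lemma conj_partE (l : composition) : is_partition l -> conj l = conj_part l :> seq nat.
Proof.
move=> lP; rewrite mkcomp_id //; apply/mapP => -[j]; rewrite mem_iota add0n => /= jl.
by move/esym/eqP; apply/negP; rewrite -lt0n count_partition // /part nth0.
Qed.

(** Transposition box by box; involutivity, the invariance of the size and the effect on strips are
    all read off from this equivalence. *)
Lemma part_conj (l : composition) i j : is_partition l ->
  (i < part (conj l) j)%N = (j < part l i)%N.
Proof.
move=> lP; rewrite conj_partE // /part; have [jl|lj] := ltnP j (head 0%N l).
  by rewrite (nth_map 0%N) ?size_iota // nth_iota // count_partition.
rewrite nth_default ?size_map ?size_iota // ltn0; apply/esym/negbTE; rewrite -leqNgt.
by apply: leq_trans lj; rewrite -nth0; apply: (@partition_mono l 0 i).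
Qed.

Lemma conj_partition (l : composition) : is_partition l -> is_partition (conj l).
Proof.
move=> lP; apply/partitionP => j; rewrite leqNgt; apply/negP.
by rewrite part_conj // => H; have := part_conj (part (conj l) j) j lP; lia.
Qed.

Lemma conjK (l : composition) : is_partition l -> conj (conj l) = l.
Proof.
move=> lP; apply: comp_ext => i.
have E k : (k < part (conj (conj l)) i)%N = (k < part l i)%N.
  by rewrite (part_conj _ _ (conj_partition lP)) part_conj.
by apply/eqP; rewrite eqn_leq leqNgt E ltnn leqNgt -E ltnn.
Qed.

Lemma sumn_conj (l : composition) : is_partition l -> sumn (conj l) = sumn l.
Proof.
move=> lP; pose L := (size l + size (conj l) + sumn l + sumn (conj l))%N.
have cnt (a : composition) i : (sumn a <= L)%N -> part a i = (\sum_(j < L) (j < part a i))%N.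
  move=> aL; have : (part a i <= L)%N by apply: leq_trans (part_le_sumn a i) aL.
  move: (part a i) => n nL; rewrite -{1}[n]card_ord -sum1_card (big_ord_widen _ (fun=> 1%N) nL).
  by rewrite big_mkcond; apply: eq_bigr => j _; case: ltnP.
rewrite (@sumn_part _ L) ?(@sumn_part l L) /L; try lia.
transitivity (\sum_(i < L) \sum_(j < L) (j < part (conj l) i))%N.
  by apply: eq_bigr => i _; apply: cnt; rewrite /L; lia.
rewrite exchange_big; apply: eq_bigr => j _; rewrite [RHS]cnt; last by rewrite /L; lia.
by apply: eq_bigr => i _; rewrite part_conj.
Qed.

(** Between partitions the clause on later rows in [step false] is automatic and leaves the vertical
    strips, whose transposes are the horizontal ones. *)
Lemma step_conj (l d : composition) : is_partition l -> is_partition d ->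
  step false l d = step true (conj l) (conj d).
Proof.
move=> lP dP; have cdP := conj_partition dP.
apply/stepP/(hstripP (conj l) cdP) => H.
  move=> j; rewrite leqNgt (part_conj _ _ dP) [X in _ && X]leqNgt part_conj // -!leqNgt.
  have [_ h2 _] := H (part (conj l) j); have [h1 _ _] := H (part (conj d) j).
  have := part_conj (part (conj l) j) j lP; have := part_conj (part (conj d) j) j dP.
  by move: h1 h2; rewrite /= !ltnn; lia.
move=> i; split.
- rewrite leqNgt; apply/negP; rewrite -(part_conj _ _ lP).
  have /andP[_ h] := H (part d i) => h'; have := leq_trans h' h.
  by rewrite part_conj // ltnn.
- rewrite /= leqNgt; apply/negP; rewrite -(part_conj _ _ dP).
  have /andP[h _] := H (part l i) => h'; have := leq_trans h' h.
  by rewrite part_conj // ltnn.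
- by move=> _ j ij; apply: partition_mono (ltnW ij).
Qed.

Section Variables.
Variable N : nat.

Definition var (p : nat) : mpoly N rat := oapp (fun i : 'I_N => 'X_i) 0 (insub p).

Lemma varE (i : 'I_N) : var i = 'X_i.
Proof. by rewrite /var valK. Qed.

Lemma schur_schur_rec (g : composition) : schur g N = schur_rec var N g.
Proof.
rewrite -schur_rec_chains -(big_tabs g comp0 N _ true).
apply: eq_big => [T|T tT]; first by rewrite skew_shape0.
rewrite [LHS]mpolyXE_id; apply: eq_bigr => i _.
by rewrite varE (@tab_type_chain g comp0 N true T i (skew_shape0 g) tT).
Qed.

(** A geometric series cut at degree [M]. Up to that degree the product over all variables is the
    generating series of the complete homogeneous polynomials, and it expands over finitely many
    exponent vectors. *)
Let Q (M p : nat) : {poly mpoly N rat} := \poly_(j < M.+1) var p ^+ j.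

Let coefQ M k n : (n <= M)%N -> (\prod_(p < k) Q M p)`_n = hsym_rec var k n.
Proof.
elim: k n => [|k IHk] n nM; first by rewrite big_ord0 coef1.
rewrite big_ord_recr coefM /=; apply: eq_bigr => j _.
by rewrite IHk ?coef_poly ?ifT 1?mulrC //; have := ltn_ord j; lia.
Qed.

Lemma hsym_hsym_rec n : hsym n N = hsym_rec var N n.
Proof.
rewrite -(@coefQ n N n (leqnn n)).
under eq_bigr do rewrite /Q poly_def.
rewrite bigA_distr_bigA coef_sum /=.
pose mnm (f : {ffun 'I_N -> 'I_n.+1}) : 'X_{1..N} := [multinom val (f i) | i < N].
transitivity (\sum_(f : {ffun 'I_N -> 'I_n.+1} | mdeg (mnm f) == n) 'X_[mnm f] : mpoly N rat); last first.
  rewrite big_mkcond; apply: eq_bigr => f _.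
  rewrite scaler_prod prodrXr coefZ coefXn.
  have -> : (\sum_(i < N) f i = mdeg (mnm f))%N.
    by rewrite mdegE; apply: eq_bigr => i _; rewrite mnmE.
  rewrite eq_sym; case: eqP => _; rewrite ?mulr0 // mulr1 mpolyXE_id.
  by apply: eq_bigr => i _; rewrite mnmE varE.
have p0 : (mdeg (0%MM : 'X_{1..N}) < n.+1)%N by rewrite mdeg0.
rewrite /hsym; apply/esym.
pose h (m : 'X_{1..N < n.+1}) : {ffun 'I_N -> 'I_n.+1} := [ffun i => inord (bmnm m i)].
have hE (m : 'X_{1..N < n.+1}) : mnm (h m) = m.
  apply/mnmP => i; rewrite mnmE ffunE /= inordK //; apply: leq_ltn_trans (bmdeg m).
  by rewrite mdegE (bigD1 i) //= leq_addr.
have hK (f : {ffun 'I_N -> 'I_n.+1}) : mdeg (mnm f) = n ->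
    bmnm (insubd (BMultinom p0) (mnm f)) = mnm f.
  by move=> fn; rewrite -[bmnm _]/(val _) val_insubd fn ltnSn.
rewrite [LHS](@big_seq_bij _ _ _ _ (index_enum _) _ (fun m : 'X_{1..N < n.+1} => mdeg m == n)
  h (fun f => insubd (BMultinom p0) (mnm f))) ?index_enum_uniq //.
- by apply: eq_bigr => m _; rewrite hE.
- move=> f _ /eqP fn; rewrite hK // fn eqxx mem_index_enum; split=> //.
  by apply/ffunP => i; apply: val_inj; rewrite ffunE /= hK // mnmE inord_val.
- move=> m _ mn; rewrite hE mn mem_index_enum; split=> //.
  exact: valKd.
Qed.

End Variables.

Section Characteristic.
Variable N : nat.

Definition cschur (a : composition) : mpoly N rat :=
  if is_partition a then schur (conj_part a) N else 0.

Lemma cschur_conj (a : composition) : is_partition a -> cschur a = schur_rec (var N) N (conj a).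
Proof. by move=> aP; rewrite /cschur aP -conj_partE // schur_schur_rec. Qed.

(** For partitions this is the conjugate of the Pieri rule for Schur polynomials. If [a] is not a
    partition, a row shorter than the next one cannot grow, so no step from [a] leads to a partition
    and both sides vanish. *)
Lemma pieri_cschur : pieri false cschur (fun m => hsym m N).
Proof.
move=> a m m0; have [aP|aP] := boolP (is_partition a); last first.
  rewrite /cschur (negPf aP) mul0r big1 // => d /stepP ad; case: ifP => // /partitionP dP.
  case/negP: aP; apply/partitionP => i; rewrite leqNgt; apply/negP => ai.
  have [h1 _ h3] := ad i; have [h2 _ _] := ad i.+1; have := dP i.
  have [|lt] : part d i = part a i \/ (part a i < part d i)%N by lia.
    by lia.
  by have := h3 lt i.+1 (ltnSn i); lia.
rewrite cschur_conj // hsym_hsym_rec pieri_schur_rec ?conj_partition // sumn_conj //.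
transitivity (\sum_(d <- comps (sumn a + m) | is_partition d && step false a d) cschur d).
  rewrite (@big_seq_bij _ _ _ _ (comps (sumn a + m)) _
     (fun d => is_partition d && step false a d) conj conj) ?uniq_comps //.
  - by apply: eq_bigr => d /andP[dP _]; rewrite cschur_conj.
  - move=> r; rewrite !mem_comps => rm /andP[rP ar].
    rewrite sumn_conj // conj_partition // conjK // step_conj ?conj_partition // conjK //.
  - move=> d; rewrite !mem_comps => dm /andP[dP ad].
    by rewrite sumn_conj // conj_partition // conjK // -step_conj.
rewrite big_mkcond [RHS]big_mkcond; apply: eq_bigr => d _.
by rewrite /cschur; case: (is_partition d) => //=; case: ifP.
Qed.

Lemma cschur0 : cschur comp0 = 1.
Proof.
have c0 : conj comp0 = comp0 by apply: parts_inj.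
by rewrite cschur_conj // c0 schur_rec0.
Qed.

Lemma chi_nsHc (c : composition) : chi (nsHc c) N = \prod_(i <- c) hsym i N.
Proof. by rewrite chiE nsHcE monalg.mmapU mul1r. Qed.

(** The products of [hsym] expand in [cschur] with the same tableau numbers that define the duality,
    so [RS_orth] applied to the H-expansion of [RS a] leaves [cschur a] alone. *)
Lemma chi_RS (RS : composition -> NSym) (a : composition) : row_strict_shin_basis RS ->
  chi (RS a) N = cschur a.
Proof.
move=> hRS; rewrite {1}(RS_nsHc hRS) chiE raddf_sum /=.
transitivity (\sum_(c <- comps (sumn a)) \sum_(g <- comps (sumn a))
  (monalg.mcoeff c (RS a) * (nb_tab false comp0 g c)%:R) *: cschur g).
  apply: eq_big_seq => c; rewrite mem_comps => /eqP ca.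
  rewrite monalg.mmapZ -chiE chi_nsHc /= mul_mpolyC.
  have := pieri_prod pieri_cschur comp0 c; rewrite cschur0 mul1r ca => ->.
  rewrite scaler_sumr; apply: eq_bigr => g _.
  by rewrite -scalerA scaler_nat.
rewrite exchange_big /= (bigD1_seq a) ?mem_comps ?uniq_comps //= -scaler_suml RS_orth //.
rewrite eqxx scale1r big1 ?addr0 // => g ga.
by rewrite -scaler_suml RS_orth // eq_sym (negPf ga) scale0r.
Qed.

End Characteristic.

Theorem theorem5p5 (RS Sh : composition -> NSym)
    (hRS : row_strict_shin_basis RS) (hSh : shin_basis Sh)
    (alpha beta : composition) (m : nat) (hm : (0 < m)%N) :
  RS alpha * nsE m =
    \sum_(delta <- comps (sumn alpha + m) | shin_sub m alpha delta) RS delta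
  /\
  RS alpha * nsR beta =
    \sum_(gamma <- comps (sumn alpha + sumn beta))
      \sum_(U : full_filling gamma alpha |
              [&& standard U, skew_rs_tab U & co_RS U == beta]) RS gamma
  /\
  (nsEc beta = \sum_(a <- comps (sumn beta)) (K_sh a beta)%:R *: RS a /\
   nsR beta = \sum_(a <- comps (sumn beta)) (L_sh a (comp_compl beta))%:R *: RS a)
  /\
  ((forall lambda : composition, is_partition lambda ->
      forall N, chi (RS lambda) N = schur (conj_part lambda) N) /\
   (forall a : composition, ~~ is_partition a ->
      forall N, chi (RS a) N = 0))
  /\
  (forall gamma : composition,
     (forall i : nat, (i.+1 < size gamma)%N ->
        (part gamma i < part gamma i.+1)%N) ->
     RS gamma =
       \sum_(s : 'S_(size gamma) | [forall i : 'I_(size gamma), (i <= (s i).+1)%N])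
         (-1) ^+ s *: \prod_(i < size gamma) nsE (part gamma (s i)))
  /\
  (nsEc beta = \sum_(a <- comps (sumn beta)) (K_RS a beta)%:R *: Sh a /\
   nsR beta = \sum_(a <- comps (sumn beta)) (L_RS a (comp_compl beta))%:R *: Sh a).
Proof.
split; first exact: RS_nsE.
split; first exact: RS_nsR.
split; first by split; [apply: nsEc_RS | apply: nsR_RS].
split.
  split=> a aP N; rewrite (chi_RS N a hRS) /cschur; first by rewrite aP.
  by rewrite (negPf aP).
split; first by move=> gamma; apply: RS_increasing.
by split; [apply: nsEc_Sh | apply: nsR_Sh].
Qed.
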